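(* Let $H$ be a semisimple Hopf algebra over $k$, $K$ a Hopf subalgebra of $H$, and $C$ a simple subcoalgebra of $H$ with associated irreducible character $c\in\mathrm{Irr}(H^* )$. Then the set $${}^cK=\{d\in\mathrm{Irr}(H^* )\ |\ dc\Lambda_K=\epsilon(d)c\Lambda_K\}$$ is closed under multiplication and under ${}^*$, and it generates a Hopf subalgebra ${}^CK$ of $H$; thus ${}^CK=\bigoplus_{d\in{}^cK}C_d$.
   Context: $k$ is an algebraically closed field of characteristic zero; $H$ is a semisimple (hence finite dimensional and cosemisimple) Hopf algebra over $k$ with counit $\epsilon$ and antipode $S$. Irreducible characters of $H^*$ are viewed as elements of $H$; they correspond bijectively to simple subcoalgebras: a simple subcoalgebra $C$ with comatrix basis $(x_{ij})$, $\Delta(x_{ij})=\sum_l x_{il}\otimes x_{lj}$, corresponds to $c=\sum_i x_{ii}$; one writes $C=C_c$. $\mathrm{Irr}(H^* )$ is the set of these characters. $\Lambda_K\in K$ is the integral of $K$ with $\epsilon(\Lambda_K)=1$. For $d,d'\in\mathrm{Irr}(H^* )$ one has $dd'=\sum_{e\in\mathrm{Irr}(H^* )}m^e_{d,d'}e$ with nonnegative integers $m^e_{d,d'}$. A subset $X\subseteq\mathrm{Irr}(H^* )$ is closed under multiplication if for all $d,d'\in X$, $m^e_{d,d'}\ne0$ implies $e\in X$; it is closed under ${}^*$ if $d^*:=S(d)\in X$ for all $d\in X$. The subspace generated by $X$ is $H(X)=\bigoplus_{x\in X}C_x$. *)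

(* Defs.v *)
(* MathComp: Hopf algebras over a field, on top of the finite-dimensional
   (unital, associative) algebras [falgType k]. *)
From HB Require Import structures.
From mathcomp Require Import all_boot all_order all_algebra all_field.

Set Implicit Arguments.
Unset Strict Implicit.
Unset Printing Implicit Defensive.

Import GRing.Theory.
Local Open Scope ring_scope.

(* Tensor products.  [tensor U V] is represented by coordinates in the tensor
   square of the chosen bases [vbasis {:U}] and [vbasis {:V}].  It is declared
   only as a vector space: for U = V the carrier is also a ring of square
   matrices, but the matrix product is not the product of the algebra U (x) U,
   which is [tmul] below. *)

Section Tensor.
Variable k : fieldType.
Implicit Types U V W : vectType k.

Definition tensor U V : vectType k := 'M[k]_(\dim {:U}, \dim {:V}).

Definition tens U V (u : U) (v : V) : tensor U V :=
  \matrix_(i, j) (coord (vbasis {:U}) i u * coord (vbasis {:V}) j v).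

(* The linear map induced by a bilinear map f (see [tlift_tens]).  Thus, for
   t = \Delta h, [tlift f t] is the Sweedler sum of the f h_(1) h_(2). *)
Definition tlift U V W (f : U -> V -> W) (t : tensor U V) : W :=
  \sum_i \sum_j (t : 'M[k]_(_, _)) i j *: f (vbasis {:U})`_i (vbasis {:V})`_j.

Lemma tlift_tens U V W (f : U -> V -> W) :
    (forall v, linear (f^~ v)) -> (forall u, linear (f u)) ->
  forall u v, tlift f (tens u v) = f u v.
Proof.
move=> fl fr u v.
pose gl v : {linear U -> W} := HB.pack (f^~ v) (GRing.isLinear.Build _ _ _ _ _ (fl v)).
pose gr u : {linear V -> W} := HB.pack (f u) (GRing.isLinear.Build _ _ _ _ _ (fr u)).
have -> : f u v = gl v u by [].
rewrite {2}(coord_vbasis (memvf u)) linear_sum; apply: eq_bigr => i _.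
rewrite linearZ /=; set b := _`_i; have -> : f b v = gr b v by [].
rewrite [in RHS](coord_vbasis (memvf v)) linear_sum scaler_sumr.
by apply: eq_bigr => j _; rewrite linearZ /= !mxE scalerA.
Qed.

(* The image of A (x) B in U (x) V. *)
Definition tensv U V (A : {vspace U}) (B : {vspace V}) : {vspace tensor U V} :=
  <<[seq tens a b | a <- vbasis A, b <- vbasis B]>>%VS.

Definition tmul (A : falgType k) (s t : tensor A A) : tensor A A :=
  tlift (fun a b => tlift (fun a' b' => tens (a * a') (b * b')) t) s.

End Tensor.

Structure hopfAlgType (k : fieldType) := HopfAlgType {
  hopf_sort :> falgType k;
  comul : {linear hopf_sort -> tensor hopf_sort hopf_sort};
  counit : {linear hopf_sort -> k | *%R};
  antipode : {linear hopf_sort -> hopf_sort};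
  comulA : forall h : hopf_sort,
    tlift (fun a b => tlift (fun a1 a2 => tens a1 (tens a2 b)) (comul a))
      (comul h)
    = tlift (fun a b => tens a (comul b)) (comul h);
  counitl : forall h : hopf_sort, tlift (fun a b => counit a *: b) (comul h) = h;
  counitr : forall h : hopf_sort, tlift (fun a b => counit b *: a) (comul h) = h;
  comul1 : comul 1 = tens (1 : hopf_sort) (1 : hopf_sort);
  comulM : forall g h : hopf_sort, comul (g * h) = tmul (comul g) (comul h);
  counit1 : counit 1 = 1;
  counitM : forall g h : hopf_sort, counit (g * h) = counit g * counit h;
  antipodel : forall h : hopf_sort,
    tlift (fun a b => antipode a * b) (comul h) = (counit h)%:A;
  antipoder : forall h : hopf_sort,
    tlift (fun a b => a * antipode b) (comul h) = (counit h)%:A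
}.

Arguments comul {k _}.
Arguments counit {k _}.
Arguments antipode {k _}.

Section Semisimple.
Variables (k : fieldType) (A : falgType k).

Definition left_ideal (I : {vspace A}) := (fullv * I <= I)%VS.

(* The regular left module A is completely reducible.  (Left ideals of A are
   automatically k-subspaces.) *)
Definition semisimple : Prop :=
  forall I : {vspace A}, left_ideal I ->
    exists J : {vspace A},
      [/\ left_ideal J, (I + J)%VS = fullv & (I :&: J)%VS = 0%VS].

End Semisimple.

Section HopfTheory.
Variables (k : fieldType) (H : hopfAlgType k).
Implicit Types (K C D L : {vspace H}) (c d e : H) (X : H -> Prop).

Definition subcoalgebra C : Prop :=
  forall x, x \in C -> comul x \in tensv C C.

Definition simple_subcoalgebra C : Prop :=
  [/\ subcoalgebra C, C <> 0%VS
    & forall D, subcoalgebra D -> (D <= C)%VS -> D = 0%VS \/ D = C].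

Definition hopf_subalgebra K : Prop :=
  [/\ 1 \in K, (K * K <= K)%VS, subcoalgebra K
    & forall x, x \in K -> antipode x \in K].

(* The values [counit (x i j)] = (i == j)%:R are forced by the counit axioms. *)
Definition comatrix_basis C n (x : 'M[H]_n) : Prop :=
  basis_of C [seq x i j | i <- enum 'I_n, j <- enum 'I_n]
  /\ forall i j, comul (x i j) = \sum_l tens (x i l) (x l j).

(* C = C_c *)
Definition has_character C c : Prop :=
  simple_subcoalgebra C /\
  exists n (x : 'M[H]_n), comatrix_basis C x /\ c = \tr x.

(* Irr(H^* ), as a subset of H *)
Definition Irr d : Prop := exists C, has_character C d.

(* The m e, for e in Irr(H^* ), are the multiplicities m^e_{d,d'}; the values
   of m outside Irr(H^* ) are irrelevant. *)
Definition multiplicities d d' (m : H -> nat) : Prop :=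
  exists s : seq H,
    [/\ uniq s, forall e, e \in s <-> Irr e
      & d * d' = \sum_(e <- s) e *+ m e].

(* The first conjunct (existence of the m^e_{d,d'}) only makes sure that the
   second one is not vacuous. *)
Definition closed_under_mul X : Prop :=
  forall d d', X d -> X d' ->
    (exists m, multiplicities d d' m) /\
    (forall m, multiplicities d d' m -> forall e, Irr e -> m e <> 0%N -> X e).

Definition closed_under_star X : Prop := forall d, X d -> X (antipode d).

(* L = H(X), the direct sum of the C_x for x in X, where (d i) enumerates X
   without repetition. *)
Definition generates X L : Prop :=
  exists n (d : 'I_n -> H) (C : 'I_n -> {vspace H}),
    [/\ injective d, forall x, X x <-> exists i, x = d i,
        forall i, has_character (C i) (d i), directv (\sum_i C i)
      & L = (\sum_i C i)%VS].

(* La is the integral of K, normalized by counit La = 1. *)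
Definition normalized_integral K (La : H) : Prop :=
  [/\ La \in K,
      forall x, x \in K -> x * La = counit x *: La /\ La * x = counit x *: La
    & counit La = 1].

(* {}^cK, in terms of c and of the integral La of K *)
Definition stab_chars c (La : H) : H -> Prop :=
  fun d => Irr d /\ d * c * La = counit d *: (c * La).

End HopfTheory.

(* Main.v *)
(* For K = H and c = 1 the statement says that H is cosemisimple, so it contains the Larson-Radford
   theorem.  Let lambda p = Tr (h |-> p S^2 h).  This is a left integral of the dual of H, normalized
   by lambda La = 1 for the integral La of H, and comparing it with the right integral lambda o S
   shows that S^4 is conjugation by the inverse of a grouplike g of finite order.  If g <> 1 or
   lambda 1 = 0, then lambda vanishes on k[g].  On the other hand, on each block of H preserved by
   S^2, S^2 is conjugation by some w with g w^2 = 1, and the traces of w on the eigenspaces of g are,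
   up to square roots of the eigenvalues, integers; positivity of their Gram matrix forbids that
   lambda vanish on k[g].  Hence g = 1 and Tr S^2 <> 0.  If chi is the character of the regular
   comodule and N = dim H, then chi / N is an idempotent with lambda (chi / N) = Tr S^2 / N, and this
   forces S^2 = 1.  Then the trace form of the dual of H is nondegenerate, and Wedderburn's theorem
   gives H = (+) C_e.

   Now let v = c La_K, and d v = eps d v with d the character of C_d.  By a Perron-Frobenius argument
   for the multiplication by d on characters, 1 = alpha + beta (d - eps d) with x alpha = eps x alpha
   for all x in C_d; so v = alpha v and x v = eps x v for all x in C_d.  Thus d belongs to the set if
   and only if all of C_d fixes v, a condition that is inherited by products and antipodes. *)

Require Import Defs.
From HB Require Import structures.
From mathcomp Require Import all_boot all_order all_algebra all_field.
From mathcomp Require Import ring zify.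
From Stdlib Require Import Classical_Prop.
Set Implicit Arguments.
Unset Strict Implicit.
Unset Printing Implicit Defensive.
Import Order.TTheory GRing.Theory Num.Theory.
Local Open Scope ring_scope.

(** * Traces and rational linear algebra *)

(** The field [k] carries no order, so neither positivity argument can be run over [k]. Both are
    moved to rational matrices whose entries come from ranks of idempotents. The Gram matrix has
    integer entries because, on the eigenspace of $g$ for the eigenvalue $a$, the element $w$ is a
    square root of $1/a$ times an involution. The fusion matrix has multiplicities as entries, up to
    degrees. The conclusions return along the embedding of the rationals in [k]. Semisimplicity is
    given for $H$ through complements of left ideals, and nothing similar is known at first for the
    dual. Wedderburn's theorem is therefore derived from one property shared by both algebras: every
    minimal left ideal contains a right unit for itself. For $H$ a complement supplies it; for the
    dual it is Brauer's lemma, once the trace form excludes minimal ideals of square zero. The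
    equation $dv = \epsilon(d)v$ constrains only the trace of $C_d$, and [k] has no norm that would
    force the matrix coefficients one by one. They are reached through the harmonic element alpha,
    which only needs to know which multiplicities vanish. *)

Section LinearFunctions.
Variables (k : fieldType).
Implicit Types U V W : lmodType k.

Definition lfun_of U W (F : U -> W) (h : linear F) : {linear U -> W} :=
  HB.pack F (GRing.isLinear.Build _ _ _ _ F h).

Lemma linD U W (F : U -> W) : linear F -> {morph F : x y / x + y}.
Proof. by move=> h x y; exact: (linearD (lfun_of h)). Qed.

Lemma linZ U W (F : U -> W) : linear F -> forall a, {morph F : x / a *: x}.
Proof. by move=> h a x; exact: (linearZZ (lfun_of h)). Qed.

Lemma lin0 U W (F : U -> W) : linear F -> F 0 = 0.
Proof. by move=> h; exact: (linear0 (lfun_of h)). Qed.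

Lemma linB U W (F : U -> W) : linear F -> {morph F : x y / x - y}.
Proof. by move=> h x y; exact: (linearB (lfun_of h)). Qed.

Lemma linS U W (F : U -> W) (I : Type) (r : seq I) (P : pred I) (E : I -> U) :
  linear F -> F (\sum_(i <- r | P i) E i) = \sum_(i <- r | P i) F (E i).
Proof. by move=> h; exact: (linear_sum (lfun_of h)). Qed.

Lemma linear_id U : linear (fun x : U => x).
Proof. by []. Qed.

Lemma linear_comp U V W (G : V -> W) (F : U -> V) :
  linear G -> linear F -> linear (fun x => G (F x)).
Proof. by move=> hG hF a x y; rewrite hF hG. Qed.

Lemma linear_scaler U W (a : k) (F : U -> W) : linear F -> linear (fun x => a *: F x).
Proof. by move=> hF b x y; rewrite hF scalerDr !scalerA mulrC. Qed.

Lemma linear_scalel U W (F : U -> k^o) (w : W) : linear F -> linear (fun x => (F x : k) *: w).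
Proof. by move=> hF b x y; rewrite hF scalerDl -scalerA. Qed.

Lemma linear_add U W (F G : U -> W) : linear F -> linear G -> linear (fun x => F x + G x).
Proof. by move=> hF hG b x y; rewrite hF hG scalerDr addrACA. Qed.

Lemma linear_opp U W (F : U -> W) : linear F -> linear (fun x => - F x).
Proof. by move=> hF b x y; rewrite hF opprD scalerN. Qed.

Lemma linear_bigsum U W (I : Type) (r : seq I) (P : pred I) (F : I -> U -> W) :
  (forall i, linear (F i)) -> linear (fun x => \sum_(i <- r | P i) F i x).
Proof.
move=> hF b x y; rewrite scaler_sumr -big_split /=.
by apply: eq_bigr => i _; rewrite hF.
Qed.

End LinearFunctions.

Section Trace.
Variables (k : fieldType) (V : vectType k).
Implicit Types F G : V -> V.
Local Notation b := (vbasis (@fullv k V)).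
Local Notation N := (\dim (@fullv k V)).

(** Row convention: row i holds the coordinates of the image of the i-th basis vector, so composites
    multiply in the order of application. *)
Definition mxf F : 'M[k]_N := \matrix_(i, j) coord b j (F b`_i).
Definition tr F : k := \sum_(i < N) coord b i (F b`_i).

Lemma sum_coord v : v = \sum_(i < N) coord b i v *: b`_i.
Proof. exact: coord_vbasis (memvf v). Qed.

Lemma coord_linear (i : 'I_N) : linear (coord b i : V -> k^o).
Proof. by move=> a x y; rewrite linearP. Qed.

Lemma vec_eq (W : lmodType k) (F G : V -> W) :
  linear F -> linear G -> (forall i : 'I_N, F b`_i = G b`_i) -> F =1 G.
Proof.
move=> hF hG e v; rewrite (sum_coord v) !linS //; apply: eq_bigr => i _.
by rewrite !(linZ hF, linZ hG) e.
Qed.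

Lemma functional_eq (u v : V) : (forall f : V -> k^o, linear f -> f u = f v) -> u = v.
Proof.
move=> e; rewrite (sum_coord u) (sum_coord v); apply: eq_bigr => i _.
by rewrite (e (coord b i) (@coord_linear i)).
Qed.

Lemma tr_mxf F : tr F = \tr (mxf F).
Proof. by apply: eq_bigr => i _; rewrite mxE. Qed.

Lemma eq_tr F G : F =1 G -> tr F = tr G.
Proof. by move=> e; apply: eq_bigr => i _; rewrite e. Qed.

Lemma mxf_comp F G : linear F -> linear G -> mxf (fun x => G (F x)) = mxf F *m mxf G.
Proof.
move=> hF hG; apply/matrixP => i j; rewrite !mxE.
rewrite {1}(sum_coord (F b`_i)) linS // linear_sum; apply: eq_bigr => l _.
by rewrite (linZ hG) linearZ !mxE.
Qed.

Lemma mxf0 F : linear F -> mxf F = 0 -> forall x, F x = 0.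
Proof.
move=> hF /matrixP e; apply: (vec_eq (G := fun=> 0)) => //.
  by move=> a x y; rewrite scaler0 addr0.
move=> i; rewrite (sum_coord (F _)) big1 // => j _.
by have := e i j; rewrite !mxE => ->; rewrite scale0r.
Qed.

Lemma trC F G : linear F -> linear G -> tr (fun x => F (G x)) = tr (fun x => G (F x)).
Proof. by move=> hF hG; rewrite !tr_mxf (mxf_comp hF hG) (mxf_comp hG hF) mxtrace_mulC. Qed.

Lemma trZ a F : tr (fun x => a *: F x) = a * tr F.
Proof. by rewrite /tr mulr_sumr; apply: eq_bigr => i _; rewrite linearZ. Qed.

Lemma trB F G : tr (fun x => F x - G x) = tr F - tr G.
Proof. by rewrite /tr -sumrB; apply: eq_bigr => i _; rewrite linearB. Qed.

Lemma tr_bigsum (I : Type) (r : seq I) (P : pred I) (F : I -> V -> V) :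
  tr (fun x => \sum_(i <- r | P i) F i x) = \sum_(i <- r | P i) tr (F i).
Proof. by rewrite /tr exchange_big; apply: eq_bigr => i _; rewrite linear_sum. Qed.

Lemma tr_linear (U : lmodType k) (F : U -> V -> V) :
  (forall v, linear (F^~ v)) -> linear (fun x => tr (F x) : k^o).
Proof.
move=> hF a x y; rewrite /tr scaler_sumr -big_split /=; apply: eq_bigr => i _.
by rewrite hF linearP.
Qed.

Lemma tr_rank1 (f : V -> k^o) (w : V) : linear f -> tr (fun h => (f h : k) *: w) = f w.
Proof.
move=> hf; rewrite {2}(sum_coord w) linS //; apply: eq_bigr => i _.
by rewrite (linZ hf) linearZ /= mulrC.
Qed.

Lemma tr_id : tr (fun x => x) = N%:R.
Proof.
rewrite /tr (eq_bigr (fun=> 1)) ?big_const_ord ?iter_addr_0 // => i _.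
by rewrite coord_free ?eqxx // (basis_free (vbasisP _)).
Qed.

(** One-sided inverses of square matrices are two-sided. This yields the injectivity of the antipode
    from an explicit right inverse, and the second half of the inner form of an automorphism. *)
Lemma right_inv_left_inv F G : linear F -> linear G ->
  (forall x, F (G x) = x) -> forall x, G (F x) = x.
Proof.
move=> hF hG FG x; apply/eqP; rewrite -subr_eq0; apply/eqP; move: x.
have FG1 : mxf F *m mxf G = 1%:M.
  apply: mulmx1C; rewrite -(mxf_comp hG hF); apply/matrixP => i j.
  by rewrite !mxE FG coord_free ?(basis_free (vbasisP _)) // eq_sym.
apply: mxf0; first by move=> a x y; rewrite hF hG scalerBr opprD addrACA.
apply/matrixP => i j; rewrite !mxE linearB /=.
have /matrixP/(_ i j) := FG1; rewrite -(mxf_comp hF hG) !mxE => ->.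
by rewrite coord_free ?(basis_free (vbasisP _)) // eq_sym subrr.
Qed.

(* Through a full rank factorization M = C R, M M = C (R C) R gives R C = 1 when M is idempotent
   and R C = 0 when M M = 0, while tr M = tr (R C). *)
Lemma trmx_rank n (M : 'M[k]_n) a : M *m M = a *: M -> \tr M = a *+ \rank M.
Proof.
move=> e; have rc : row_base M *m col_base M = a%:M.
  have Cf : row_free (col_base M)^T by rewrite /row_free mxrank_tr; exact: (col_base_full M).
  apply: (row_free_inj (row_base_free M)) => /=.
  apply: trmx_inj; apply: (row_free_inj Cf); rewrite -!trmx_mul; congr trmx.
  rewrite mul_scalar_mx -scalemxAr mulmx_base -e -[in RHS](mulmx_base M).
  by rewrite !mulmxA.
by rewrite -{1}(mulmx_base M) mxtrace_mulC rc mxtrace_scalar.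
Qed.

Lemma tr_idem F : linear F -> (forall x, F (F x) = F x) -> tr F = (\rank (mxf F))%:R.
Proof.
move=> hF e; rewrite tr_mxf; apply: trmx_rank; rewrite scale1r -(mxf_comp hF hF).
by apply/matrixP => i j; rewrite !mxE e.
Qed.

Lemma tr_nilp F : linear F -> (forall x, F (F x) = 0) -> tr F = 0.
Proof.
move=> hF e; rewrite tr_mxf (@trmx_rank _ _ 0) ?mul0rn // scale0r -(mxf_comp hF hF).
by apply/matrixP => i j; rewrite !mxE e linear0.
Qed.

End Trace.

(** Source of all multiplicities: the trace of an idempotent matrix is its rank. The second clause
    matters as much as the first, since rank zero kills every entry and not only the trace. *)
Lemma fin_idem (k : fieldType) (J : finType) (P : J -> J -> k) :
  (forall s t, \sum_u P s u * P u t = P s t) ->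
  exists2 r : nat, \sum_s P s s = r%:R & (r = 0%N -> forall s t, P s t = 0).
Proof.
move=> e; pose M := \matrix_(i < #|J|, j < #|J|) P (enum_val i) (enum_val j).
have re (F : J -> k) : \sum_s F s = \sum_(i < #|J|) F (enum_val i).
  by rewrite (reindex _ (onW_bij _ (@enum_val_bij J))).
have MM : M *m M = 1 *: M.
  rewrite scale1r; apply/matrixP => i j; rewrite !mxE -e re.
  by apply: eq_bigr => l _; rewrite !mxE.
exists (\rank M).
  by rewrite re -(trmx_rank MM); apply: eq_bigr => i _; rewrite mxE.
move/eqP; rewrite mxrank_eq0 => /eqP M0 s t.
by have /matrixP/(_ (enum_rank s) (enum_rank t)) := M0; rewrite !mxE !enum_rankK.
Qed.

Section CharZero.
Variables (k : fieldType) (char0 : [pchar k] =i pred0).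

Lemma natr_eq0 n : (n%:R == 0 :> k) = (n == 0)%N.
Proof. by have /pcharf0P := char0; apply. Qed.

Lemma intr_eq0_char0 (z : int) : (z%:~R == 0 :> k) = (z == 0).
Proof.
case: z => n; first by rewrite -pmulrn natr_eq0.
by rewrite NegzE mulrNz oppr_eq0 -pmulrn natr_eq0 oppr_eq0.
Qed.

Lemma natr_inj : injective (fun n : nat => n%:R : k).
Proof.
move=> m n e; have : (m%:Z - n%:Z)%:~R = 0 :> k by rewrite rmorphB /= -!pmulrn e subrr.
by move/eqP; rewrite intr_eq0_char0 subr_eq0 => /eqP[].
Qed.

Lemma ratr_num (x : rat) (n d : int) :
  d != 0 -> x * d%:~R = n%:~R -> ratr x * d%:~R = n%:~R :> k.
Proof.
move=> d0 e; have den0 : (denq x)%:~R != 0 :> k by rewrite intr_eq0_char0 denq_eq0.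
apply: (mulIf den0); rewrite /ratr mulrAC divfK // -!rmorphM; congr _%:~R.
apply: (@intr_inj rat); rewrite !rmorphM /= numqE -e.
by rewrite mulrAC.
Qed.

Lemma ratr_eqP (x : rat) (t : k) (d : int) :
  d != 0 -> ratr x * d%:~R = t * d%:~R -> ratr x = t.
Proof. by move=> d0; apply: mulIf; rewrite intr_eq0_char0. Qed.

Lemma ratr_char0_is_zmod : zmod_morphism (ratr : rat -> k).
Proof.
move=> x y; have dx := denq_neq0 x; have dy := denq_neq0 y.
have d0 : denq x * denq y != 0 by rewrite mulf_neq0.
apply: (ratr_eqP d0); rewrite (@ratr_num _ (numq x * denq y - numq y * denq x)) //.
  rewrite rmorphB !rmorphM mulrBl /= mulrA (@ratr_num x (numq x)) ?numqE //.
  by rewrite mulrCA (@ratr_num y (numq y)) ?numqE // [_ * (numq y)%:~R]mulrC.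
by rewrite rmorphB !rmorphM /= !numqE; ring.
Qed.

Lemma ratr_char0_is_monoid : monoid_morphism (ratr : rat -> k).
Proof.
split=> [|x y]; first by rewrite /ratr divr1.
have dx := denq_neq0 x; have dy := denq_neq0 y.
have d0 : denq x * denq y != 0 by rewrite mulf_neq0.
apply: (ratr_eqP d0); rewrite (@ratr_num _ (numq x * numq y)) //.
  by rewrite !rmorphM /= mulrACA (@ratr_num x (numq x)) ?(@ratr_num y (numq y)) ?numqE.
by rewrite !rmorphM /= mulrACA !numqE.
Qed.

(** The map divides by the image of the denominator, which is nonzero in characteristic zero; this
    makes it a morphism although [k] has no order. *)
Definition ratr0 : {rmorphism rat -> k} :=
  HB.pack (ratr : rat -> k) (GRing.isZmodMorphism.Build _ _ _ ratr_char0_is_zmod)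
    (GRing.isMonoidMorphism.Build _ _ _ ratr_char0_is_monoid).

(* The Gram matrix of an integer matrix s has the row space of s over the rationals, hence over k. *)
Lemma gram_ker m n (s : 'M[int]_(m, n)) (z : 'cV[k]_n) :
  map_mx intr (s^T *m s) *m z = 0 -> map_mx intr s *m z = 0.
Proof.
pose q : 'M[rat]_(m, n) := map_mx intr s.
have /submxP[Y qY] : (q <= q^T *m q)%MS.
  rewrite submxE; set X := cokermx _.
  have /eqP e : q^T *m q *m X == 0 by rewrite -submxE.
  (* The diagonal entries of this product are sums of squares of rationals, so each column of $qX$
     vanishes; this is where the order of the rationals enters. *)
  have e2 : (q *m X)^T *m (q *m X) = 0 by rewrite trmx_mul -mulmxA (mulmxA q^T) e mulmx0.
  move: (q *m X) e2 => B e2; apply/eqP/matrixP => i j; rewrite [RHS]mxE.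
  have /matrixP/(_ j j) := e2; rewrite !mxE => /eqP; rewrite psumr_eq0; last first.
    by move=> l _; rewrite mxE -expr2 sqr_ge0.
  by move=> /allP/(_ i (mem_index_enum _)) /=; rewrite mxE -expr2 sqrf_eq0 => /eqP.
have intE p r (M : 'M[int]_(p, r)) : map_mx ratr0 (map_mx intr M) = map_mx intr M.
  by apply/matrixP => i j; rewrite !mxE rmorph_int.
move=> e; rewrite -(intE _ _ s) -/q qY map_mxM /= /q map_trmx -map_mxM /= intE.
by rewrite -mulmxA e mulmx0.
Qed.

End CharZero.

(* If a A = c a then
   sum_ij A_ij y_j (a_i - a_j)^2 = 0, because A y = c y and 1 A = c 1. *)
Section Perron.
Variables (n : nat) (A : 'M[rat]_n) (y : 'I_n -> rat) (c : rat).
Hypotheses (A0 : forall i j, 0 <= A i j) (y0 : forall i, 0 < y i).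
Hypotheses (Ay : forall i, \sum_j A i j * y j = c * y i).
Hypotheses (sA : forall j, \sum_i A i j = c).

Lemma perron_harmonic (a : 'rV_n) : a *m (A - c%:M) = 0 ->
  forall i j, A i j != 0 -> a 0 i = a 0 j.
Proof.
rewrite mulmxBr mul_mx_scalar => /eqP; rewrite subr_eq0 => /eqP e i j Aij.
have eb l : \sum_i a 0 i * A i l = c * a 0 l.
  by have /rowP/(_ l) := e; rewrite !mxE.
have : \sum_i \sum_j A i j * y j * (a 0 i - a 0 j) ^+ 2 = 0.
  rewrite (eq_bigr (fun i => a 0 i ^+ 2 * (\sum_j A i j * y j)
     + \sum_j A i j * (y j * a 0 j ^+ 2) - 2 * \sum_j a 0 i * A i j * (y j * a 0 j))); last first.
    move=> l _; rewrite mulr_sumr mulr_sumr -big_split -sumrB; apply: eq_bigr => p _ /=.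
    by ring.
  pose Y := \sum_l y l * a 0 l ^+ 2.
  have s1 : \sum_i a 0 i ^+ 2 * (\sum_j A i j * y j) = c * Y.
    by rewrite mulr_sumr; apply: eq_bigr => l _; rewrite Ay; ring.
  have s2 : \sum_i \sum_j A i j * (y j * a 0 j ^+ 2) = c * Y.
    by rewrite exchange_big mulr_sumr; apply: eq_bigr => l _ /=; rewrite -mulr_suml sA.
  have s3 : \sum_i \sum_j a 0 i * A i j * (y j * a 0 j) = c * Y.
    rewrite exchange_big mulr_sumr; apply: eq_bigr => l _ /=.
    by rewrite -mulr_suml eb; ring.
  by rewrite sumrB big_split /= -mulr_sumr s1 s2 s3; ring.
have T0 p q : 0 <= A p q * y q * (a 0 p - a 0 q) ^+ 2.
  by rewrite mulr_ge0 ?sqr_ge0 // mulr_ge0 // ltW.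
move/eqP; rewrite psumr_eq0; last by move=> p _; apply: sumr_ge0.
move=> /allP/(_ i (mem_index_enum _)) /=; rewrite psumr_eq0 // => /allP/(_ j (mem_index_enum _)) /=.
by rewrite -mulrA !mulf_eq0 (negPf Aij) (gt_eqF (y0 j)) /= orbb subr_eq0 => /eqP.
Qed.

(** With $T = A - c$, rank-nullity reduces the claim to a trivial intersection of kernel and image.
    If $v = bT$ and $vT = 0$, then $v$ is constant along the edges of $A$, so the column $(y_j v_j)$
    is killed by $T$ as well and $\sum_i v_i^2 y_i = b\,T\,(y_j v_j) = 0$. *)
Lemma perron_split (e : 'rV_n) : exists a b, e = a + b *m (A - c%:M) /\ a *m (A - c%:M) = 0.
Proof.
pose T := A - c%:M.
have cap0 : (kermx T :&: T)%MS = 0.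
  apply/eqP; rewrite -submx0; apply/rV_subP => v; rewrite sub_capmx => /andP[/sub_kermxP vT].
  case/submxP => b vb; have h := perron_harmonic vT.
  have : \sum_i v 0 i ^+ 2 * y i = 0.
    have Tv i : \sum_j T i j * (y j * v 0 j) = 0.
      rewrite (eq_bigr (fun j => A i j * y j * v 0 i - (c%:M : 'M_n) i j * (y j * v 0 j))).
        rewrite sumrB -mulr_suml Ay (bigD1 i) //= big1 ?addr0.
          by rewrite mxE eqxx mulr1n mulrA subrr.
        by move=> j /negPf ji; rewrite mxE eq_sym ji mulr0n mul0r.
      move=> j _; rewrite [T i j]mxE [(- _ : 'M_n) i j]mxE mulrBl mulrA; congr (_ - _).
      by have [->|/h->] := eqVneq (A i j) 0; rewrite ?mul0r ?mulrA.
    rewrite (eq_bigr (fun i => \sum_j b 0 j * (T j i * (y i * v 0 i)))).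
      rewrite exchange_big /= big1 // => j _; rewrite -mulr_sumr Tv mulr0 //.
    move=> i _; rewrite expr2 {1}vb mxE !mulr_suml; apply: eq_bigr => j _.
    by rewrite -!mulrA [v 0 i * _]mulrC.
  move/eqP; rewrite psumr_eq0; last by move=> i _; rewrite mulr_ge0 ?sqr_ge0 // ltW.
  move=> /allP z; suff -> : v = 0 by rewrite sub0mx.
  apply/rowP => i; have := z i (mem_index_enum _); rewrite /=.
  by rewrite mulf_eq0 (gt_eqF (y0 i)) orbF sqrf_eq0 mxE => /eqP.
have : (e <= kermx T + T)%MS.
  apply: submx_full; rewrite /row_full -(eqn_add2r (\rank (kermx T :&: T)%MS)) mxrank_sum_cap.
  by rewrite cap0 mxrank0 addn0 mxrank_ker subnK // rank_leq_row.
case/sub_addsmxP => -[u1 u2] /= ->; exists (u1 *m kermx T), u2; split=> //.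
by rewrite -mulmxA mulmx_ker mulmx0.
Qed.

End Perron.

(** * Semisimple algebras over an algebraically closed field *)

Lemma equiv_rep (T : finType) (r : rel T) : equivalence_rel r ->
  exists rep : T -> T, (forall i, r i (rep i)) /\ (forall i j, r i j -> rep i = rep j).
Proof.
move=> er; have rr i : r i i by have [] := er i i i.
exists (fun i => odflt i [pick j | r i j]); split=> [i|i j rij].
  by case: pickP => [//|/(_ i)]; rewrite rr.
rewrite (eq_pick (_ : r i =1 r j)); last by move=> l; have [_] := er i j l; apply.
by case: pickP => // /(_ j); rewrite rr.
Qed.

Section MatrixUnits.
Variables (k : fieldType) (A : falgType k).

(* The block structure of A is given by an equivalence r on the indices of a single system of
   matrix units: E i j = 0 when i and j are in different blocks. *)
Record matrix_units m (r : rel 'I_m) (E : 'I_m -> 'I_m -> A) (M : A -> 'I_m -> 'I_m -> k) : Prop :=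
  MatrixUnits {
    mu_rel : equivalence_rel r;
    mu_E0 : forall i j, ~~ r i j -> E i j = 0;
    mu_mul : forall i j l, r i j -> r j l -> E i j * E j l = E i l;
    mu_mul0 : forall i j p l, j != p -> E i j * E p l = 0;
    mu_one : \sum_i E i i = 1;
    mu_lin : forall i j, linear (fun x => M x i j : k^o);
    mu_coord : forall x, x = \sum_i \sum_j M x i j *: E i j;
    mu_E : forall p q i j, M (E p q) i j = (r p q && ((i == p) && (j == q)))%:R
  }.

Variables (m : nat) (r : rel 'I_m) (E : 'I_m -> 'I_m -> A) (M : A -> 'I_m -> 'I_m -> k).
Hypothesis mu : matrix_units r E M.

Lemma mu_refl i : r i i.
Proof. by have [] := mu_rel mu i i i. Qed.

Lemma mu_trans i j l : r i j -> r i l = r j l.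
Proof. by have [_] := mu_rel mu i j l. Qed.

Lemma mu_sym i j : r i j = r j i.
Proof. by apply/idP/idP => h; rewrite -(mu_trans _ h) mu_refl. Qed.

Lemma mu_mulE i j p l : E i j * E p l = if (j == p) && (r i j && r p l) then E i l else 0.
Proof.
case: eqP => [<-|/eqP] /=; last by move=> jp; rewrite (mu_mul0 mu).
have [rij|n] := boolP (r i j); last by rewrite (mu_E0 mu n) mul0r.
have [rjl|n] := boolP (r j l); last by rewrite (mu_E0 mu n) mulr0.
by rewrite (mu_mul mu).
Qed.

Lemma mu_EME x i j : E i i * x * E j j = M x i j *: E i j.
Proof.
rewrite {1}(mu_coord mu x) mulr_sumr mulr_suml (bigD1 i) //= [X in _ + X]big1 ?addr0; last first.
  move=> p pi; rewrite mulr_sumr mulr_suml big1 // => q _.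
  by rewrite -scalerAr mu_mulE eq_sym (negPf pi) scaler0 mul0r.
rewrite mulr_sumr mulr_suml (bigD1 j) //= [X in _ + X]big1 ?addr0; last first.
  move=> q qj; rewrite -scalerAr mu_mulE eqxx mu_refl /=.
  by case: ifP => _; rewrite ?scaler0 ?mul0r // -scalerAl mu_mulE (negPf qj) scaler0.
rewrite -scalerAr -scalerAl; congr (_ *: _).
have [rij|n] := boolP (r i j); last by rewrite (mu_E0 mu n) mulr0 mul0r.
by rewrite !(mu_mul mu) ?mu_refl.
Qed.

Lemma mu_M0 x i j : ~~ r i j -> M x i j = 0.
Proof.
move=> n; rewrite (mu_coord mu x) (linS _ _ _ (mu_lin mu i j)) big1 // => p _.
rewrite (linS _ _ _ (mu_lin mu i j)) big1 // => q _.
rewrite (linZ (mu_lin mu i j)) (mu_E mu).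
have [/andP[/eqP <- /eqP <-]|_] := boolP ((i == p) && _); last by rewrite andbF scaler0.
by rewrite (negPf n) scaler0.
Qed.

Lemma mu_E_neq0 i j : r i j -> E i j != 0.
Proof.
move=> rij; apply/eqP => e; have := mu_E mu i j i j.
rewrite e (lin0 (mu_lin mu i j)) rij !eqxx => /esym/eqP.
by rewrite oner_eq0.
Qed.

Lemma mu_MM x y i j : M (x * y) i j = \sum_l M x i l * M y l j.
Proof.
have [rij|n] := boolP (r i j); last first.
  rewrite mu_M0 // big1 // => l _; have [ril|nil] := boolP (r i l); last by rewrite mu_M0 ?mul0r.
  by rewrite (@mu_M0 y) ?mulr0 // -(mu_trans _ ril).
have := mu_EME (x * y) i j.
rewrite -[X in X * y]mulr1 -(mu_one mu) mulr_sumr mulr_suml mulr_sumr mulr_suml.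
rewrite (eq_bigr (fun l => (M x i l * M y l j) *: E i j)).
  by rewrite -scaler_suml => /esym /eqP; rewrite -subr_eq0 -scalerBl scaler_eq0 (negPf (mu_E_neq0 rij)) orbF subr_eq0 => /eqP->.
move=> l _; have e : E l l = E l l * E l l by rewrite (mu_mul mu) ?mu_refl.
rewrite e -!mulrA [x * _]mulrA !mulrA mu_EME -!mulrA [E l l * _]mulrA mu_EME.
rewrite -scalerAl -scalerAr scalerA.
have [ril|nil] := boolP (r i l); last by rewrite mu_M0 // mul0r !scale0r.
by rewrite (mu_mul mu) // -(mu_trans _ ril).
Qed.

Lemma mu_M1 i j : M 1 i j = (i == j)%:R.
Proof.
rewrite -(mu_one mu) (linS _ _ _ (mu_lin mu i j)) (bigD1 i) //= big1 ?addr0.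
  by rewrite (mu_E mu) mu_refl eqxx eq_sym.
by move=> p pi; rewrite (mu_E mu) eq_sym (negPf pi) andbF.
Qed.

End MatrixUnits.

(** * Wedderburn's theorem from right units in minimal left ideals *)

Section Wedderburn.
Variables (k : closedFieldType) (A : falgType k).
Implicit Types (I J : {vspace A}) (x y z f : A).

Lemma left_idealP I : left_ideal I <-> forall a x, x \in I -> a * x \in I.
Proof.
split=> [/prodvP h a x xI|h]; first by rewrite h ?memvf.
by apply/prodvP => a x _; exact: h.
Qed.

Definition minimal_left_ideal I : Prop :=
  [/\ left_ideal I, I <> 0%VS
    & forall J, left_ideal J -> (J <= I)%VS -> J <> 0%VS -> J = I].

Lemma minimal_left_ideal_gen I x y : minimal_left_ideal I -> x \in I -> x != 0 ->
  y \in I -> exists a, a * x = y.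
Proof.
case=> /left_idealP idI _ minI xI x0 yI; have idJ : left_ideal (fullv * <[x]>)%VS.
  by rewrite /left_ideal prodvA prodvSl ?subvf.
have J0 : (fullv * <[x]>)%VS <> 0%VS.
  move=> e; have : x \in (fullv * <[x]>)%VS by rewrite -[x in x \in _]mul1r memv_mul ?memvf ?memv_line.
  by rewrite e memv0 (negPf x0).
have JI : (fullv * <[x]> <= I)%VS.
  by apply/prodvP => a z _ /vlineP[c ->]; rewrite -scalerAr memvZ // idI.
move: yI; rewrite -(minI _ idJ JI J0) -limg_amulr => /memv_imgP[a _ ->].
by exists a; rewrite lfunE.
Qed.

Lemma exists_minimal_left_ideal J : left_ideal J -> J <> 0%VS ->
  exists2 I, minimal_left_ideal I & (I <= J)%VS.
Proof.
have [n] := ubnP (\dim J); elim: n J => // n IHn J dJ idJ J0.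
have [[J' [idJ' sJ' J'0 neJ]]|no] :=
  classic (exists J', [/\ left_ideal J', (J' <= J)%VS, J' <> 0%VS & J' <> J]).
  have ltJ : (\dim J' < n)%N.
    rewrite -ltnS; apply: leq_trans dJ; rewrite ltnS ltn_neqAle dimvS // andbT.
    by apply/negP => /eqP e; apply: neJ; apply/eqP; rewrite eqEdim sJ' e leqnn.
  by have [I mI sI] := IHn J' ltJ idJ' J'0; exists I => //; apply: subv_trans sJ'.
exists J => //; split=> // J' idJ' sJ' J'0; apply: NNPP => neJ.
by apply: no; exists J'.
Qed.

(** The unit is the component [f] of 1 in [I]: for $x \in I$, the difference $x - xf$ lies in [I]
    and, as $x f'$, in the complement. *)
Lemma left_ideal_complement_unit I : left_ideal I ->
  (exists J, [/\ left_ideal J, (I + J)%VS = fullv & (I :&: J)%VS = 0%VS]) ->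
  exists2 f, f \in I & forall x, x \in I -> x * f = x.
Proof.
move=> /left_idealP idI [J [/left_idealP idJ IJ IJ0]].
have : (1 : A) \in (I + J)%VS by rewrite IJ memvf.
case/memv_addP => f fI [f' f'J e]; exists f => // x xI.
apply/eqP; rewrite -subr_eq0 -memv0 -IJ0 memv_cap; apply/andP; split.
  by rewrite memvB // idI.
by rewrite -opprB memvN -{1}[x]mulr1 e mulrDr addrC addKr idJ.
Qed.

(** Brauer's lemma. By minimality some $f = ax$ satisfies $fy = y$, and right multiplication by $y$
    is injective on [I] because a nonzero $z$ with $zy = 0$ would generate $f$. Then $(z - zf)y = 0$
    gives $z = zf$. *)
Lemma minimal_left_ideal_unit I x y : minimal_left_ideal I ->
  x \in I -> y \in I -> x * y != 0 -> exists2 f, f \in I & forall z, z \in I -> z * f = z.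
Proof.
move=> mI xI yI xy0; have /left_idealP idI : left_ideal I by case: mI.
have [a axy] := minimal_left_ideal_gen mI (idI x y yI) xy0 yI.
pose f := a * x; have fI : f \in I by exact: idI.
have fy : f * y = y by rewrite -mulrA.
have y0 : y != 0 by apply: contraNneq xy0 => ->; rewrite mulr0.
have ann z : z \in I -> z * y = 0 -> z = 0.
  move=> zI zy; apply/eqP; apply: contraTT isT => z0.
  have [b bz] := minimal_left_ideal_gen mI zI z0 fI.
  by move: y0; rewrite -fy -bz -mulrA zy mulr0 eqxx.
exists f => // z zI; apply/eqP; rewrite -subr_eq0; apply/eqP/ann.
  by rewrite memvB // idI.
by rewrite mulrBl -mulrA fy subrr.
Qed.

Hypothesis minU : forall I, minimal_left_ideal I ->
  exists2 f, f \in I & forall x, x \in I -> x * f = x.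

(** Induction on the dimension of [J]: split off the unit [f] of a minimal left ideal and continue
    in $\{x \in J : xf = 0\}$, a left ideal of smaller dimension. The last clause records that each
    [f i] generates a minimal left ideal. *)
Lemma orthogonal_idempotents J : left_ideal J ->
  exists m (f : 'I_m -> A),
    [/\ forall i, f i \in J, forall x, x \in J -> x * (\sum_i f i) = x,
        forall i j, f i * f j = if i == j then f i else 0, forall i, f i != 0
      & forall i x, x * f i != 0 -> exists y, y * (x * f i) = f i].
Proof.
have [n] := ubnP (\dim J); elim: n J => // n IHn J dJ idJ.
have [J0|/eqP J0] := eqVneq J 0%VS.
  have no (i : 'I_0) : False by case: i.
  exists 0%N, (fun _ => 0); split=> [i|x|i|i|i]; try by case: (no i).
  by rewrite J0 memv0 => /eqP->; rewrite mul0r.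
have [I mI IJ] := exists_minimal_left_ideal idJ J0.
have [f fI uf] := minU mI; have [/left_idealP idI I0 _] := mI.
move/left_idealP: (idJ) => idJ'.
pose J' := (J :&: lker (amulr f))%VS.
have J'P x : (x \in J') = (x \in J) && (x * f == 0).
  by rewrite memv_cap memv_ker lfunE.
have f0 : f != 0.
  apply/eqP => f0; apply: I0; apply/eqP; rewrite -subv0; apply/subvP => x xI.
  by rewrite -(uf x xI) f0 mulr0 mem0v.
have fJ : f \in J by exact: subvP fI.
have ff : f * f = f by exact: uf.
have [||m [g [gJ ge gg g0 gmin]]] := IHn J'.
- rewrite -ltnS; apply: leq_trans dJ; rewrite ltnS ltn_neqAle dimvS ?capvSl // andbT.
  apply/negP => e; have : f \in J' by rewrite (eqP (_ : J' == J)) // eqEdim capvSl (eqP e) leqnn.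
  by rewrite J'P ff (negPf f0) andbF.
- apply/left_idealP => a x; rewrite !J'P => /andP[xJ /eqP xf].
  by rewrite idJ' // -mulrA xf mulr0 eqxx.
pose e := \sum_i g i; rewrite -/e in ge.
have gf i : g i * f = 0 by have := gJ i; rewrite J'P => /andP[_ /eqP].
have eg i : e * g i = g i.
  rewrite mulr_suml (bigD1 i) //= big1 => [|j /negPf ji]; last by rewrite gg ji.
  by rewrite gg eqxx addr0.
have ef : e * f = 0 by rewrite mulr_suml big1.
have ee : e * e = e by rewrite mulr_sumr; apply: eq_bigr => i _; exact: eg.
(* The idempotents found by induction already satisfy $g_i f = 0$; this correction adds $f_1 g_i =
   0$ and keeps $f_1 f = f$. *)
pose f1 := f - f * e.
have f1f : f1 * f = f by rewrite mulrBl ff -mulrA ef mulr0 subr0.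
have f1g i : f1 * g i = 0 by rewrite mulrBl -mulrA eg subrr.
have gf1 i : g i * f1 = 0 by rewrite mulrBr mulrA gf mul0r subrr.
have ff1 : f * f1 = f1 by rewrite mulrBr mulrA ff.
have f1f1 : f1 * f1 = f1.
  by rewrite {1}/f1 mulrBl -mulrA ff1 [e * f1]mulrBr mulrA ef mul0r subrr mulr0 subr0.
have eJ : e \in J.
  by apply: memv_suml => i _; have := gJ i; rewrite J'P => /andP[].
exists m.+1, (fun i => oapp g f1 (unlift ord0 i)); split.
- move=> i; case: unliftP => [j _|_] /=; first by have := gJ j; rewrite J'P => /andP[].
  by rewrite memvB // idJ'.
- move=> x xJ; rewrite big_ord_recl unlift_none /=.
  under eq_bigr do rewrite liftK /=.
  have := ge (x - x * f); rewrite J'P memvB ?idJ' //= mulrBl -mulrA ff subrr eqxx => /(_ isT).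
  rewrite -/e mulrDr mulrBr mulrA mulrBl => h.
  by rewrite addrAC -addrA h addrCA subrr addr0.
- move=> i j; case: unliftP => [i' ->|->] /=; case: unliftP => [j' ->|->] /=.
  + by rewrite gg (inj_eq (@lift_inj _ ord0)).
  + by rewrite gf1 ?[_ == ord0]eq_sym ?(negPf (neq_lift _ _)).
  + by rewrite f1g ?(negPf (neq_lift _ _)).
  + by rewrite f1f1 ?eqxx.
- move=> i; case: unliftP => [j _|_] //=.
  by apply: contraNneq f0 => f10; rewrite -f1f f10 mul0r.
- move=> i x; case: unliftP => [j _|_] /=; first exact: gmin.
  move=> xf1; have xf0 : x * f != 0.
    by apply: contraNneq xf1 => xf; rewrite -ff1 mulrA xf mul0r.
  have [y yx] := minimal_left_ideal_gen mI (idI x f fI) xf0 fI.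
  by exists y; rewrite -{1}ff1 !mulrA -(mulrA y) yx.
Qed.

(** The first $\dim A + 1$ powers of [z] are linearly dependent, which gives a nonzero annihilating
    polynomial, and it splits over [k]. *)
Lemma annihilating_product z : exists rs : seq k, \prod_(c <- rs) (z - c%:A) = 0.
Proof.
pose N := \dim {:A}; pose b := vbasis {:A}.
pose Z := \matrix_(i < N.+1, j < N) coord b j (z ^+ i).
have nfree : kermx Z != 0.
  rewrite kermx_eq0 /row_free; apply: contraTneq (rank_leq_col Z) => ->.
  by rewrite ltnn.
pose u := nz_row (kermx Z); pose p := \poly_(i < N.+1) u 0 (inord i).
have u0 : u != 0 by rewrite nz_row_eq0.
have uZ : u *m Z = 0 by apply/sub_kermxP; exact: nz_row_sub.
have p0 : p != 0.
  apply: contraNneq u0 => p0; apply/eqP/rowP => i; rewrite mxE.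
  by have := coef_poly N.+1 (fun i => u 0 (inord i)) i; rewrite -/p p0 coef0 ltn_ord inord_val.
have pz : horner_alg z p = 0.
  rewrite /p poly_def rmorph_sum /= [LHS](coord_vbasis (memvf _)) big1 // => j _.
  rewrite linear_sum /= [X in X *: _](_ : _ = 0) ?scale0r //.
  have /rowP/(_ j) := uZ; rewrite !mxE => e; rewrite -[RHS]e; apply: eq_bigr => i _.
  by rewrite inord_val linearZ /= rmorphXn /= horner_algX mulr_algl linearZ /= mxE.
have [rs e] := closed_field_poly_normal p; exists rs.
move: pz; rewrite e linearZ /= rmorph_prod /= mulr_algl => /eqP.
rewrite scaler_eq0 lead_coef_eq0 (negPf p0) /= => /eqP pz; rewrite -pz.
by apply: eq_bigr => c _; rewrite rmorphB /= horner_algX horner_algC.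
Qed.

Section Primitive.
Variables (f : A).
Hypotheses (ff : f * f = f) (f0 : f != 0).
Hypothesis fmin : forall x, x * f != 0 -> exists y, y * (x * f) = f.

(** Schur's lemma: the corner $fAf$ is a division algebra. If $z = fxf$ were not a multiple of $f$,
    every $z - cf$ would be invertible in the corner, and no product of such factors could
    vanish. *)
Lemma primitive_corner x : exists c, f * x * f = c *: f.
Proof.
set z := f * x * f; have fz : f * z = z by rewrite /z !mulrA ff.
have zf : z * f = z by rewrite /z -mulrA ff.
have [rs rs0] := annihilating_product z.
apply: NNPP => no; pose w c := z - c *: f.
have w0 c : w c != 0 by apply/eqP => /eqP; rewrite subr_eq0 => /eqP e; apply: no; exists c.
have fw c : f * w c = w c by rewrite mulrBr fz -scalerAr ff.
have wf c : w c * f = w c by rewrite mulrBl zf -scalerAl ff.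
have inv c : exists y, w c * y = f.
  (* Minimality gives left inverses inside the corner. A left inverse of the left inverse must be
     the element itself, so the inverse is two-sided. *)
  have linv v : f * v = v -> v * f = v -> v != 0 -> exists2 y, y * v = f & f * y = y /\ y * f = y.
    move=> fv vf v0; have [|y yv] := fmin (x := v); first by rewrite vf.
    exists (f * y * f); last by rewrite -!mulrA ff !mulrA ff.
    by rewrite -!mulrA fv -{1}vf yv ff.
  have [y yw [fy yf]] := linv _ (fw c) (wf c) (w0 c).
  have y0 : y != 0 by apply: contraNneq f0 => y0; rewrite -yw y0 mul0r.
  have [y' yy' [fy' y'f]] := linv _ fy yf y0.
  exists y; have -> : w c = y' by rewrite -(fw c) -yy' -mulrA yw y'f.
  exact: yy'.
have nz h s : h * f = h -> h != 0 -> h * \prod_(c <- s) (z - c%:A) != 0.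
  elim: s h => [|c s IHs] h hf h0; first by rewrite big_nil mulr1.
  have -> : h * \prod_(j <- (c :: s)) (z - j%:A) = (h * w c) * \prod_(j <- s) (z - j%:A).
    rewrite big_cons mulrA; congr (_ * _); rewrite -{1}hf -mulrA; congr (_ * _).
    by rewrite mulrBr fz -scalerAr mulr1.
  apply: IHs; first by rewrite -mulrA wf.
  apply: contraNneq h0 => hw; have [y wy] := inv c.
  by rewrite -hf -wy mulrA hw mul0r.
by have := nz f rs ff f0; rewrite rs0 mulr0 eqxx.
Qed.

End Primitive.

(** A nonzero $f_i x f_j$ is invertible between the two corners ([rinv]), so $f_i A f_j$ is zero or
    a line, and its being nonzero is an equivalence relation on the indices. Generators of these
    lines, normalized through class representatives, are the matrix units. *)
Theorem wedderburn : exists m (r : rel 'I_m) E M, @matrix_units k A m r E M.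
Proof.
have [|m [f [_ f1 ff f0 fmin]]] := @orthogonal_idempotents fullv.
  by rewrite /left_ideal subvf.
have sf : \sum_i f i = 1 by rewrite -[LHS]mul1r f1 ?memvf.
have fi i : f i * f i = f i by rewrite ff eqxx.
have fij i j : i != j -> f i * f j = 0 by rewrite ff => /negPf->.
have corner i x : exists c, f i * x * f i = c *: f i by exact: (primitive_corner (fi i) (f0 i) (fmin i)).
(* Phrased with subspaces so that the relation is boolean. *)
pose r i j := (<[f i]> * fullv * <[f j]> != 0)%VS.
have rP i j : reflect (exists x, f i * x * f j != 0) (r i j).
  apply: (iffP idP) => [|[x x0]]; last first.
    apply: contraNneq x0 => e; have : f i * x * f j \in (<[f i]> * fullv * <[f j]>)%VS.
      by rewrite !memv_mul ?memv_line ?memvf.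
    by rewrite e memv0.
  move=> r0; apply: NNPP => no; case/negP: r0.
  rewrite -subv0; apply/prodvP => u v ui /vlineP[c ->].
  have {ui} : u \in (<[f i]> * fullv * 1)%VS by rewrite prodv1.
  rewrite -limg_amulr => /memv_imgP[u' u'i ->]; rewrite lfunE /= mulr1.
  have : u' \in lker (amulr (f j)).
    apply: subvP u'i; apply/prodvP => _ x /vlineP[d ->] _; rewrite memv_ker lfunE /=.
    apply/eqP; rewrite -!scalerAl; apply/eqP; rewrite scaler_eq0; apply/orP; right.
    by apply: contraT => n; case: no; exists x.
  by rewrite memv_ker lfunE /= -scalerAr => /eqP->; rewrite scaler0 mem0v.
have rinv i j x : f i * x * f j != 0 -> exists2 y, f j * y * f i * (f i * x * f j) = f j &
    f i * x * f j * (f j * y * f i) = f i.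
  move=> x0; have [|y yx] := fmin j (f i * x); first exact: x0.
  have yx' : f j * y * f i * (f i * x * f j) = f j.
    by rewrite -!mulrA (mulrA (f i)) fi (mulrA (f i)) yx fi.
  exists y => //; have [c ec] : exists c, f i * x * f j * (f j * y * f i) = c *: f i.
    have [c ec] := corner i (x * f j * (f j * y)).
    by exists c; rewrite -ec !mulrA.
  have : (c - 1) *: (f i * x * f j) = 0.
    rewrite scalerBl scale1r; apply/eqP; rewrite subr_eq0; apply/eqP.
    have -> : c *: (f i * x * f j) = (c *: f i) * (f i * x * f j) by rewrite -scalerAl !mulrA fi.
    by rewrite -ec -[_ * (f i * x * f j)]mulrA yx' -[LHS]mulrA fi.
  by move/eqP; rewrite scaler_eq0 (negPf x0) orbF subr_eq0 ec => /eqP->; rewrite scale1r.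
have rr i : r i i by apply/rP; exists 1; rewrite mulr1 fi.
have rsym i j : r i j -> r j i.
  case/rP => x x0; have [y e1 e2] := rinv _ _ _ x0; apply/rP; exists y.
  by apply: contraNneq (f0 j) => y0; rewrite -e1 y0 mul0r.
have rtr i j l : r i j -> r j l -> r i l.
  case/rP => x x0 /rP[x' x'0]; have [y e1 _] := rinv _ _ _ x0.
  apply/rP; exists (x * f j * x'); apply: contraNneq x'0 => e.
  have -> : f j * x' * f l = f j * y * f i * (f i * (x * f j * x') * f l).
    by rewrite -{1}e1 !mulrA; congr (_ * _ * _); rewrite -!mulrA; congr (_ * (_ * _)).
  by rewrite e mulr0.
have requiv : equivalence_rel r.
  move=> i j l; split=> // rij; apply/idP/idP => h; last exact: rtr h.
  by apply: rtr h; exact: rsym.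
have [rep [rrep rep_eq]] := equiv_rep requiv.
(* Mutually inverse elements between the idempotent of [i] and that of its representative. Passing
   through the representative makes the products $a_i b_j$ compose exactly, with no scalars to
   adjust. *)
have /fin_all_exists[ab abP] i : exists ab : A * A,
    [/\ f i * ab.1 * f (rep i) = ab.1, f (rep i) * ab.2 * f i = ab.2, ab.2 * ab.1 = f (rep i)
      & ab.1 * ab.2 = f i].
  have /rP[x x0] := rrep i; have [y e1 e2] := rinv _ _ _ x0.
  exists (f i * x * f (rep i), f (rep i) * y * f i) => /=; split=> //.
    by rewrite !mulrA fi -!mulrA fi.
  by rewrite !mulrA fi -!mulrA fi.
pose a i := (ab i).1; pose b i := (ab i).2.
have fa i : f i * a i = a i by rewrite /a; have [e _ _ _] := abP i; rewrite -e !mulrA fi.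
have bf i : b i * f i = b i by rewrite /b; have [_ e _ _] := abP i; rewrite -e -!mulrA fi.
have af i : a i * f (rep i) = a i by rewrite /a; have [e _ _ _] := abP i; rewrite -e -!mulrA fi.
have ba i : b i * a i = f (rep i) by case: (abP i).
have ab1 i : a i * b i = f i by case: (abP i).
pose E i j := if r i j then a i * b j else 0.
have Eii i : E i i = f i by rewrite /E rr.
have fE i j : f i * E i j = E i j by rewrite /E; case: ifP; rewrite ?mulr0 // mulrA fa.
have Ef i j : E i j * f j = E i j by rewrite /E; case: ifP; rewrite ?mul0r // -mulrA bf.
have EE i j l : r i j -> r j l -> E i j * E j l = E i l.
  move=> rij rjl; rewrite /E rij rjl (rtr _ _ _ rij rjl).
  by rewrite -!mulrA (mulrA (b j)) ba -(rep_eq _ _ rij) !mulrA af.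
have E0 i j : ~~ r i j -> E i j = 0 by rewrite /E => /negPf->.
have EE0 i j p l : j != p -> E i j * E p l = 0.
  by move=> jp; rewrite -(Ef i j) -(fE p l) -!mulrA (mulrA (f j)) fij // mul0r mulr0.
(* The element [f i * x * E j i] lies on the line of [f i] by Schur's lemma, and multiplying it by
   [E i j] on the right recovers [f i * x * f j]. *)
pose M x i j : k := coord [tuple f i] ord0 (f i * x * E j i).
have fr i : free [tuple f i] by rewrite /= seq1_free.
have coordf i c : coord [tuple f i] ord0 (c *: f i) = c.
  by rewrite linearZ /=; have /= -> := coord_free ord0 ord0 (fr i); rewrite mulr1.
have ME x i j : f i * x * f j = M x i j *: E i j.
  have [rij|n] := boolP (r i j); last first.
    by rewrite E0 // scaler0; apply: contraNeq n => n; apply/rP; exists x.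
  have [c ec] : exists c, f i * x * E j i = c *: f i.
    by have [c ec] := corner i (x * E j i); exists c; rewrite -ec -!mulrA Ef.
  rewrite /M ec coordf; have -> : c *: E i j = (c *: f i) * E i j by rewrite -scalerAl fE.
  by rewrite -ec -[RHS]mulrA EE ?Eii // rsym.
exists m, r, E, M; split=> //.
- by under eq_bigr do rewrite Eii.
- by move=> i j c x y; rewrite /M mulrDr mulrDl -scalerAr -scalerAl linearP.
- move=> x; under eq_bigr do under eq_bigr do rewrite -ME.
  by under eq_bigr do rewrite -mulr_sumr sf mulr1; rewrite -mulr_suml sf mul1r.
- move=> p q i j; rewrite /M.
  have [rpq|n] /= := boolP (r p q); last by rewrite (E0 _ _ n) mulr0 mul0r linear0.
  have [->|ip] /= := eqVneq i p; last by rewrite -{1}fE mulrA fij // !mul0r linear0.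
  have [->|jq] /= := eqVneq j q; last by rewrite fE EE0 ?linear0 // eq_sym.
  rewrite fE (EE p q p rpq (rsym _ _ rpq)) Eii.
  by have := coordf p 1; rewrite scale1r.
Qed.

End Wedderburn.

(** * Sweedler sums and the antipode *)

Section MoreLinear.
Variable k : fieldType.

Lemma linear_mull (U : lmodType k) (A : falgType k) (F : U -> A) (b : A) :
  linear F -> linear (fun x => F x * b).
Proof. by move=> h c x y; rewrite h mulrDl -scalerAl. Qed.

Lemma linear_mulr (U : lmodType k) (A : falgType k) (F : U -> A) (b : A) :
  linear F -> linear (fun x => b * F x).
Proof. by move=> h c x y; rewrite h mulrDr -scalerAr. Qed.

Lemma linear_kmull (U : lmodType k) (F : U -> k^o) (b : k) :
  linear F -> linear (fun x => (F x : k) * b : k^o).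
Proof. by move=> h c x y; rewrite h mulrDl scalerAl. Qed.

Lemma linear_kmulr (U : lmodType k) (F : U -> k^o) (b : k) :
  linear F -> linear (fun x => b * (F x : k) : k^o).
Proof. by move=> h c x y; rewrite h mulrDr scalerAr. Qed.

Lemma linear_scomp (U V : lmodType k) (f : {linear V -> k | *%R}) (F : U -> V) :
  linear F -> linear (fun x => f (F x) : k^o).
Proof. by move=> h c x y; rewrite h linearP. Qed.

Lemma linear_kcomp (U V : lmodType k) (f : V -> k) (F : U -> V) :
  linear (f : V -> k^o) -> linear F -> linear (fun x => f (F x) : k^o).
Proof. by move=> hf h c x y; rewrite h hf. Qed.

Lemma linear_tlift (U V W : vectType k) (F : U -> V -> W) : linear (tlift F).
Proof.
move=> c s t; rewrite /tlift scaler_sumr -big_split /=; apply: eq_bigr => i _.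
rewrite scaler_sumr -big_split /=; apply: eq_bigr => j _.
by rewrite !mxE scalerDl scalerA.
Qed.

Lemma linear_tlift_fun (X : lmodType k) (U V W : vectType k) (F : X -> U -> V -> W) t :
  (forall u v, linear (fun x => F x u v)) -> linear (fun x => tlift (F x) t).
Proof.
by move=> h; apply: linear_bigsum => i; apply: linear_bigsum => j; apply: linear_scaler; apply: h.
Qed.

Lemma tens_linear_l (U V : vectType k) (v : V) : linear (fun u : U => tens u v).
Proof. by move=> c x y; apply/matrixP => i j; rewrite !mxE linearP mulrDl -mulrA. Qed.

Lemma tens_linear_r (U V : vectType k) (u : U) : linear (fun v : V => tens u v).
Proof. by move=> c x y; apply/matrixP => i j; rewrite !mxE linearP mulrDr mulrCA. Qed.

Definition bil (U V W : lmodType k) (F : U -> V -> W) : Prop :=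
  (forall v, linear (F^~ v)) /\ (forall u, linear (F u)).

Lemma tlift_tensE (U V W : vectType k) (F : U -> V -> W) u v :
  bil F -> tlift F (tens u v) = F u v.
Proof. by case=> hl hr; exact: tlift_tens. Qed.

Lemma tensor_eq (U V : vectType k) (s t : tensor U V) :
  (forall (f : U -> k^o) (g : V -> k^o), linear f -> linear g ->
    tlift (fun u v => (f u : k) * g v : k^o) s = tlift (fun u v => (f u : k) * g v : k^o) t) ->
  s = t.
Proof.
move=> e; apply/matrixP => i j.
have E (r : tensor U V) : (r : 'M_(_, _)) i j = tlift (fun u v =>
    coord (vbasis (@fullv k U)) i u * coord (vbasis (@fullv k V)) j v : k^o) r.
  rewrite /tlift (bigD1 i) //= (bigD1 j) //= !coord_free ?(basis_free (vbasisP _)) // !eqxx.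
  rewrite big1 ?big1 ?addr0 => [|p pi|q qj].
  - by rewrite mulr1 [RHS]mulr1.
  - rewrite big1 // => q _; rewrite !coord_free ?(basis_free (vbasisP _)) //.
    by rewrite (negPf pi) mul0r scaler0.
  - rewrite !coord_free ?(basis_free (vbasisP _)) //.
    by rewrite (negPf qj) mulr0 scaler0.
by rewrite !E; apply: e; exact: coord_linear.
Qed.

End MoreLinear.

Section Sweedler.
Variables (k : fieldType) (H : hopfAlgType k).
Implicit Types (W : vectType k) (g h : H).
Local Notation S := (@antipode k H).
Local Notation eps := (@counit k H).

Definition sw W h (F : H -> H -> W) : W := tlift F (comul h).

Lemma linear_sw_l (U : lmodType k) W (F : H -> H -> W) (h : U -> H) :
  linear h -> linear (fun x => sw (h x) F).
Proof. by move=> hl c x y; rewrite /sw hl linearP linear_tlift. Qed.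

Lemma linear_sw_r (U : lmodType k) W (F : U -> H -> H -> W) h :
  (forall u v, linear (fun x => F x u v)) -> linear (fun x => sw h (F x)).
Proof. exact: linear_tlift_fun. Qed.

End Sweedler.

(** A Sweedler sum may be rewritten only when its body is multilinear. This tactic discharges these
    side conditions by recursion on the body; for an opaque head it looks for a hypothesis of
    linearity or bilinearity in the context. *)
Ltac lin :=
  cbv beta;
  lazymatch goal with
  | |- forall _, _ => let u := fresh in intro u; lin
  | |- GRing.linear_for _ ?F =>
    first
    [ assumption
    | exact (linearP F)
    | match F with
      | (fun x => x) => exact (@linear_id _ _)
      | (fun x => @?a x + @?b x) => apply: (@linear_add _ _ _ a b); lin
      | (fun x => - @?a x) => apply: (@linear_opp _ _ _ a); lin
      | (fun x => @?a x * ?b) =>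
          first [apply: (@linear_mull _ _ _ a b) | apply: (@linear_kmull _ _ a b)]; lin
      | (fun x => ?b * @?a x) =>
          first [apply: (@linear_mulr _ _ _ a b) | apply: (@linear_kmulr _ _ a b)]; lin
      | (fun x => ?b *: @?a x) => apply: (@linear_scaler _ _ _ b a); lin
      | (fun x => @?a x *: ?b) => apply: (@linear_scalel _ _ _ a b); lin
      | (fun x => tens (@?a x) ?b) =>
          apply: (@linear_comp _ _ _ _ (fun u => tens u b) a); [exact (@tens_linear_l _ _ _ b) | lin]
      | (fun x => tens ?b (@?a x)) =>
          apply: (@linear_comp _ _ _ _ (fun u => tens b u) a); [exact (@tens_linear_r _ _ _ b) | lin]
      | (fun x => @sw _ _ ?W (@?a x) ?G) => apply: (@linear_sw_l _ _ _ W G a); lin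
      | (fun x => @sw _ _ ?W ?h (@?G x)) => apply: (@linear_sw_r _ _ _ W G h); lin
      | (fun x => @tlift _ _ _ ?W ?G (@?a x)) =>
          apply: (@linear_comp _ _ _ _ (@tlift _ _ _ W G) a);
          [exact (@linear_tlift _ _ _ W G) | lin]
      | (fun x => @tlift _ _ _ ?W (@?G x) ?t) => apply: (@linear_tlift_fun _ _ _ _ W G t); lin
      | (fun x => tr (@?G x)) => apply: (@tr_linear _ _ _ G); lin
      | (fun x => \sum_(i <- ?r | @?P i) (@?G x i)) =>
          apply: (@linear_bigsum _ _ _ _ r P (fun i x => G x i)); lin
      | (fun x => @GRing.Linear.sort _ _ _ _ ?f (@?a x)) =>
          first [ apply: (@linear_comp _ _ _ _ f a); [exact (linearP f) | lin]
                | apply: (@linear_scomp _ _ _ f a); lin ]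
      | (fun x => ?G (@?a x) ?v) =>
          match goal with hf : bil ?G |- _ =>
            apply: (@linear_comp _ _ _ _ (fun u => G u v) a); [exact (proj1 hf v) | lin] end
      | (fun x => ?G ?v (@?a x)) =>
          first [
          match goal with hf : bil ?G |- _ =>
            apply: (@linear_comp _ _ _ _ (G v) a); [exact (proj2 hf v) | lin] end
          | match goal with hf : GRing.linear_for _ (?G ?v) |- _ =>
            apply: (@linear_comp _ _ _ _ (G v) a); [exact hf | lin] end
          | match goal with hf : forall i, GRing.linear_for _ (?G i) |- _ =>
            apply: (@linear_comp _ _ _ _ (G v) a); [exact (hf v) | lin] end ]
      | (fun x => ?f (@?a x)) =>
          match goal with hf : GRing.linear_for _ f |- _ =>
            first [apply: (@linear_comp _ _ _ _ f a) | apply: (@linear_kcomp _ _ _ f a)];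
            [exact hf | lin] end
      end ]
  end.
Ltac bilin := split; lin.

Section Hopf.
Variables (k : fieldType) (H : hopfAlgType k).
Implicit Types (W : vectType k) (g h : H).
Local Notation S := (@antipode k H).
Local Notation eps := (@counit k H).

Lemma sw_ext W h (F G : H -> H -> W) : (forall a b, F a b = G a b) -> sw h F = sw h G.
Proof.
by move=> e; apply: eq_bigr => i _; apply: eq_bigr => j _; rewrite e.
Qed.

Lemma sw_map W W' (G : W -> W') h (F : H -> H -> W) : linear G ->
  G (sw h F) = sw h (fun a b => G (F a b)).
Proof.
move=> hG; rewrite /sw /tlift linS //; apply: eq_bigr => i _; rewrite linS //.
by apply: eq_bigr => j _; rewrite (linZ hG).
Qed.

Lemma sw_exch W g h (F : H -> H -> H -> H -> W) :
  sw g (fun a b => sw h (fun c d => F a b c d)) = sw h (fun c d => sw g (fun a b => F a b c d)).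
Proof.
rewrite [LHS](@sw_map _ _ (fun w => w)) //; rewrite /sw /tlift.
under eq_bigr do under eq_bigr do rewrite scaler_sumr.
under eq_bigr do rewrite exchange_big.
rewrite exchange_big /=; apply: eq_bigr => i _.
under eq_bigr do under eq_bigr do rewrite scaler_sumr.
under eq_bigr do rewrite exchange_big.
rewrite exchange_big /=; apply: eq_bigr => j _.
rewrite scaler_sumr; apply: eq_bigr => p _; rewrite scaler_sumr; apply: eq_bigr => q _.
by rewrite !scalerA mulrC.
Qed.

(** Coassociativity for an arbitrary trilinear [F]: both sides of [comulA] are contracted with [F]
    by the linear map [G]. *)
Lemma swA W h (F : H -> H -> H -> W) :
  (forall b c, linear (fun a => F a b c)) -> (forall a c, linear (fun b => F a b c)) ->
  (forall a b, linear (F a b)) ->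
  sw h (fun a b => sw a (fun a1 a2 => F a1 a2 b)) = sw h (fun a b => sw b (fun b1 b2 => F a b1 b2)).
Proof.
move=> h1 h2 h3; pose G (t : tensor H (tensor H H)) := tlift (fun a s => tlift (F a) s) t.
have hF a : bil (F a) by split=> *; [exact: h2|exact: h3].
have GE a s : G (tens a s) = tlift (F a) s.
  by rewrite /G tlift_tensE //; split=> [t|u]; [apply: linear_tlift_fun => *; exact: h1 | exact: linear_tlift].
have hG : linear G by exact: linear_tlift.
have := congr1 G (comulA h).
have E1 (t : tensor H H) (T : H -> H -> tensor H (tensor H H)) : G (tlift T t) = tlift (fun a b => G (T a b)) t.
  rewrite /tlift linS //; apply: eq_bigr => i _; rewrite linS //.
  by apply: eq_bigr => j _; rewrite (linZ hG).
rewrite !E1 => e.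
transitivity (sw h (fun a b => G (tlift (fun a1 a2 => tens a1 (tens a2 b)) (comul a)))).
  apply: sw_ext => a b; rewrite E1; apply: sw_ext => a1 a2.
  by rewrite GE tlift_tensE.
by rewrite /sw e; apply: sw_ext => a b; rewrite GE.
Qed.

Lemma sw_epsl W h (F : H -> W) : linear F -> sw h (fun a b => eps a *: F b) = F h.
Proof.
move=> hF; rewrite -{2}(counitl h) -/(sw h _) sw_map //.
by apply: sw_ext => a b; rewrite (linZ hF).
Qed.

Lemma sw_epsr W h (F : H -> W) : linear F -> sw h (fun a b => eps b *: F a) = F h.
Proof.
move=> hF; rewrite -{2}(counitr h) -/(sw h _) sw_map //.
by apply: sw_ext => a b; rewrite (linZ hF).
Qed.

Lemma sw1 W (F : H -> H -> W) : bil F -> sw 1 F = F 1 1.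
Proof. by move=> hF; rewrite /sw comul1 tlift_tensE. Qed.

Lemma swM W g h (F : H -> H -> W) : bil F ->
  sw (g * h) F = sw g (fun a b => sw h (fun c d => F (a * c) (b * d))).
Proof.
move=> hF; rewrite /sw comulM /tmul; have hT := @linear_tlift _ _ _ _ F.
rewrite -/(sw g _) sw_map //; apply: sw_ext => a b; rewrite -/(sw h _) sw_map //.
by apply: sw_ext => c d; rewrite tlift_tensE.
Qed.

Lemma sw_Sl W h (F : H -> W) : linear F -> sw h (fun a b => F (S a * b)) = eps h *: F 1.
Proof. by move=> hF; rewrite -sw_map // [sw h _]antipodel (linZ hF). Qed.

Lemma sw_Sr W h (F : H -> W) : linear F -> sw h (fun a b => F (a * S b)) = eps h *: F 1.
Proof. by move=> hF; rewrite -sw_map // [sw h _]antipoder (linZ hF). Qed.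

Lemma antipode1 : S 1 = 1.
Proof.
have := @sw_Sl _ 1 (fun x => x) (@linear_id _ _); rewrite sw1; last by bilin.
by rewrite mulr1 counit1 scale1r.
Qed.

Lemma counit_antipode h : eps (S h) = eps h.
Proof.
have := @sw_Sl k^o h eps (linearP _); rewrite counit1 [X in _ = X]mulr1 => <-.
rewrite -(@sw_epsr k^o h (fun a => eps (S a))); last by lin.
by apply: (@sw_ext k^o h) => a b; rewrite counitM mulrC.
Qed.

(** Uniqueness of convolution inverses, written out: [T] is $S(g_1h_1)\,g_2h_2\,S(h_3)S(g_3)$, which
    collapses from the left to $S(h)S(g)$ and from the right to $S(gh)$. *)
Lemma antipodeM g h : S (g * h) = S h * S g.
Proof.
pose T := sw g (fun a b => sw a (fun a1 a2 => sw h (fun c d => sw c (fun c1 c2 =>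
  S (a1 * c1) * (a2 * c2) * (S d * S b))))).
have e1 : T = S h * S g.
  transitivity (sw g (fun a b => eps a *: sw h (fun c d => eps c *: (S d * S b)))).
    apply: sw_ext => a b; rewrite sw_exch (sw_map (G := fun x => eps a *: x)); last by lin.
    apply: sw_ext => c d; rewrite -(@swM _ a c (fun u v => S u * v * (S d * S b))); last by bilin.
    rewrite (@sw_Sl _ _ (fun x => x * (S d * S b))); last by lin.
    by rewrite counitM mul1r scalerA.
  rewrite (@sw_epsl _ g (fun b => sw h (fun c d => eps c *: (S d * S b)))); last by lin.
  by rewrite (@sw_epsl _ h (fun d => S d * S g)); last by lin.
rewrite -e1 /T.
transitivity (sw g (fun a b => sw a (fun a1 a2 => S (a1 * h) * a2 * S b))); last first.
  apply: sw_ext => a b; apply: sw_ext => a1 a2.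
  rewrite (@swA _ h (fun c1 c2 d => S (a1 * c1) * (a2 * c2) * (S d * S b))); try by lin.
  rewrite -(@sw_epsr _ h (fun c => S (a1 * c) * a2 * S b)); last by lin.
  apply: sw_ext => c d; rewrite -{1}[a2]mulr1 mulrA.
  rewrite -(@sw_Sr _ d (fun x => S (a1 * c) * a2 * x * S b)); last by lin.
  by apply: sw_ext => d1 d2; rewrite !mulrA.
rewrite (@swA _ g (fun a1 a2 b => S (a1 * h) * a2 * S b)); try by lin.
rewrite -(@sw_epsr _ g (fun a => S (a * h))); last by lin.
apply: sw_ext => a b; rewrite -{1}[S (a * h)]mulr1.
rewrite -(@sw_Sr _ b (fun x => S (a * h) * x)); last by lin.
by apply: sw_ext => b1 b2; rewrite mulrA.
Qed.

(** Again two collapses of one sum: [T] evaluates [B] on $\Delta(S(h_1)h_2)\,(S(h_4) \otimes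
    S(h_3))$, where either the first two or the last three factors cancel. *)
Lemma sw_antipode W h (B : H -> H -> W) : bil B ->
  sw (S h) B = sw h (fun a b => B (S b) (S a)).
Proof.
move=> hB.
pose T := sw h (fun a b => sw a (fun a1 a2 => sw (S a1 * a2) (fun u v =>
  sw b (fun b1 b2 => B (u * S b2) (v * S b1))))).
transitivity T; last first.
  transitivity (sw h (fun a b => eps a *: sw b (fun b1 b2 => B (S b2) (S b1)))); last first.
    by rewrite (@sw_epsl _ h (fun b => sw b (fun b1 b2 => B (S b2) (S b1)))) //; last by lin.
  apply: sw_ext => a b.
  rewrite (@sw_Sl _ a (fun x => sw x (fun u v => sw b (fun b1 b2 => B (u * S b2) (v * S b1))))); last by lin.
  rewrite sw1; last by bilin.
  by congr (_ *: _); apply: sw_ext => b1 b2; rewrite !mul1r.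
rewrite /T (@swA _ h (fun a1 a2 b => sw (S a1 * a2) (fun u v =>
  sw b (fun b1 b2 => B (u * S b2) (v * S b1))))); try by lin.
rewrite -(@sw_epsr _ h (fun a => sw (S a) B)); last by lin.
apply: sw_ext => a c; rewrite (sw_map (G := fun w => eps c *: w)); last by lin.
transitivity (sw c (fun a2 b => sw (S a) (fun u v => sw a2 (fun p q =>
    sw b (fun b1 b2 => B (u * p * S b2) (v * q * S b1)))))); last first.
  by apply: sw_ext => a2 b; rewrite swM //; bilin.
rewrite sw_exch; apply: sw_ext => u v.
rewrite (@swA _ c (fun p q b => sw b (fun b1 b2 => B (u * p * S b2) (v * q * S b1)))); try by lin.
transitivity (sw c (fun p r => B (u * (p * S r)) v)).
  by rewrite (@sw_Sr _ c (fun x => B (u * x) v)) ?mulr1 //; lin.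
apply: sw_ext => p r.
rewrite -(@swA _ r (fun q b1 b2 => B (u * p * S b2) (v * q * S b1))); try by lin.
rewrite -(@sw_epsl _ r (fun r => B (u * (p * S r)) v)); last by lin.
apply: sw_ext => t b2.
have := @sw_Sr _ t (fun x => B (u * p * S b2) (v * x)).
rewrite mulr1 -mulrA => <-; last by lin.
by apply: sw_ext => q b1; rewrite !mulrA.
Qed.

End Hopf.

(** * Integrals *)

Section Integrals.
Variables (k : fieldType) (H : hopfAlgType k).
Implicit Types (W : vectType k) (g h p : H).
Local Notation S := (@antipode k H).
Local Notation eps := (@counit k H).

Lemma sw_tr h (G : H -> H -> H -> H) :
  tr (fun x => sw h (fun a b => G a b x)) = sw h (fun a b => tr (G a b) : k^o).
Proof.
rewrite /sw /tlift tr_bigsum; apply: eq_bigr => i _.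
by rewrite tr_bigsum; apply: eq_bigr => j _; rewrite trZ.
Qed.

Lemma sw_sum W (I : finType) h (F : I -> H -> H -> W) :
  \sum_i sw h (F i) = sw h (fun a b => \sum_i F i a b).
Proof.
rewrite /sw /tlift exchange_big; apply: eq_bigr => i _ /=.
by rewrite exchange_big; apply: eq_bigr => j _ /=; rewrite scaler_sumr.
Qed.

(** [La] is the component of 1 in a complement of the kernel of the counit, and this makes it a left
    integral. For the right side, $t = \Lambda x - \epsilon(x)\Lambda$ spans a left ideal with $t^2
    = \epsilon(t)t = 0$. Splitting 1 along a complement of this line puts $t = t \cdot 1$ into the
    complement, so $t = 0$. *)
Lemma exists_integral : semisimple H ->
  exists La : H, [/\ eps La = 1, forall x, x * La = eps x *: La & forall x, La * x = eps x *: La].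
Proof.
move=> ssH; pose Ke := lker (linfun (eps : H -> k^o)).
have KeP x : (x \in Ke) = (eps x == 0) by rewrite memv_ker lfunE.
have idK : left_ideal Ke.
  apply/prodvP => a x _; rewrite !KeP counitM => /eqP->.
  by rewrite mulr0.
have [J [/prodvP idJ KJ KJ0]] := ssH _ idK.
have : (1 : H) \in (Ke + J)%VS by rewrite KJ memvf.
case/memv_addP => u uK [La LaJ e].
have e1 : eps La = 1.
  by rewrite -(counit1 H) e linearD /=; move: uK; rewrite KeP => /eqP->; rewrite add0r.
have left x : x * La = eps x *: La.
  apply/eqP; rewrite -subr_eq0 -memv0 -KJ0 memv_cap KeP linearB linearZ /= counitM subrr eqxx /=.
  by rewrite memvB ?memvZ // idJ // memvf.
exists La; split=> // x.
pose t := La * x - eps x *: La; apply/eqP; rewrite -subr_eq0 -/t.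
have lt h : h * t = eps h *: t by rewrite mulrBr mulrA -scalerAr left -scalerAl scalerBr !scalerA mulrC.
have t0 : eps t = 0 by rewrite linearB linearZ /= counitM e1 mul1r mulr1 subrr.
have idt : left_ideal <[t]>%VS.
  by apply/prodvP => h _ _ /vlineP[c ->]; rewrite -scalerAr lt !memvZ ?memv_line.
have [J' [/prodvP idJ' tJ tJ0]] := ssH _ idt.
have : (1 : H) \in (<[t]> + J')%VS by rewrite tJ memvf.
case/memv_addP => _ /vlineP[c ->] [j jJ e']; rewrite -memv0 -tJ0 memv_cap memv_line /=.
rewrite -[t]mulr1 e' mulrDr -scalerAr lt t0 scale0r scaler0 add0r.
by rewrite idJ' // memvf.
Qed.

Definition haar p : k := tr (fun h => p * S (S h)).
Local Notation lam := haar.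

Lemma linear_haar : linear (lam : H -> k^o).
Proof. by rewrite /lam; lin. Qed.

Lemma haarZ c p : lam (c *: p) = c * lam p.
Proof. exact: (linZ linear_haar). Qed.

(** Apply a functional [f]. The operator $h \mapsto f(p_1)\,p_2 S^2(h)$ equals $\sum_i P_i Q_i$,
    because $f(p_1 S^2(h_2) S(h_1))\,p_2 S^2(h_3)$ contracts to it; the index [i] runs over a basis
    and carries the factor that is fed to [f]. In the opposite order $\sum_i Q_i P_i$ sends $y$ to
    $f(y_1 S(y_2))\,p S^2(y_3) = f(1)\,p S^2(y)$, and cyclicity of the trace concludes. *)
Lemma haar_left p : sw p (fun a b => (lam b : k) *: a) = lam p *: 1.
Proof.
have hl := linear_haar; apply: functional_eq => f hf.
rewrite (linZ hf) (sw_map _ _ hf).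
transitivity (tr (fun h => sw p (fun a b => (f a : k) *: (b * S (S h))))).
  rewrite sw_tr; apply: (@sw_ext _ _ k^o p) => a b.
  by rewrite trZ (linZ hf) mulrC.
pose b := vbasis {:H}.
pose Q (i : 'I_(\dim {:H})) h := sw h (fun c d => (f (b`_i * S c) : k) *: (p * S (S d))).
pose P (i : 'I_(\dim {:H})) y := sw y (fun u v => (coord b i u : k) *: v).
have hQ i : linear (Q i) by rewrite /Q; lin.
have hP i : linear (P i) by rewrite /P; lin.
have fE u c : f (u * S c) = \sum_i (coord b i u : k) * f (b`_i * S c).
  rewrite {1}(sum_coord u) mulr_suml linS //; apply: eq_bigr => i _.
  by rewrite -scalerAl (linZ hf).
have e1 h : sw p (fun a b => (f a : k) *: (b * S (S h))) = \sum_i P i (Q i h).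
  transitivity (sw h (fun c d => sw (p * S (S d)) (fun u v => (f (u * S c) : k) *: v))).
    transitivity (sw h (fun c d => sw p (fun a b => sw d (fun d1 d2 =>
        (f (a * S (S d1) * S c) : k) *: (b * S (S d2)))))); last first.
      apply: sw_ext => c d; rewrite swM; last by bilin.
      by apply: sw_ext => x y; rewrite sw_antipode ?sw_antipode //; bilin.
    rewrite sw_exch; apply: sw_ext => x y.
    rewrite -(@swA _ _ _ h (fun c d1 d2 => (f (x * S (S d1) * S c) : k) *: (y * S (S d2)))); try by lin.
    rewrite -(@sw_epsl _ _ _ h (fun h => (f x : k) *: (y * S (S h)))); last by lin.
    apply: sw_ext => e d2.
    have := @sw_Sr _ _ _ e (fun z => (f (x * S z) : k) *: (y * S (S d2))).
    rewrite antipode1 mulr1 => <-; last by lin.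
    by apply: sw_ext => c d1; rewrite antipodeM mulrA.
  under [RHS]eq_bigr do rewrite /Q (sw_map _ _ (hP _)).
  rewrite sw_sum; apply: sw_ext => c d.
  under [RHS]eq_bigr do rewrite (linZ (hP _)) /P (sw_map (G := fun w => _ *: w) _ _ (linear_scaler _ (@linear_id _ _))).
  rewrite sw_sum; apply: sw_ext => u v.
  by rewrite fE scaler_suml; apply: eq_bigr => i _; rewrite scalerA mulrC.
rewrite (eq_tr e1) tr_bigsum.
under eq_bigr do rewrite (trC (hP _) (hQ _)).
rewrite -tr_bigsum.
rewrite (@eq_tr _ _ _ (fun y => (f 1 : k) *: (p * S (S y)))); first by rewrite trZ mulrC.
move=> y; under eq_bigr do rewrite /P (sw_map _ _ (hQ _)).
rewrite sw_sum -(@sw_epsl _ _ _ y (fun y => (f 1 : k) *: (p * S (S y)))); last by lin.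
transitivity (sw y (fun u v => sw v (fun c d => (f (u * S c) : k) *: (p * S (S d))))).
  apply: sw_ext => u v; under eq_bigr do rewrite (linZ (hQ _)) /Q
    (sw_map (G := fun w => _ *: w) _ _ (linear_scaler _ (@linear_id _ _))).
  rewrite sw_sum; apply: sw_ext => c d.
  by rewrite fE scaler_suml; apply: eq_bigr => i _; rewrite scalerA.
rewrite -(@swA _ _ _ y (fun u c d => (f (u * S c) : k) *: (p * S (S d)))); try by lin.
apply: sw_ext => e d.
by rewrite (@sw_Sr _ _ _ e (fun z => (f z : k) *: (p * S (S d)))) //; lin.
Qed.

Lemma haarM x y : lam (x * y) = lam (y * S (S x)).
Proof.
transitivity (tr (fun h => x * (y * S (S h)))); first by apply: eq_tr => h; rewrite mulrA.
rewrite (@trC _ _ (fun z => x * z) (fun h => y * S (S h))); try by lin.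
by apply: eq_tr => h; rewrite !antipodeM mulrA.
Qed.

Variable La : H.
Hypotheses (epsLa : eps La = 1) (leftLa : forall x, x * La = eps x *: La).
Hypothesis rightLa : forall x, La * x = eps x *: La.

Lemma haarLa : lam La = 1.
Proof.
rewrite /haar (@eq_tr _ _ _ (fun h => (eps h : k) *: La)).
  by rewrite tr_rank1 ?epsLa //; exact: linearP.
by move=> h; rewrite rightLa !counit_antipode.
Qed.

(** The Frobenius property of $H$. In $h_1 S((\Lambda h_2)_1)\,\lambda((\Lambda h_2)_2)$, left
    invariance and $\Lambda h_2 = \epsilon(h_2)\Lambda$ leave $h$, whereas multiplicativity of the
    coproduct cancels $h_1 S(h_2)$ and leaves the right side. *)
Lemma haar_dual_basis h : h = sw La (fun a b => (lam (b * h) : k) *: S a).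
Proof.
have hl := linear_haar.
pose T := sw h (fun x y => sw (La * y) (fun u v => (lam v : k) *: (x * S u))).
have e1 : T = h.
  rewrite -[RHS](@sw_epsr _ _ _ h (fun x => x)) //; apply: sw_ext => x y.
  transitivity (x * S (sw (La * y) (fun u v => (lam v : k) *: u))).
    rewrite (sw_map (G := fun w => x * S w)); last by lin.
    by apply: sw_ext => u v; rewrite linearZ /= scalerAr.
  by rewrite haar_left linearZ /= antipode1 rightLa haarZ haarLa mulr1 -scalerAr mulr1.
rewrite -{1}e1 /T.
transitivity (sw h (fun x y => sw y (fun y1 y2 => sw La (fun a b =>
    (lam (b * y2) : k) *: (x * S y1 * S a))))).
  apply: sw_ext => x y; rewrite swM; last by bilin.
  rewrite sw_exch; apply: sw_ext => a b; apply: sw_ext => c d.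
  by rewrite antipodeM mulrA.
rewrite -(@swA _ _ _ h (fun x y1 y2 => sw La (fun a b => (lam (b * y2) : k) *: (x * S y1 * S a)))); try by lin.
rewrite -[RHS](@sw_epsl _ _ _ h (fun h => sw La (fun a b => (lam (b * h) : k) *: S a))); last by lin.
apply: sw_ext => e y.
rewrite (@sw_Sr _ _ _ e (fun X => sw La (fun a b => (lam (b * y) : k) *: (X * S a)))); last by lin.
by congr (_ *: _); apply: sw_ext => a b; rewrite mul1r.
Qed.

Definition antipode_inv h := sw La (fun a b => (lam (b * h) : k) *: a).

Lemma antipodeVK h : S (antipode_inv h) = h.
Proof.
rewrite /antipode_inv (sw_map _ _ (linearP S)) [RHS](haar_dual_basis h).
by apply: sw_ext => a b; rewrite linearZ.
Qed.

Lemma antipode_inj : injective S.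
Proof.
have hl := linear_haar; apply: (can_inj (g := antipode_inv)).
apply: right_inv_left_inv; [exact: linearP | by rewrite /antipode_inv; lin | exact: antipodeVK].
Qed.

Lemma haar_nondeg z : (forall x, lam (x * z) = 0) -> z = 0.
Proof.
move=> e; rewrite (haar_dual_basis z) /sw /tlift big1 // => i _; rewrite big1 // => j _.
by rewrite e scale0r scaler0.
Qed.

Lemma antipode_integral : S La = La.
Proof.
have right y : S La * y = eps y *: S La.
  rewrite -[y]antipodeVK -antipodeM leftLa linearZ /=; congr (_ *: _).
  by rewrite counit_antipode.
rewrite -[RHS]scale1r -epsLa -(counit_antipode La) -leftLa right epsLa scale1r.
by [].
Qed.

Definition left_invariant (mu : H -> k^o) :=
  linear mu /\ forall p, sw p (fun a b => (mu b : k) *: a) = (mu p : k) *: 1.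
Definition right_invariant (mu : H -> k^o) :=
  linear mu /\ forall p, sw p (fun a b => (mu a : k) *: b) = (mu p : k) *: 1.

Lemma right_invariant_antipode mu :
  left_invariant mu -> right_invariant (fun x => mu (S x)).
Proof.
case=> hmu e; split; first by lin.
move=> p; apply: antipode_inj; rewrite (sw_map _ _ (linearP S)) linearZ /= antipode1 -e.
rewrite sw_antipode; last by bilin.
by apply: sw_ext => a b; rewrite linearZ.
Qed.

Lemma left_invariant_antipode mu :
  right_invariant mu -> left_invariant (fun x => mu (S x)).
Proof.
case=> hmu e; split; first by lin.
move=> p; apply: antipode_inj; rewrite (sw_map _ _ (linearP S)) linearZ /= antipode1 -e.
rewrite sw_antipode; last by bilin.
by apply: sw_ext => a b; rewrite linearZ.
Qed.

(** Expand $p$ in the dual bases: $\mu(p) = \mu(S\Lambda_1)\,\lambda(\Lambda_2 p)$, and $\mu \circ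
    S$ is right invariant, so the first leg of $\Lambda$ integrates out. *)
Lemma left_invariant_uniq mu p : left_invariant mu -> mu p = (mu La : k) * lam p.
Proof.
move=> hl; have [hmu _] := hl; have [_ e] := right_invariant_antipode hl.
have hh := linear_haar.
rewrite [in LHS](haar_dual_basis p) (sw_map _ _ hmu).
transitivity (lam (sw La (fun a b => (mu (S a) : k) *: b) * p)).
  rewrite (sw_map (G := fun w => lam (w * p) : k^o)); last by lin.
  apply: (@sw_ext _ _ k^o) => a b; rewrite -scalerAl (linZ hh) (linZ hmu).
  by rewrite /= [RHS]mulrC.
by rewrite e antipode_integral -scalerAl mul1r haarZ.
Qed.

Lemma left_haar : left_invariant lam.
Proof. by split; [exact: linear_haar | exact: haar_left]. Qed.

(** The distinguished grouplike element, which measures how far $\lambda$ is from being right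
    invariant ([haar_right]). *)
Definition modular_elt := sw La (fun a b => (lam a : k) *: b).
Local Notation g := modular_elt.

(** For each functional $f$ the map $x \mapsto \lambda(x_1)f(x_2)$ is left invariant, hence a
    multiple of $\lambda$; its value at [La] is $f(g)$. *)
Lemma haar_right p : sw p (fun a b => (lam a : k) *: b) = (lam p : k) *: g.
Proof.
have hh := linear_haar; apply: functional_eq => f hf; rewrite (sw_map _ _ hf) (linZ hf).
pose mu x := sw x (fun a b => (lam a : k) * f b : k^o).
have hmu : linear mu by rewrite /mu; lin.
have : left_invariant mu.
  split=> // x.
  transitivity (sw x (fun a b => sw b (fun b1 b2 => (lam b1 * f b2 : k) *: a))).
    apply: sw_ext => a b; rewrite /mu (sw_map (G := fun w : k^o => (w : k) *: a)) //.
    by move=> c u v; rewrite scalerDl scalerA.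
  rewrite -(@swA _ _ _ x (fun a b1 b2 => (lam b1 * f b2 : k) *: a)); try by lin.
  rewrite /mu [RHS](sw_map (G := fun w : k^o => (w : k) *: (1 : H))); last first.
    by move=> c u v; rewrite scalerDl scalerA.
  apply: sw_ext => e b2; rewrite mulrC -scalerA -haar_left.
  rewrite (sw_map (G := fun w => (f b2 : k) *: w)); last by lin.
  by apply: sw_ext => a b1; rewrite scalerA mulrC.
move/(left_invariant_uniq p) => e.
transitivity (mu p); first by apply: (@sw_ext _ _ k^o) => a b; rewrite (linZ hf).
rewrite e mulrC; congr (_ * _); rewrite /g (sw_map _ _ hf).
by apply: (@sw_ext _ _ k^o) => a b; rewrite (linZ hf).
Qed.

Lemma sw_modular W (B : H -> H -> W) : bil B -> sw g B = B g g.
Proof.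
move=> hB; have hh := linear_haar.
rewrite {1}/g (sw_map (G := fun x => sw x B)); last by lin.
transitivity (sw La (fun a b => sw b (fun b1 b2 => (lam a : k) *: B b1 b2))).
  apply: sw_ext => a b; rewrite (linZ (linear_sw_l _ (@linear_id _ _))).
  by rewrite (sw_map (G := fun w => (lam a : k) *: w)) //; lin.
rewrite -(@swA _ _ _ La (fun a b1 b2 => (lam a : k) *: B b1 b2)); try by lin.
rewrite [in RHS]/g (sw_map _ _ (proj2 hB g)); apply: sw_ext => e b2.
rewrite (linZ (proj2 hB g)) -(linZ (proj1 hB b2)) -haar_right (sw_map _ _ (proj1 hB b2)).
by apply: sw_ext => a b1; rewrite (linZ (proj1 hB b2)).
Qed.

Lemma counit_modular : eps g = 1.
Proof.
have hh := linear_haar.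
rewrite -haarLa /g (@sw_map _ _ _ k^o (fun x => eps x)); last exact: linearP.
rewrite -[RHS](@sw_epsr _ _ k^o La (fun a => lam a)) //; apply: (@sw_ext _ _ k^o) => a b.
by rewrite linearZ /= mulrC.
Qed.

Lemma antipode_modularl : S g * g = 1.
Proof.
have := @sw_Sl _ _ _ g (fun x => x) (@linear_id _ _).
by rewrite sw_modular ?counit_modular ?scale1r //; bilin.
Qed.

Lemma antipode_modularr : g * S g = 1.
Proof.
have := @sw_Sr _ _ _ g (fun x => x) (@linear_id _ _).
by rewrite sw_modular ?counit_modular ?scale1r //; bilin.
Qed.

Lemma antipode2_modular : S (S g) = g.
Proof.
have e : S (S g) * S g = 1 by rewrite -antipodeM antipode_modularr antipode1.
by rewrite -[LHS]mulr1 -antipode_modularl mulrA e mul1r.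
Qed.

(** The functional $x \mapsto \lambda(xg)$ is right invariant, so $x \mapsto \lambda(S(x)g)$ is left
    invariant and equals $\lambda$ by its value at [La]. Substituting $x = S(p)$ leaves $\lambda
    \circ S^2 = \lambda$, again by uniqueness. *)
Lemma haar_mul_modular p : lam (S p) = lam (p * g).
Proof.
have hh := linear_haar.
have hr : right_invariant (fun x => lam (x * g)).
  split=> [|x]; first by lin.
  transitivity (sw (x * g) (fun u v => (lam u : k) *: v) * S g); last first.
    by rewrite haar_right -scalerAl antipode_modularr.
  rewrite (sw_map (G := fun w => w * S g)); last by lin.
  rewrite swM; last by bilin.
  apply: sw_ext => a b; rewrite sw_modular; last by bilin.
  by rewrite -scalerAl -mulrA antipode_modularr mulr1.
have e1 x : lam (S x * g) = lam x.
  rewrite (left_invariant_uniq x (left_invariant_antipode hr)) antipode_integral rightLa.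
  by rewrite haarZ haarLa counit_modular mulr1 mul1r.
have e2 x : lam (S (S x)) = lam x.
  have h2 := left_invariant_antipode (right_invariant_antipode left_haar).
  by rewrite (left_invariant_uniq x h2) !antipode_integral haarLa mul1r.
by rewrite -[p]antipodeVK e1 e2.
Qed.

(** Tested against the nondegenerate form: $\lambda(xyg) = \lambda(S(y)S(x)) = \lambda(S(S^2(y)x)) =
    \lambda(S^2(y)xg) = \lambda(xgS^4(y))$, with the twisted trace property [haarM] used in the
    second and the last equality. *)
Lemma antipode4 y : y * g = g * S (S (S (S y))).
Proof.
have hh := linear_haar.
apply/eqP; rewrite -subr_eq0; apply/eqP/haar_nondeg => x; rewrite mulrBr (linB hh).
apply/eqP; rewrite subr_eq0; apply/eqP.
rewrite mulrA -haar_mul_modular antipodeM haarM -antipodeM haar_mul_modular.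
by rewrite -mulrA haarM !mulrA.
Qed.

Lemma modular_exp W n (B : H -> H -> W) : bil B -> sw (g ^+ n) B = B (g ^+ n) (g ^+ n).
Proof.
elim: n B => [|n IHn] B hB; first by rewrite expr0 sw1.
rewrite exprS swM // sw_modular; last by bilin.
by rewrite IHn //; bilin.
Qed.

Lemma modular_unit n (x : H) : x * g ^+ n = 0 -> x = 0.
Proof.
elim: n => [|n IHn]; first by rewrite expr0 mulr1.
rewrite exprSr mulrA => e; apply: IHn.
by rewrite -[LHS]mulr1 -antipode_modularr mulrA e mul0r.
Qed.

(** Distinct grouplikes are linearly independent. Take a shortest dependence $g^n = \sum_{i<n} c_i
    g^i$ and apply $x \mapsto f(x_2)x_1$: this gives $c_i(f(g^i) - f(g^n)) = 0$ for all functionals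
    $f$. Some $c_i$ is nonzero since $g$ is invertible, so $g^n = g^i$. *)
Lemma modular_order : exists2 n : nat, (0 < n)%N & g ^+ n = 1.
Proof.
pose X n := [seq g ^+ i | i <- iota 0 n].
have szX n : size (X n) = n by rewrite size_map size_iota.
have exX : exists n, ~~ free (X n).
  exists (\dim {:H}).+1; apply/negP => /eqP fX.
  by have := dimvS (subvf <<X (\dim {:H}).+1>>%VS); rewrite fX szX ltnn.
have [n nfX minX] := ex_minnP exX.
case: n => [|n] in nfX minX *; first by rewrite /X nil_free in nfX.
have fX : free (X n) by apply: contraT => nf; have := minX n nf; rewrite ltnn.
have gX : g ^+ n \in <<X n>>%VS.
  have e : perm_eq (X n.+1) (g ^+ n :: X n).
    by rewrite /X -[n.+1]addn1 iotaD map_cat add0n cats1 perm_rcons.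
  by apply: contraR nfX => nX; rewrite (perm_free e) free_cons nX.
pose c i := coord (in_tuple (X n)) i (g ^+ n).
have Xi (i : 'I_(size (X n))) : (in_tuple (X n))`_i = g ^+ i.
  have ltin : (i < n)%N by rewrite -[X in (_ < X)%N](szX n).
  by rewrite /= /X (nth_map 0%N) ?size_iota // nth_iota.
have ge : g ^+ n = \sum_i c i *: g ^+ i.
  by rewrite {1}(coord_span (X := in_tuple (X n)) gX); apply: eq_bigr => i _; rewrite Xi.
have /existsP[i ci] : [exists i, c i != 0].
  apply: contraT; rewrite negb_exists => /forallP c0.
  have : 1 * g ^+ n = 0.
    by rewrite mul1r ge big1 // => i _; have := c0 i; rewrite negbK => /eqP->; rewrite scale0r.
  by move/modular_unit/eqP; rewrite oner_eq0.
have ltin : (i < n)%N by rewrite -[X in (_ < X)%N](szX n).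
exists (n - i)%N; first by rewrite subn_gt0.
have eg : g ^+ n = g ^+ i.
  apply: functional_eq => f hf.
  pose D x := sw x (fun a b => (f b : k) *: a).
  have hD : linear D by rewrite /D; lin.
  have Dg j : D (g ^+ j) = (f (g ^+ j) : k) *: g ^+ j by rewrite /D modular_exp //; bilin.
  have : \sum_i (c i * (f (g ^+ i) - f (g ^+ n)) : k) *: (in_tuple (X n))`_i = 0.
    under eq_bigr do rewrite Xi mulrBr scalerBl.
    rewrite sumrB (eq_bigr (fun i => D (c i *: g ^+ i))); last first.
      by move=> j _; rewrite (linZ hD) Dg scalerA.
    rewrite -(linS _ _ _ hD) -ge Dg; move: (f (g ^+ n)) => y.
    rewrite ge scaler_sumr; apply/eqP; rewrite subr_eq0; apply/eqP/eq_bigr => j _.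
    by rewrite scalerA mulrC.
  have /freeP fX' : free (in_tuple (X n)) by [].
  move/(fX' (fun i => c i * (f (g ^+ i) - f (g ^+ n))))/(_ i)/eqP.
  by rewrite mulf_eq0 (negPf ci) subr_eq0 => /eqP->.
apply/eqP; rewrite -subr_eq0; apply/eqP/(modular_unit (n := i)).
by rewrite mulrBl -exprD subnK 1?ltnW // mul1r eg subrr.
Qed.

End Integrals.

(** * Traces of automorphisms of semisimple algebras *)

Section BlockTheory.
Variables (k : fieldType) (A : falgType k).
Variables (m : nat) (r : rel 'I_m) (E : 'I_m -> 'I_m -> A) (M : A -> 'I_m -> 'I_m -> k).
Hypothesis mu : matrix_units r E M.

Lemma mu_inj x y : (forall i j, M x i j = M y i j) -> x = y.
Proof.
by move=> e; rewrite (mu_coord mu x) (mu_coord mu y); apply: eq_bigr => i _; apply: eq_bigr => j _; rewrite e.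
Qed.

Lemma mu_ME x p q i j : M (x * E p q) i j = if r p q && (j == q) then M x i p else 0.
Proof.
rewrite (mu_MM mu) (bigD1 p) //= big1 ?addr0 => [|l /negPf lp].
  by rewrite (mu_E mu) eqxx /=; case: ifP => _; rewrite ?mulr1 ?mulr0.
by rewrite (mu_E mu) lp andbF mulr0.
Qed.

Lemma mu_EM x p q i j : M (E p q * x) i j = if r p q && (i == p) then M x q j else 0.
Proof.
rewrite (mu_MM mu) (bigD1 q) //= big1 ?addr0 => [|l /negPf lp].
  by rewrite (mu_E mu) eqxx andbT; case: ifP => _; rewrite ?mul1r ?mul0r.
by rewrite (mu_E mu) lp !andbF mul0r.
Qed.

Definition block i : A := \sum_(p | r i p) E p p.

Lemma mu_M_sum (I : Type) (s : seq I) (P : pred I) (F : I -> A) i j :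
  M (\sum_(l <- s | P l) F l) i j = \sum_(l <- s | P l) M (F l) i j.
Proof. exact: (linS _ _ _ (mu_lin mu i j)). Qed.

Lemma mu_blockM i x p q : M (block i * x) p q = if r i p then M x p q else 0.
Proof.
rewrite mulr_suml mu_M_sum; case: ifP => rip.
  rewrite (bigD1 p) //= big1 ?addr0 => [|l /andP[_ /negPf lp]].
    by rewrite mu_EM (mu_refl mu) eqxx.
  by rewrite mu_EM [p == l]eq_sym lp andbF.
rewrite big1 // => l ril; rewrite mu_EM; case: ifP => // /andP[_ /eqP e].
by rewrite e ril in rip.
Qed.

Lemma block_central i x : block i * x = x * block i.
Proof.
apply: mu_inj => p q; rewrite mu_blockM mulr_sumr mu_M_sum.
have [rpq|npq] := boolP (r p q); last first.
  by rewrite !(mu_M0 mu) // if_same big1 // => l _; rewrite (mu_M0 mu).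
rewrite (mu_sym mu i) (mu_trans mu i rpq) (mu_sym mu q); case: ifP => riq.
  rewrite (bigD1 q) //= big1 ?addr0 => [|l /andP[_ /negPf lq]].
    by rewrite mu_ME (mu_refl mu) eqxx.
  by rewrite mu_ME eq_sym lq andbF.
rewrite big1 // => l ril; rewrite mu_ME; case: ifP => // /andP[_ /eqP e].
by rewrite e ril in riq.
Qed.

Lemma blockE i p q : r i p -> block i * E p q = E p q.
Proof.
move=> rip; apply: mu_inj => a b; rewrite mu_blockM (mu_E mu).
have [->|] := eqVneq a p; first by rewrite rip.
by rewrite andbF if_same.
Qed.

Lemma block_idem i : block i * block i = block i.
Proof.
rewrite {2 3}/block mulr_sumr; apply: eq_bigr => p rip; exact: blockE.
Qed.

Lemma block_neq0 i : block i != 0.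
Proof.
apply: contraTneq isT => e; have := mu_E_neq0 mu (mu_refl mu i).
by rewrite -(blockE i (mu_refl mu i)) e mul0r eqxx.
Qed.

Lemma mu_sandwich x a p q b : r a p -> r q b -> E a p * x * E q b = M x p q *: E a b.
Proof.
move=> rap rqb; rewrite -(mu_mul mu rap (mu_refl mu p)) -(mu_mul mu (mu_refl mu q) rqb).
rewrite -!mulrA (mulrA x) (mulrA (E p p)) [E p p * _]mulrA (mu_EME mu) -scalerAl -scalerAr.
have [rpq|n] := boolP (r p q); last by rewrite (mu_M0 mu) // !scale0r.
rewrite (mu_mul mu rpq rqb) (mu_mul mu rap) //.
by rewrite -(mu_trans mu b rpq) // in rqb.
Qed.

Lemma tr_matrix_units (F : A -> A) : linear F -> tr F = \sum_p \sum_q M (F (E p q)) p q.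
Proof.
move=> hF; rewrite (@eq_tr _ _ _ (fun x => \sum_p \sum_q M x p q *: F (E p q))).
  rewrite tr_bigsum; apply: eq_bigr => p _; rewrite tr_bigsum; apply: eq_bigr => q _.
  by rewrite (@tr_rank1 _ _ (fun x => M x p q : k^o)) //; exact: (mu_lin mu).
move=> x; rewrite {1}(mu_coord mu x) linS //; apply: eq_bigr => p _.
by rewrite linS //; apply: eq_bigr => q _; rewrite (linZ hF).
Qed.

Lemma idem_block_trace i x : block i * x = x -> x * x = x ->
  exists n : nat, \sum_(p | r i p) M x p p = n%:R.
Proof.
move=> ix xx; have [|n e _] := @fin_idem k 'I_m (M x).
  by move=> s t; rewrite -(mu_MM mu) xx.
exists n; rewrite -e big_mkcond; apply: eq_bigr => p _.
by rewrite -{2}ix mu_blockM.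
Qed.

Section Automorphism.
Variables (sg : A -> A) (g : A).
Hypotheses (lsg : linear sg) (sgM : forall x y, sg (x * y) = sg x * sg y).
Hypothesis sg_surj : forall x, exists y, sg y = x.
Variables (N : nat) (N0 : (0 < N)%N) (gN : g ^+ N = 1).

Lemma g_cancel x : x * g = 0 -> x = 0.
Proof.
move=> e; rewrite -[x]mulr1 -gN; case: (N) N0 => // n _.
by rewrite exprS mulrA e mul0r.
Qed.

(* Equivalently, sg maps the block of i to itself. *)
Definition fixed_block i := exists x, sg (E i i) * x * E i i != 0.

(** Matrix units of the block factor through [E i i] on both sides, and $\sigma(E_{ii})AE_{ii} = 0$
    when the block is moved. *)
Lemma unfixed i p l : ~ fixed_block i -> r i p -> r i l -> sg (E p l) * E l l = 0.
Proof.
move=> nf rip ril; have rli : r l i by rewrite (mu_sym mu).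
have z x : sg (E i i) * x * E i i = 0.
  by apply/eqP; apply: contraT => n; case: nf; exists x.
have rpi : r p i by rewrite (mu_sym mu).
rewrite -(mu_mul mu rpi ril) -(mu_mul mu rpi (mu_refl mu i)) -(mu_mul mu rli ril).
rewrite -(mu_mul mu rli (mu_refl mu i)) !sgM -!mulrA.
have -> : sg (E i i) * (sg (E i l) * (E l i * (E i i * E i l))) =
   sg (E i i) * (sg (E i l) * E l i) * E i i * E i l by rewrite !mulrA.
by rewrite z mul0r mulr0.
Qed.

(* Skolem-Noether *)
Lemma fixed_block_inner i : fixed_block i -> exists u u',
  [/\ block i * u = u, block i * u' = u', u' * u = block i, u * u' = block i
    & forall x, block i * x = x -> sg x = u * x * u'].
Proof.
case=> x0 y0; set e := block i.
have rii := mu_refl mu i.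
have Eii : E i i * E i i = E i i by rewrite (mu_mul mu).
have {x0 y0} [y [y0 sy yE]] : exists y, [/\ y != 0, sg (E i i) * y = y & y * E i i = y].
  exists (sg (E i i) * x0 * E i i); split=> //; first by rewrite !mulrA -sgM Eii.
  by rewrite -!mulrA Eii.
have [a Ma] : exists a, M y a i != 0.
  apply: NNPP => no; case/eqP: y0; apply: mu_inj => a b.
  rewrite (lin0 (mu_lin mu a b)) -yE mu_ME rii /=; case: eqP => // _.
  by apply/eqP; apply: contraT => n; case: no; exists a.
have ria : r i a by rewrite (mu_sym mu); apply: contraNT Ma => n; rewrite (mu_M0 mu _ n).
(* The inverse of [y] between the idempotents [E i i] and [sg (E i i)]. That [y * y'] is the second
   idempotent needs surjectivity of [sg], by which the corner of [sg (E i i)] is the image of a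
   line. *)
pose y' := (M y a i)^-1 *: (E i a * sg (E i i)).
have y'y : y' * y = E i i.
  have Ey : E i a * y = M y a i *: E i i by rewrite -(mu_sandwich y ria rii) -mulrA yE.
  by rewrite -scalerAl -mulrA sy Ey scalerA mulVf ?scale1r.
have yy' : y * y' = sg (E i i).
  have [t st] := sg_surj (y * y').
  have e1 : y * y' = sg (E i i * t * E i i).
    rewrite !sgM st -!mulrA mulrA sy; congr (_ * _).
    by rewrite -scalerAl -mulrA -sgM Eii.
  rewrite (mu_EME mu) (linZ lsg) in e1.
  have : y * (y' * y) = (M t i i : k) *: y by rewrite mulrA e1 -scalerAl sy.
  rewrite y'y yE -{1}[y]scale1r => /eqP; rewrite -subr_eq0 -scalerBl scaler_eq0 (negPf y0) orbF.
  by rewrite subr_eq0 e1 => /eqP<-; rewrite scale1r.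
(* Transport of [y] along the matrix units: the term for [p] leads from [E p p] to [sg (E p p)], so
   the sum intertwines [E p q] with [sg (E p q)]. *)
pose u := \sum_(p | r i p) sg (E p i) * y * E i p.
have yy'q x : y * (y' * x) = sg (E i i) * x by rewrite mulrA yy'.
have y'yq x : y' * (y * x) = E i i * x by rewrite mulrA y'y.
have yEq x : y * (E i i * x) = y * x by rewrite mulrA yE.
have syq x : sg (E i i) * (y * x) = y * x by rewrite mulrA sy.
pose u' := \sum_(p | r i p) E p i * y' * sg (E i p).
have rpi p : r i p -> r p i by rewrite (mu_sym mu).
have u'u : u' * u = e.
  rewrite mulr_suml; apply: eq_bigr => p rip; rewrite mulr_sumr (bigD1 p) //= [X in _ + X]big1 ?addr0.
    rewrite -!mulrA (mulrA (sg _) (sg _)) -sgM (mu_mul mu rip (rpi _ rip)) syq y'yq.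
    by rewrite (mu_mul mu rii rip) (mu_mul mu (rpi _ rip) rip).
  move=> q /andP[riq qp]; rewrite -!mulrA (mulrA (sg _) (sg _)) -sgM (mu_mul0 mu) 1?eq_sym //.
  by rewrite (lin0 lsg) mul0r !mulr0.
have uu'1 : u * u' = sg e.
  rewrite (linS _ _ _ lsg) mulr_suml; apply: eq_bigr => p rip.
  rewrite mulr_sumr (bigD1 p) //= [X in _ + X]big1 ?addr0.
    rewrite -!mulrA (mulrA (E i p)) (mu_mul mu rip (rpi _ rip)) yEq yy'q.
    by rewrite -!sgM (mu_mul mu rii rip) (mu_mul mu (rpi _ rip) rip).
  move=> q /andP[riq qp]; rewrite -!mulrA (mulrA (E i p)) (mu_mul0 mu) 1?eq_sym //.
  by rewrite mul0r !mulr0.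
have ue : u * e = u.
  rewrite mulr_suml; apply: eq_bigr => p rip.
  by rewrite -!mulrA -block_central -/e blockE.
have eu : e * u = u by rewrite /e block_central.
have eu' : e * u' = u'.
  by rewrite mulr_sumr; apply: eq_bigr => p rip; rewrite !mulrA blockE.
have u'e : u' * e = u' by rewrite -block_central.
(* So far [u * u'] is only known to be [sg e]. Adding the complementary idempotent $d = 1 - e$ turns
   [u] and [u'] into one-sided inverses in the whole algebra, hence two-sided ones. *)
have uu' : u * u' = e.
  have [d [ed1 ed de dd]] : exists d, [/\ e + d = 1, e * d = 0, d * e = 0 & d * d = d].
    have ee : e * e = e := block_idem i; exists (1 - e).
    have ed : e * (1 - e) = 0 by rewrite mulrBr mulr1 ee subrr.
    split=> //; first by rewrite addrC subrK.
      by rewrite mulrBl mul1r ee subrr.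
    by rewrite {1}mulrBl mul1r ed subr0.
  have mulE c f : c * f = e -> c * e = c -> e * f = f -> (c + d) * (f + d) = 1.
    move=> cf ce ef; rewrite mulrDr !mulrDl cf dd -{1}ce -{1}ef -mulrA ed mulr0 mulrA de mul0r.
    by rewrite addr0 add0r.
  have v'v : (u' + d) * (u + d) = 1 by exact: mulE.
  have : (u + d) * (u' + d) = 1.
    have h := @right_inv_left_inv _ _ (fun x => x * (u + d)) (fun x => x * (u' + d))
      (linear_mull _ (@linear_id _ _)) (linear_mull _ (@linear_id _ _)).
    by rewrite -[u + d]mul1r h // => x; rewrite -mulrA v'v mulr1.
  rewrite mulrDr !mulrDl dd -{2}ue -{2}eu' -mulrA ed mulr0 mulrA de mul0r addr0 add0r -ed1.
  exact: addIr.
have su p q : r i p -> r p q -> sg (E p q) * u = u * E p q.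
  move=> rip rpq; have riq : r i q by rewrite (mu_sym mu) -(mu_trans mu i rpq) (mu_sym mu).
  rewrite mulr_sumr (bigD1 q) //= [X in _ + X]big1 ?addr0; last first.
    by move=> s /andP[_ sq]; rewrite !mulrA -sgM (mu_mul0 mu) 1?eq_sym // (lin0 lsg) !mul0r.
  rewrite mulr_suml (bigD1 p) //= [X in _ + X]big1 ?addr0; last first.
    by move=> s /andP[_ sp]; rewrite -!mulrA (mu_mul0 mu) // !mulr0.
  by rewrite !mulrA -sgM (mu_mul mu rpq (rpi _ riq)) -!mulrA (mu_mul mu rip rpq).
have {uu'1} sge : sg e = e by rewrite -uu'1.
clearbody u u'; exists u, u'; split=> // x ex.
have xe : x * e = x by rewrite -block_central.
suff h z : sg (e * z) * u = u * (e * z).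
  by rewrite -[in LHS]xe sgM sge -uu' mulrA -[in LHS]ex h ex.
rewrite (mu_coord mu z) !mulr_sumr !(linS _ _ _ lsg) mulr_suml; apply: eq_bigr => p _.
rewrite !mulr_sumr !(linS _ _ _ lsg) mulr_suml; apply: eq_bigr => q _.
rewrite -!scalerAr (linZ lsg) -scalerAl; congr (_ *: _).
have [rip|n] := boolP (r i p); last first.
  suff -> : e * E p q = 0 by rewrite (lin0 lsg) mul0r mulr0.
  apply: mu_inj => a1 b1; rewrite (lin0 (mu_lin mu a1 b1)) mu_blockM (mu_E mu).
  by case: (eqVneq a1 p) => [->|_]; rewrite ?(negPf n) // andbF if_same.
rewrite blockE //; have [rpq|n] := boolP (r p q); last by rewrite (mu_E0 mu n) (lin0 lsg) mul0r mulr0.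
exact: su.
Qed.

End Automorphism.

Lemma mu_M_block i p q : M (block i) p q = (r i p && (p == q))%:R.
Proof.
by rewrite -[block i]mulr1 mu_blockM (mu_M1 mu); case: (r i p).
Qed.

Lemma block_central_scalar i z :
  (forall x, block i * x = x -> z * x = x * z) -> block i * z = M z i i *: block i.
Proof.
move=> cz; apply: mu_inj => p q.
rewrite mu_blockM (linZ (mu_lin mu p q)) mu_M_block.
have [rip|_] /= := boolP (r i p); last by rewrite scaler0.
have rpi : r p i by rewrite (mu_sym mu).
have [<-|pq] := eqVneq p q.
  have := congr1 (fun x => M x p i) (cz _ (blockE i rip)).
  by rewrite mu_ME mu_EM rpi !eqxx /= => ->; rewrite [RHS]mulr1.
rewrite scaler0; have [rpq|n] := boolP (r p q); last by rewrite (mu_M0 mu).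
have riq : r i q by rewrite (mu_sym mu) -(mu_trans mu i rpq).
have := congr1 (fun x => M x p q) (cz _ (blockE q riq)).
by rewrite mu_ME mu_EM (mu_refl mu) eqxx (negPf pq).
Qed.

End BlockTheory.

Lemma closed_sqrt (k : closedFieldType) (c : k) : exists d, d * d = c.
Proof.
have /closed_rootP[d /eqP] : size ('X^2 - c%:P) != 1%N by rewrite size_XnsubC.
by rewrite !hornerE expr2 => /eqP; rewrite subr_eq0 => /eqP; exists d.
Qed.

(** * Nonvanishing of twisted traces, by positivity *)

Section PositiveTrace.
Variables (k : closedFieldType) (char0 : [pchar k] =i pred0) (A : falgType k).
Variables (m : nat) (r : rel 'I_m) (E : 'I_m -> 'I_m -> A) (M : A -> 'I_m -> 'I_m -> k).
Hypothesis mu : matrix_units r E M.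
Variables (sg : A -> A) (g : A).
Hypotheses (lsg : linear sg) (sgM : forall x y, sg (x * y) = sg x * sg y).
Hypotheses (sg_surj : forall x, exists y, sg y = x) (sgg : sg g = g).
Hypothesis sg2 : forall x, x * g = g * sg (sg x).
Variables (N : nat) (N0 : (0 < N)%N) (gN : g ^+ N = 1).
Local Notation block := (block r E).

(** On a fixed block $\sigma$ is conjugation by $u$, and the relation between $\sigma^2$ and $g$
    makes $gu^2$ central there, hence a nonzero scalar $c$. Dividing $u$ by a square root of $c$
    gives $w$ with inverse $gw$, so $\sigma(E_{pl}) = wE_{pl}\,gw$. The trace of $x \mapsto
    q\sigma(x)$ on the block thereby factors into those of $qw$ and $gw$. *)
Lemma block_root i : exists w : A,
  [/\ forall q p l, r i p -> r i l -> M (q * sg (E p l)) p l = M (q * w) p p * M (g * w) l l,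
      g * w = w * g
    & fixed_block E sg i /\ (block i * w = w /\ g * w * w = block i)
      \/ ~ fixed_block E sg i /\ w = 0].
Proof.
have [fi|nf] := classic (fixed_block E sg i); last first.
  exists 0; split; rewrite ?mulr0 ?mul0r //; last by right.
  move=> q p l rip ril; rewrite !mulr0 (lin0 (mu_lin mu p p)) mul0r.
  have [rpl|n] := boolP (r p l); last by rewrite (mu_M0 mu).
  apply/eqP; rewrite -[_ == _]orbF -(negPf (mu_E_neq0 mu rpl)) -scaler_eq0 -(mu_EME mu).
  by rewrite -!mulrA (unfixed mu sgM nf) // !mulr0.
have [u [u' [eu eu' u'u uu' su]]] := fixed_block_inner mu lsg sgM sg_surj fi.
set e := block i in eu eu' u'u uu' su *.
have eC x : e * x = x * e := block_central mu i x.
have ue : u * e = u by rewrite -eC.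
have ee : e * e = e := block_idem mu i.
have zC x : e * x = x -> g * u * u * x = x * (g * u * u).
  move=> ex; have := congr1 (fun y => y * u * u) (sg2 x).
  rewrite /= (su _ ex) su; last by rewrite !mulrA eu.
  rewrite !mulrA => ->; rewrite -(mulrA _ u' u) u'u -(mulrA _ u' e) -eC.
  by rewrite -!mulrA u'u ee -eC ex.
have gu : g * u = u * g.
  have ege : e * (e * g) = e * g by rewrite mulrA ee.
  have h1 : sg (e * g) = u * g * u' by rewrite su // mulrA ue.
  have h2 : sg (e * g) = e * g by rewrite sgM sgg su // ue uu'.
  have := congr1 (fun y => y * u) (etrans (esym h1) h2).
  by rewrite -!mulrA u'u -eC !mulrA ue eC -(mulrA g e u) eu.
have z_c := block_central_scalar mu zC; rewrite -/e in z_c.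
have ez : e * (g * u * u) = g * u * u by rewrite !mulrA (eC g) -(mulrA g e u) eu.
set c := M _ i i in z_c; rewrite ez in z_c.
have c0 : c != 0.
  apply/eqP => c0; have := congr1 (fun y => y * u' * u') z_c.
  rewrite /= c0 scale0r !mul0r -(mulrA _ u u') uu' -(mulrA _ u e) ue -(mulrA g) uu' -eC.
  by move/(g_cancel N0 gN)/eqP; rewrite (negPf (block_neq0 mu i)).
have [d dd] := closed_sqrt c^-1.
have d0 : d != 0 by apply: contraNneq c0 => d0; rewrite -invr_eq0 -dd d0 mul0r.
pose w := d *: u.
have gww : g * w * w = e.
  by rewrite -!(scalerAl, scalerAr) scalerA dd z_c scalerA mulVf ?scale1r.
have gw : g * w = d^-1 *: u'.
  have gcu : g * u = c *: u'.
    by rewrite -eu' scalerAl -z_c -!mulrA uu' ue.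
  rewrite -scalerAr gcu scalerA; congr (_ *: _); apply: (mulfI d0).
  by rewrite mulrA dd mulVf // divff.
exists w; split.
- move=> q p l rip ril; have [rpl|n] := boolP (r p l); last first.
    by case/negP: n; rewrite -(mu_trans mu l rip).
  rewrite su; last by rewrite /e (blockE mu).
  have -> : q * (u * E p l * u') = (q * w) * E p l * (g * w).
    by rewrite gw /w -!scalerAr -!scalerAl scalerA mulVf // scale1r !mulrA.
  rewrite (mu_MM mu) (bigD1 l) //= big1 ?addr0; first by rewrite (mu_ME mu) rpl eqxx.
  by move=> s /negPf sl; rewrite (mu_ME mu) sl andbF mul0r.
- by rewrite -scalerAr -scalerAl gu.
- by left; split=> //; split=> //; rewrite -scalerAr eu.
Qed.


(* The spectral projections of g, as polynomials in g. *)
Lemma spectral_idempotents : exists n (a : 'I_n -> k) (Q : 'I_n -> {poly k}),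
  [/\ forall i, a i != 0, \sum_i horner_alg g (Q i) = 1,
      forall i, horner_alg g (Q i) * horner_alg g (Q i) = horner_alg g (Q i)
    & forall i, g * horner_alg g (Q i) = a i *: horner_alg g (Q i)].
Proof.
have [rs] := closed_field_poly_normal ('X^N - 1 : {poly k}).
rewrite lead_coefXnsubC // scale1r => Xrs.
have urs : uniq rs.
  rewrite -separable_prod_XsubC -Xrs separable_Xn_sub_1 //.
  by rewrite (natr_eq0 char0) -lt0n.
have van (P : {poly k}) : (forall x, x \in rs -> P.[x] = 0) -> horner_alg g P = 0.
  move=> P0; have /dvdpP[R ->] : \prod_(x <- rs) ('X - x%:P) %| P.
    apply: uniq_roots_dvdp; last by rewrite uniq_rootsE.
    by apply/allP => x /P0 e; rewrite rootE e.
  by rewrite -Xrs rmorphM rmorphB rmorphXn /= horner_algX rmorph1 gN subrr mulr0.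
pose a (i : 'I_(size rs)) := rs`_i.
have a_inj i j : (a i == a j) = (i == j) by rewrite /a nth_uniq.
have rsP x : x \in rs -> exists i, x = a i.
  by move=> xrs; have lt := xrs; rewrite -index_mem in lt; exists (Ordinal lt); rewrite /a /= nth_index.
pose Q i := \prod_(j | j != i) ((a i - a j)^-1 *: ('X - (a j)%:P)).
have QE i j : (Q i).[a j] = (i == j)%:R.
  rewrite horner_prod; have [<-|ij] := eqVneq i j.
    rewrite big1 // => l li; rewrite !hornerE mulVf // subr_eq0 a_inj eq_sym //.
  by rewrite (bigD1 j) ?(eq_sym j) //= !hornerE subrr mulr0 mul0r.
exists (size rs), a, Q; split.
- move=> i; apply/eqP => ai; have : root ('X^N - 1 : {poly k}) (a i).
    by rewrite Xrs root_prod_XsubC mem_nth.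
  by rewrite rootE !hornerE ai expr0n -[N]prednK //= sub0r oppr_eq0 oner_eq0.
- apply/eqP; rewrite -subr_eq0 -rmorph_sum -(rmorph1 (horner_alg g)) -rmorphB; apply/eqP/van.
  move=> _ /rsP[j ->]; rewrite hornerD hornerN hornerC horner_sum (bigD1 j) //= big1 ?addr0.
    by rewrite QE eqxx subrr.
  by move=> i /negPf ij; rewrite QE ij.
- move=> i; apply/eqP; rewrite -subr_eq0 -rmorphM -rmorphB; apply/eqP/van.
  move=> _ /rsP[j ->]; rewrite hornerD hornerN hornerM QE.
  by case: eqP => _; rewrite ?mulr1 ?mulr0 subrr.
- move=> i; have : horner_alg g ('X * Q i - (a i)%:P * Q i) = 0.
    apply: van => _ /rsP[j ->]; rewrite hornerD hornerN !hornerM hornerX hornerC QE.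
    by case: eqP => [->|_]; rewrite ?mulr1 ?mulr0 subrr.
  by rewrite rmorphB !rmorphM /= horner_algX horner_algC mulr_algl => /eqP; rewrite subr_eq0 => /eqP.
Qed.

Lemma horner_alg_sum (Q : {poly k}) : horner_alg g Q = \sum_(i < size Q) Q`_i *: g ^+ i.
Proof.
rewrite -{1}[Q]coefK poly_def rmorph_sum /=; apply: eq_bigr => i _.
by rewrite linearZ /= rmorphXn /= horner_algX mulr_algl.
Qed.

Lemma horner_alg_comm (Q : {poly k}) w : g * w = w * g -> horner_alg g Q * w = w * horner_alg g Q.
Proof.
move=> gw; rewrite horner_alg_sum mulr_suml mulr_sumr; apply: eq_bigr => i _.
by rewrite -scalerAl -scalerAr; congr (_ *: _); apply/esym/commrX.
Qed.

(** On the image of the spectral projection $q$ of eigenvalue $a$ one has $w^2 = 1/a = b^2$, so $x =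
    qw/b$ is an involution of $f = qe$, where $e$ is the block idempotent. With the idempotent $h =
    (f + x)/2$, the element $qw = b(2h - f)$ has trace $b(2n_1 - n_2)$. *)
Lemma block_root_trace i w (Q : {poly k}) (a b : k) :
  g * w = w * g -> block i * w = w -> g * w * w = block i ->
  horner_alg g Q * horner_alg g Q = horner_alg g Q -> g * horner_alg g Q = a *: horner_alg g Q ->
  b * b = a^-1 -> a != 0 ->
  exists z : int, \sum_(p | r i p) M (horner_alg g Q * w) p p = b * z%:~R.
Proof.
move=> gw ew gww; set q := horner_alg g Q => qq gq bb a0.
have qw : q * w = w * q := horner_alg_comm Q gw.
have b0 : b != 0 by apply: contraNneq a0 => b0; rewrite -invr_eq0 -bb b0 mul0r.
have eC x : block i * x = x * block i := block_central mu i x.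
have ee : block i * block i = block i := block_idem mu i.
move: (block i) (fun x => @idem_block_trace k A m r E M mu i x) ew gww eC ee => e tre ew gww eC ee.
pose x := b^-1 *: (q * w); pose f := q * e.
have two : (2%:R : k) != 0 by rewrite (natr_eq0 char0).
have ff : f * f = f by rewrite /f -mulrA (mulrA e) eC -mulrA ee mulrA qq.
have we : w * e = w by rewrite -eC.
have fx : f * x = x by rewrite /f /x -scalerAr -mulrA (mulrA e) eC -mulrA ew mulrA qq.
have xf : x * f = x by rewrite /f /x -scalerAl mulrA -(mulrA q) -qw mulrA qq -mulrA we.
have xx : x * x = f.
  have e1 : q * w * (q * w) = q * w * w by rewrite mulrA -(mulrA q) -qw mulrA qq.
  have e2 : q * (g * w * w) = a *: (q * w * w).
    by rewrite !mulrA (horner_alg_comm Q (erefl (g * g))) gq -!scalerAl.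
  by rewrite /x -scalerAl -scalerAr scalerA -invfM bb invrK e1 /f -gww e2.
have ef : e * f = f by rewrite eC /f -mulrA ee.
have ex : e * x = x by rewrite eC /x -scalerAl -mulrA we.
pose h := 2%:R^-1 *: (f + x).
have eh : e * h = h by rewrite -scalerAr mulrDr ef ex.
have hh : h * h = h.
  rewrite /h -scalerAl -scalerAr mulrDr !mulrDl ff fx xf xx [x + f]addrC -mulr2n -scaler_nat.
  by rewrite [2^-1 *: (2%:R *: _)]scalerA mulVf // scale1r.
have [n1 e1] := tre _ eh hh; have [n2 e2] := tre _ ef ff.
exists (n1%:Z *+ 2 - n2%:Z).
have -> : q * w = b *: (2%:R *: h - f).
  by rewrite /h scalerA divff // scale1r addrC addKr /x scalerA divff // scale1r.
have lM p : linear (fun y => M y p p : k^o) := mu_lin mu p p.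
under eq_bigr do rewrite (linZ (lM _)) (linB (lM _)) (linZ (lM _)).
rewrite -[LHS]mulr_sumr; congr (_ * _).
rewrite sumrB -[X in X - _]mulr_sumr e1 e2 rmorphB rmorphMn /= -!pmulrn.
by rewrite mulr_natl.
Qed.

(** Suppose all these traces vanish. For the spectral projection of index $c$ the trace is $b_c
    \sum_i s_{ic} \sum_{c'} s_{ic'} a_{c'} b_{c'}$ with an integer matrix $s$, so $s^T s z = 0$ for
    $z = (a_c b_c)$. Then $sz = 0$ by [gram_ker], that is, $gw$ has trace zero on every block. This
    fails on the block of the counit, which is fixed and one-dimensional, so that $gw$ is an
    invertible scalar there. *)
Theorem exists_tr_neq0 (eps : A -> k) : linear (eps : A -> k^o) ->
  (forall x y, eps (x * y) = eps x * eps y) -> eps 1 = 1 -> eps g = 1 ->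
  (forall x, eps (sg x) = eps x) -> exists j, tr (fun x => g ^+ j * sg x) != 0.
Proof.
move=> leps epsM eps1 epsg epssg; apply: NNPP => no.
have tr0 (Q : {poly k}) : tr (fun x => horner_alg g Q * sg x) = 0.
  rewrite (@eq_tr _ _ _ (fun x => \sum_(i < size Q) Q`_i *: (g ^+ i * sg x))).
    rewrite tr_bigsum big1 // => i _; rewrite trZ.
    have -> : tr (fun x => g ^+ i * sg x) = 0; last by rewrite mulr0.
    by apply/eqP; apply: contraT => h; case: no; exists i.
  by move=> x; rewrite horner_alg_sum mulr_suml; apply: eq_bigr => i _; rewrite scalerAl.
have [rep [rrep rep_eq]] := equiv_rep (mu_rel mu).
have rrep' p : r (rep p) p by rewrite (mu_sym mu).
have repr p l : (rep l == rep p) = r p l.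
  apply/eqP/idP => [e|/rep_eq //].
  by rewrite (mu_trans mu l (rrep p)) -e.
have /fin_all_exists[w wP] := block_root.
have trE q : tr (fun x => q * sg x) =
    \sum_i (\sum_(p | rep p == i) M (q * w i) p p) * (\sum_(p | rep p == i) M (g * w i) p p).
  rewrite (tr_matrix_units mu); last by move=> c x y; rewrite lsg mulrDr -scalerAr.
  rewrite (partition_big rep xpredT) //=; apply: eq_bigr => i _.
  rewrite mulr_suml; apply: eq_bigr => p /eqP <-; rewrite mulr_sumr [RHS]big_mkcond /=.
  apply: eq_bigr => l _; rewrite repr; case: ifP => [rpl|/negbT n]; last exact: (mu_M0 mu).
  have [-> //] := wP (rep p); by rewrite (mu_sym mu) -(mu_trans mu _ rpl) (mu_sym mu).
have [n [a [Q [a0 sQ QQ gQ]]]] := spectral_idempotents.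
have /fin_all_exists[b bb] i : exists b, b * b = (a i)^-1 by exact: closed_sqrt.
have sP i (c : 'I_n) : exists z : int,
    \sum_(p | rep p == i) M (horner_alg g (Q c) * w i) p p = b c * z%:~R.
  have [ri|ni] := eqVneq (rep i) i; last first.
    exists 0; rewrite mulr0 big1 // => p /eqP rp; case/eqP: ni.
    by rewrite -{2}rp; apply: rep_eq; rewrite -{1}rp.
  have [_ gw [[_ [ew gww]]|[_ w0]]] := wP i; last first.
    exists 0; rewrite mulr0 big1 // => p _; rewrite w0 mulr0.
    exact: (lin0 (mu_lin mu p p)).
  rewrite (eq_bigl (r i)); last by move=> p; rewrite -[in LHS]ri repr.
  exact: (block_root_trace gw ew gww (QQ c) (gQ c) (bb c) (a0 c)).
have {sP} /fin_all_exists[s sE] i : exists s : 'I_n -> int, forall c,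
    \sum_(p | rep p == i) M (horner_alg g (Q c) * w i) p p = b c * (s c)%:~R.
  by have /fin_all_exists[s sE] := sP i; exists s.
have b0 c : b c != 0 by apply: contraNneq (a0 c) => b0; rewrite -invr_eq0 -bb b0 mul0r.
have tgE i : \sum_(p | rep p == i) M (g * w i) p p = \sum_c (s i c)%:~R * (a c * b c).
  transitivity (\sum_(p | rep p == i) \sum_c a c * M (horner_alg g (Q c) * w i) p p).
    apply: eq_bigr => p _; have -> : g * w i = \sum_c a c *: (horner_alg g (Q c) * w i).
      rewrite -{1}[w i]mul1r -sQ mulr_suml mulr_sumr; apply: eq_bigr => c _.
      by rewrite mulrA gQ scalerAl.
    by rewrite (mu_M_sum mu); apply: eq_bigr => c _; rewrite (linZ (mu_lin mu p p)).
  rewrite exchange_big; apply: eq_bigr => c _ /=.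
  by rewrite -mulr_sumr sE mulrA mulrC.
pose sm := \matrix_(i, c) s i c; pose z : 'cV[k]_n := \col_c (a c * b c).
have smz i : (map_mx intr sm *m z) i 0 = \sum_(p | rep p == i) M (g * w i) p p.
  by rewrite tgE !mxE; apply: eq_bigr => c _; rewrite !mxE.
have /(gram_ker char0)/matrixP kz : map_mx intr (sm^T *m sm) *m z = 0.
  rewrite map_mxM -mulmxA; apply/matrixP => c j; rewrite ord1 [LHS]mxE [RHS]mxE.
  apply: (mulfI (b0 c)); rewrite mulr0 -[RHS](tr0 (Q c)) trE mulr_sumr; apply: eq_bigr => i _.
  by rewrite smz sE !mxE mulrA.
have [i0 ei0] : exists i, eps (E i i) != 0.
  apply: NNPP => nex; have := eps1; rewrite -(mu_one mu) (linS _ _ _ leps) big1.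
    by move/esym/eqP; rewrite oner_eq0.
  by move=> i _; apply/eqP; apply: contraT => h; case: nex; exists i.
(* A multiplicative functional takes the same value on all diagonal units of a block, and these are
   orthogonal; so a block on which it is nonzero has size one. *)
have single p : r i0 p -> p = i0.
  move=> rp; apply/eqP; apply: contraT => pi0.
  have : eps (E p p) * eps (E i0 i0) = 0 by rewrite -epsM (mu_mul0 mu) // (lin0 leps).
  have rp' : r p i0 by rewrite (mu_sym mu).
  rewrite -(mu_mul mu rp' rp) epsM [eps (E p i0) * _]mulrC -epsM (mu_mul mu rp rp') => /eqP.
  by rewrite mulf_eq0 (negPf ei0).
have rep0 : rep i0 = i0 by exact: single.
have [_ gw [[_ [ew gww]]|[nf _]]] := wP i0; last first.
  apply: nf; exists 1; apply: contraNneq ei0 => e.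
  have : eps (sg (E i0 i0) * 1 * E i0 i0) = 0 by rewrite e (lin0 leps).
  by rewrite !epsM eps1 mulr1 epssg => /eqP; rewrite mulf_eq0 orbb.
have := kz i0 0; rewrite smz mxE (eq_bigl (pred1 i0)); last first.
  move=> p; rewrite -[in LHS]rep0 repr; apply/idP/eqP => [/single|->] //; exact: (mu_refl mu).
rewrite big_pred1_eq => M0.
have blk0 : block i0 = E i0 i0.
  rewrite /block (eq_bigl (pred1 i0)) ?big_pred1_eq // => p; apply/idP/eqP => [/single|->] //.
  exact: (mu_refl mu).
have : block i0 * (g * w i0) * block i0 = 0 by rewrite blk0 (mu_EME mu) M0 scale0r.
rewrite (block_central mu) -mulrA (block_idem mu) => e.
have : block i0 = 0 by rewrite -gww -{2}ew mulrA e mul0r.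
by apply/eqP; exact: (block_neq0 mu).
Qed.

End PositiveTrace.

(** * The Larson-Radford theorem *)

Section RegularCharacter.
Variables (k : fieldType) (H : hopfAlgType k).
Implicit Types (W : vectType k) (g h x y : H) (f : H -> k^o).
Local Notation S := (@antipode k H).
Local Notation eps := (@counit k H).
Local Notation N := (\dim {:H}).

(** The left action of the dual on $H$, usually written $f \rightharpoonup x$. *)
Definition hit f x : H := sw x (fun a b => (f b : k) *: a).

Lemma linear_hit f : linear f -> linear (hit f).
Proof. by move=> hf; rewrite /hit; lin. Qed.

Lemma hit_comp f f' x : linear f -> linear f' ->
  hit f (hit f' x) = hit (fun y => sw y (fun a b => (f a : k) * f' b : k^o)) x.
Proof.
move=> hf hf'; rewrite [hit f' x]/hit (sw_map _ _ (linear_hit hf)).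
transitivity (sw x (fun a b => sw a (fun a1 a2 => ((f a2 : k) * f' b : k) *: a1))).
  apply: sw_ext => a b; rewrite (linZ (linear_hit hf)) /hit (sw_map (G := fun w => (f' b : k) *: w)); last by lin.
  by apply: sw_ext => a1 a2; rewrite scalerA mulrC.
rewrite (@swA _ _ _ x (fun a1 a2 b => ((f a2 : k) * f' b : k) *: a1)); try by lin.
apply: sw_ext => a b; rewrite (sw_map (G := fun w : k^o => (w : k) *: a)) //.
by move=> c u v; rewrite scalerDl scalerA.
Qed.

(** The element of $H$ that represents the functional $f \mapsto \mathrm{Tr}(f \rightharpoonup)$ on
    the dual, see [regular_charE]; the basis only serves to produce it. *)
Definition regular_char : H := \sum_(i < N) tr (hit (coord (vbasis {:H}) i)) *: (vbasis {:H})`_i.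
Local Notation chi := regular_char.

Lemma regular_charE f : linear f -> f chi = tr (hit f).
Proof.
move=> hf; rewrite /chi linS //.
rewrite (@eq_tr _ _ _ (fun x => \sum_(i < N) (f (vbasis {:H})`_i : k) *: hit (coord (vbasis {:H}) i) x)).
  by rewrite tr_bigsum; apply: eq_bigr => i _; rewrite (linZ hf) trZ mulrC.
move=> x; rewrite /hit.
under [RHS]eq_bigr do rewrite (sw_map (G := fun w => _ *: w) _ _ (linear_scaler _ (@linear_id _ _))).
rewrite sw_sum; apply: sw_ext => a b.
rewrite {1}(sum_coord b) linS // scaler_suml; apply: eq_bigr => i _.
by rewrite (linZ hf) scalerA mulrC.
Qed.

Definition cocommutative x :=
  forall W (B : H -> H -> W), bil B -> sw x B = sw x (fun a b => B b a).

Lemma bil_sum W (B : H -> H -> W) a b : bil B ->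
  B a b = \sum_i \sum_j (coord (vbasis {:H}) i a * coord (vbasis {:H}) j b) *: B (vbasis {:H})`_i (vbasis {:H})`_j.
Proof.
case=> h1 h2; rewrite {1}(sum_coord a) (linS _ _ _ (h1 b)); apply: eq_bigr => i _.
rewrite (linZ (h1 b)) {1}(sum_coord b) (linS _ _ _ (h2 _)) scaler_sumr; apply: eq_bigr => j _.
by rewrite (linZ (h2 _)) scalerA.
Qed.

Lemma cocommutativeP x :
  (forall f f', linear f -> linear f' -> sw x (fun a b => (f a : k) * f' b : k^o) =
    sw x (fun a b => (f' a : k) * f b : k^o)) -> cocommutative x.
Proof.
move=> e W B hB.
have hB' : bil (fun a b => B b a) by case: hB.
transitivity (\sum_i \sum_j (sw x (fun a b => (coord (vbasis {:H}) i a : k) * coord (vbasis {:H}) j b : k^o) : k)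
    *: B (vbasis {:H})`_i (vbasis {:H})`_j).
  under [RHS]eq_bigr => i _.
    under eq_bigr => j _.
      rewrite (sw_map (G := fun w : k^o => (w : k) *: B (vbasis {:H})`_i (vbasis {:H})`_j)); last first.
        by move=> c u v; rewrite scalerDl scalerA.
      over.
    rewrite sw_sum; over.
  by rewrite sw_sum; apply: sw_ext => a b; rewrite (bil_sum _ _ hB).
under eq_bigr do under eq_bigr do rewrite (e _ _ (@coord_linear _ _ _) (@coord_linear _ _ _)).
under eq_bigr => i _.
  under eq_bigr => j _.
    rewrite (sw_map (G := fun w : k^o => (w : k) *: B (vbasis {:H})`_i (vbasis {:H})`_j)); last first.
      by move=> c u v; rewrite scalerDl scalerA.
    over.
  rewrite sw_sum; over.
rewrite sw_sum; apply: sw_ext => a b; rewrite [RHS](bil_sum _ _ hB).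
by apply: eq_bigr => i _; apply: eq_bigr => j _; rewrite mulrC.
Qed.

Lemma regular_char_cocommutative : cocommutative chi.
Proof.
apply: cocommutativeP => f f' hf hf'.
have e f1 f2 : linear f1 -> linear f2 ->
    sw chi (fun a b => (f1 a : k) * f2 b : k^o) = tr (fun x => hit f1 (hit f2 x)).
  move=> h1 h2; rewrite [LHS](@regular_charE (fun x => sw x (fun a b => (f1 a : k) * f2 b : k^o))); last by lin.
  by apply: (@eq_tr k H) => x; rewrite hit_comp.
by rewrite !e // (trC (linear_hit hf) (linear_hit hf')).
Qed.

Lemma hit_mull f b h : linear f -> hit f (b * h) =
  sw b (fun b1 b2 => sw h (fun h1 h2 => (f (b2 * h2) : k) *: (b1 * h1))).
Proof. by move=> hf; rewrite /hit swM //; bilin. Qed.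

(** Since $f(xh_2)h_1 = S(x_1)\,(f \rightharpoonup x_2h)$, cyclicity of the trace moves $S(x_1)$
    behind $x_2$, where the hypothesis $x_2S(x_1) = \epsilon(x)$ applies. That hypothesis holds for
    cocommutative $x$, so $\chi^2 = N\chi$ is available before $S^2 = 1$; once $S^2 = 1$ is known it
    holds for all $x$. *)
Lemma mul_regular_char x : (forall W (F : H -> W), linear F -> sw x (fun a b => F (b * S a)) = eps x *: F 1) ->
  x * chi = eps x *: chi.
Proof.
move=> hx; apply: functional_eq => f hf; rewrite (linZ hf) (regular_charE hf).
rewrite (@regular_charE (fun y => f (x * y))); last by lin.
have hh := linear_hit hf.
rewrite (@eq_tr _ _ _ (fun h => sw x (fun a b => S a * hit f (b * h)))); last first.
  move=> h; rewrite -[LHS](@sw_epsl _ _ _ x (fun x => hit (fun y => f (x * y)) h)); last by rewrite /hit; lin.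
  transitivity (sw x (fun a b => sw b (fun b1 b2 => sw h (fun h1 h2 => (f (b2 * h2) : k) *: (S a * (b1 * h1)))))); last first.
    apply: sw_ext => a b; rewrite hit_mull // (sw_map (G := fun w => S a * w)); last by lin.
    apply: sw_ext => b1 b2; rewrite (sw_map (G := fun w => S a * w)); last by lin.
    by apply: sw_ext => h1 h2; rewrite scalerAr.
  rewrite -(@swA _ _ _ x (fun a b1 b2 => sw h (fun h1 h2 => (f (b2 * h2) : k) *: (S a * (b1 * h1))))); try by lin.
  apply: sw_ext => e b2.
  transitivity (sw e (fun a b1 => sw h (fun h1 h2 => (f (b2 * h2) : k) *: (S a * b1 * h1)))).
    rewrite (@sw_Sl _ _ _ e (fun z => sw h (fun h1 h2 => (f (b2 * h2) : k) *: (z * h1)))); last by lin.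
    by congr (_ *: _); apply: sw_ext => h1 h2; rewrite mul1r.
  by apply: sw_ext => a b1; apply: sw_ext => h1 h2; rewrite mulrA.
rewrite (@sw_tr _ _ x (fun a b h => S a * hit f (b * h))).
transitivity (sw x (fun a b => tr (fun h => hit f ((b * S a) * h)) : k^o)).
  apply: (@sw_ext _ _ k^o) => a b.
  rewrite (@trC _ _ (fun z => S a * z) (fun h => hit f (b * h))); try by lin.
  by apply: (@eq_tr k H) => h; rewrite mulrA.
rewrite (hx k^o (fun z => tr (fun h => hit f (z * h)) : k^o)); last by lin.
by congr (_ *: _); apply: (@eq_tr k H) => h; rewrite mul1r.
Qed.

Lemma counit_regular_char : eps chi = N%:R.
Proof.
rewrite (@regular_charE eps); last exact: linearP.
rewrite -(tr_id H); apply: (@eq_tr k H) => x.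
by rewrite /hit (@sw_epsr _ _ _ x (fun a => a)).
Qed.

Lemma haar_regular_char : haar chi = haar (1 : H).
Proof.
rewrite (regular_charE (@linear_haar k H)) -(@tr_rank1 _ _ _ _ (@linear_haar k H)).
by apply: (@eq_tr k H) => x; exact: haar_left.
Qed.

Lemma regular_char_square : chi * chi = N%:R *: chi.
Proof.
rewrite mul_regular_char ?counit_regular_char // => W F hF.
rewrite regular_char_cocommutative; last by bilin.
by rewrite (sw_Sr _ hF) counit_regular_char.
Qed.

Lemma regular_char_antipode2 : (forall x, S (S (S (S x))) = x) -> S (S chi) = chi.
Proof.
move=> S4; apply: functional_eq => f hf; rewrite (regular_charE hf).
rewrite (@regular_charE (fun x => f (S (S x)))); last by lin.
have hh := linear_hit hf.
rewrite (@eq_tr _ _ _ (fun x => S (S (hit f (S (S x)))))).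
  rewrite (@trC _ _ (fun y => S (S y)) (fun x => hit f (S (S x)))); try by lin.
  by apply: (@eq_tr k H) => x; rewrite S4.
move=> x; rewrite /hit sw_antipode; last by bilin.
rewrite sw_antipode; last by bilin.
rewrite (sw_map (G := fun w => S (S w))); last by lin.
by apply: sw_ext => a b; rewrite !linearZ /= S4.
Qed.

End RegularCharacter.

Section LarsonRadford.
Variables (k : closedFieldType) (char0 : [pchar k] =i pred0) (H : hopfAlgType k).
Hypothesis ssH : semisimple H.
Local Notation S := (@antipode k H).
Local Notation eps := (@counit k H).
Local Notation N := (\dim {:H}).
Local Notation chi := (regular_char H).

Lemma haar1_antipode4 : haar (1 : H) <> 0 /\ forall x : H, S (S (S (S x))) = x.
Proof.
have [La [e1 lL rL]] := exists_integral ssH.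
pose g := modular_elt La.
have [n n0 gn] : exists2 n : nat, (0 < n)%N & g ^+ n = 1 := modular_order e1 lL rL.
have minU I : minimal_left_ideal I -> exists2 f : H, f \in I & forall x, x \in I -> x * f = x.
  by case=> idI _ _; apply: left_ideal_complement_unit => //; exact: ssH.
have [m [r [E [M mu]]]] := wedderburn minU.
have [||||||||||j] := @exists_tr_neq0 k char0 H m r E M mu (fun x => S (S x)) g _ _ _ _ _ n n0 gn eps.
- by lin.
- by move=> x y; rewrite !antipodeM.
- move=> x; exists (antipode_inv La (antipode_inv La x)).
  by rewrite !(antipodeVK e1 rL).
- exact: antipode2_modular.
- by move=> x; exact: antipode4.
- exact: linearP.
- exact: counitM.
- exact: counit1.
- exact: counit_modular.
- by move=> x; rewrite !counit_antipode.
rewrite -/(haar (g ^+ j)) => lj.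
have hl := @linear_haar k H.
(* Left invariance at the grouplike $g^j$ reads $\lambda(g^j)(g^j - 1) = 0$. Hence $\lambda(1) =
   \lambda(g^j)$ is nonzero, and [haar_right] at 1 then forces $g = 1$. *)
have gj : g ^+ j = 1.
  have := haar_left (g ^+ j); rewrite (modular_exp e1 lL rL); last by bilin.
  move/eqP; rewrite -subr_eq0 -scalerBr scaler_eq0 (negPf lj) subr_eq0 => /eqP->.
  by [].
have l1 : haar (1 : H) != 0 by rewrite -gj.
have g1 : g = 1.
  have := haar_right e1 lL rL 1; rewrite sw1; last by bilin.
  by move/eqP; rewrite eq_sym -subr_eq0 -scalerBr scaler_eq0 (negPf l1) subr_eq0 => /eqP.
split; first exact/eqP.
by move=> x; have := antipode4 e1 lL rL x; rewrite -/g g1 mulr1 mul1r.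
Qed.

(* With p = chi / N an idempotent, haar p = haar 1 / N reads Tr(S^2 | pH) = Tr(S^2) / N; both traces
   are integers, Tr(S^2) <> 0 and |Tr(S^2)| <= N. *)
Theorem antipode_involutive (x : H) : S (S x) = x.
Proof.
have [l1 S4] := haar1_antipode4.
have N0 : (0 < N)%N.
  by rewrite lt0n dimv_eq0; apply: contraTneq (memvf (1 : H)) => ->; rewrite memv0 oner_eq0.
have NR : N%:R != 0 :> k by rewrite (natr_eq0 char0) -lt0n.
have two : 2%:R != 0 :> k by rewrite (natr_eq0 char0).
pose p := N%:R^-1 *: chi; have hl := @linear_haar k H.
have pp : p * p = p.
  rewrite /p -scalerAl -scalerAr regular_char_square; congr (_ *: _).
  by rewrite scalerA mulVf // scale1r.
have Sp : S (S p) = p by rewrite /p !linearZ /= regular_char_antipode2.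
pose s (y : H) := S (S y).
have ls : linear s by rewrite /s; lin.
have ss y : s (s y) = y by exact: S4.
have sp y : s (p * y) = p * s y by rewrite /s !antipodeM Sp.
(* From $F^3 = F$ the operators $(F^2 \pm F)/2$ are idempotents with difference $F$, so the trace is
   a difference of two ranks. *)
have halfD (F : H -> H) : linear F -> (forall y, F (F (F y)) = F y) ->
    exists n1 n2 : nat, tr F = n1%:R - n2%:R.
  move=> lF FFF.
  have idem c : c * c = 1 -> let G y := 2%:R^-1 *: (F (F y) + c *: F y) in
      exists n : nat, tr G = n%:R.
    move=> cc G; exists (\rank (mxf G)); apply: tr_idem; first by rewrite /G; lin.
    have FG y : F (G y) = 2%:R^-1 *: (F y + c *: F (F y)).
      by rewrite /G (linZ lF) (linD lF) (linZ lF) FFF.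
    have FFG y : F (F (G y)) = G y.
      by rewrite FG (linZ lF) (linD lF) (linZ lF) FFF.
    have cFG y : c *: F (G y) = G y.
      by rewrite FG scalerA mulrC -scalerA scalerDr scalerA cc scale1r addrC.
    by move=> y; rewrite {1}/G FFG cFG -mulr2n -scaler_nat scalerA mulVf ?scale1r.
  have [n1 e1] := idem 1 (mulr1 1).
  have [n2 e2] := idem (- 1) (etrans (mulrNN 1 1) (mulr1 1)).
  exists n1, n2; rewrite -e1 -e2 -trB; apply: eq_tr => y.
  rewrite -scalerBr scale1r scaleN1r opprD opprK addrACA subrr add0r.
  by rewrite -mulr2n -scaler_nat scalerA mulVf ?scale1r.
have [n1 [n2 e12]] : exists n1 n2 : nat, tr (fun y => p * s y) = n1%:R - n2%:R.
  apply: halfD => [|y]; first by lin.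
  by rewrite /= sp ss !mulrA !pp.
have [r1 [r2 [e1 e2 le1 le2]]] : exists r1 r2 : nat,
   [/\ tr s = N%:R - 2%:R * r1%:R, (r1 = 0%N -> forall y, s y = y), (r1 <= N)%N
     & (r1 = N -> False)].
  pose Gm y := 2%:R^-1 *: (y - s y); pose Gp y := 2%:R^-1 *: (y + s y).
  have lm : linear Gm by rewrite /Gm; lin.
  have lp : linear Gp by rewrite /Gp; lin.
  have mm y : Gm (Gm y) = Gm y.
    have e : s (Gm y) = - Gm y by rewrite /Gm (linZ ls) (linB ls) ss -scalerN opprB.
    by rewrite {1}/Gm e opprK -mulr2n -scaler_nat scalerA mulVf ?scale1r.
  have ppp y : Gp (Gp y) = Gp y.
    have e : s (Gp y) = Gp y by rewrite /Gp (linZ ls) (linD ls) ss addrC.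
    by rewrite {1}/Gp e -mulr2n -scaler_nat scalerA mulVf ?scale1r.
  have tm := tr_idem lm mm; have tp := tr_idem lp ppp.
  have sE : tr s = N%:R - 2%:R * tr Gm.
    rewrite -(tr_id H) -trZ -trB; apply: (@eq_tr k H) => y.
    by rewrite /Gm scalerA divff // scale1r opprB addrCA subrr addr0.
  have pE : tr Gp = N%:R - tr Gm.
    rewrite -(tr_id H) -trB; apply: (@eq_tr k H) => y; rewrite /Gm /Gp.
    apply: (scalerI two); rewrite scalerBr !scalerA divff // !scale1r.
    by rewrite scaler_nat mulr2n opprB addrA addrAC addrK addrC.
  exists (\rank (mxf Gm)), 0%N; split.
  - by rewrite sE tm.
  - move/eqP; rewrite mxrank_eq0 => /eqP m0 y; have := mxf0 lm m0 y.
    by move/eqP; rewrite scaler_eq0 invr_eq0 (negPf two) subr_eq0 => /eqP <-.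
  - exact: rank_leq_row.
  - move=> rN; have := pE; rewrite tp tm rN subrr => /eqP; rewrite (natr_eq0 char0) mxrank_eq0 => /eqP p0.
    have := mxf0 lp p0 1; rewrite /Gp /s !antipode1 -mulr2n -scaler_nat scalerA mulVf // scale1r.
    by move/eqP; rewrite oner_eq0.
have lp1 : tr (fun y => p * s y) = N%:R^-1 * tr s.
  have -> : tr s = haar (1 : H) by apply: (@eq_tr k H) => y; rewrite mul1r.
  by rewrite -haar_regular_char -haarZ.
have ls0 : tr s != 0.
  by apply/eqP => s0; apply: l1; rewrite -s0; apply: (@eq_tr k H) => y; rewrite mul1r.
(* With $r_1$ the dimension of the $(-1)$-eigenspace of $S^2$, this is $N(n_1 - n_2) = N - 2r_1$.
   The right side is nonzero and at most $N$ in absolute value, so it is $\pm N$; the value $-N$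
   would mean $S^2 = -1$, against $S^2(1) = 1$. So $r_1 = 0$. *)
apply: e2; have E : (N + N * n2 = N * n1 + 2 * r1)%N.
  apply: (natr_inj char0); rewrite (natrD _ N) (natrD _ (N * n1)) !natrM.
  have h : N%:R * (n1%:R - n2%:R) = N%:R - 2%:R * r1%:R :> k.
    by rewrite -e12 lp1 mulrA divff // mul1r e1.
  have -> : N%:R * n1%:R = N%:R * (n1%:R - n2%:R) + N%:R * n2%:R :> k by ring.
  by rewrite h; ring.
have : N <> (2 * r1)%N.
  by move=> N2; move: ls0; rewrite e1 -natrM -N2 subrr eqxx.
move=> N2; have [n12|n12|n12] := ltngtP n1 n2.
- case: le2; nia.
- nia.
- by case: N2; move: E; rewrite n12; lia.
Qed.

End LarsonRadford.

(** * Simple subcoalgebras and irreducible characters *)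

Lemma free_dual (k : fieldType) (V : vectType k) (T : eqType) (F : T -> V) (G : T -> 'Hom(V, k^o)) s :
  uniq s -> (forall p q, p \in s -> q \in s -> G p (F q) = (p == q)%:R) -> free [seq F p | p <- s].
Proof.
elim: s => [|p s IHs] /= => [_ _|/andP[ps us] GF]; first exact: nil_free.
rewrite free_cons IHs // ?andbT => [|a b sa sb]; last by rewrite GF // inE ?sa ?sb orbT.
apply/negP => Fp; have : F p \in lker (G p).
  apply: subvP Fp; apply/span_subvP => _ /mapP[q qs ->]; rewrite memv_ker GF ?inE ?qs ?eqxx ?orbT //.
  have [e|_] := eqVneq p q; last exact: eqxx.
  by move: ps; rewrite e qs.
by rewrite memv_ker GF ?inE ?eqxx // oner_eq0.
Qed.

Lemma free_map_coef (k : fieldType) (V : vectType k) (T : eqType) (F : T -> V) (c : T -> k) s :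
  free [seq F p | p <- s] -> \sum_(p <- s) c p *: F p = 0 -> forall p, p \in s -> c p = 0.
Proof.
elim: s => [|q s IHs] //=; rewrite free_cons => /andP[Fq fs]; rewrite big_cons => e.
have cq : c q = 0.
  apply/eqP; apply: contraR Fq => cq; rewrite -[F q]scale1r -(mulVf cq) -scalerA memvZ //.
  move/eqP: e; rewrite addr_eq0 => /eqP->; rewrite memvN big_seq memv_suml // => p ps.
  by rewrite memvZ // memv_span // map_f.
move: e; rewrite cq scale0r add0r => /(IHs fs) e p.
by rewrite inE => /orP[/eqP->|/e].
Qed.

Definition hopf_dual (k : fieldType) (H : hopfAlgType k) := 'Hom(H, k^o).

(** * The convolution algebra of the dual *)

Section DualAlgebra.
Variables (k : fieldType) (H : hopfAlgType k).
Implicit Types (f g h : hopf_dual H).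

HB.instance Definition _ := Vector.on (hopf_dual H).

Lemma linear_dual (f : hopf_dual H) : linear (f : H -> k^o).
Proof. by move=> c x y; rewrite linearP. Qed.

Definition conv f g : hopf_dual H := linfun (fun x : H => sw x (fun a b => (f a : k) * (g b : k) : k^o)).

Lemma convE f g x : conv f g x = sw x (fun a b => (f a : k) * (g b : k) : k^o).
Proof.
have hf := linear_dual f; have hg := linear_dual g.
have h : linear (fun x : H => sw x (fun a b => (f a : k) * (g b : k) : k^o)) by lin.
exact: (lfunE (lfun_of h)).
Qed.

Definition dual_unit : hopf_dual H := linfun (@counit k H : H -> k^o).

Lemma dual_unitE x : dual_unit x = counit x.
Proof. exact: (lfunE (lfun_of (linearP (@counit k H) : linear (_ : H -> k^o)))). Qed.

Lemma convA : associative conv.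
Proof.
move=> f g h; apply/lfunP => x; rewrite !convE.
have hf := linear_dual f; have hg := linear_dual g; have hh := linear_dual h.
transitivity (sw x (fun a b => sw b (fun c d => (f a : k) * ((g c : k) * (h d : k)) : k^o))).
  apply: (@sw_ext _ _ k^o) => a b; rewrite convE.
  by rewrite (sw_map (G := fun w : k^o => (f a : k) * (w : k) : k^o)); last by lin.
rewrite -(@swA _ _ k^o x (fun a c d => (f a : k) * ((g c : k) * (h d : k)) : k^o)); try by lin.
apply: (@sw_ext _ _ k^o) => a b; rewrite convE.
rewrite (sw_map (G := fun w : k^o => (w : k) * (h b : k) : k^o)); last by lin.
by apply: (@sw_ext _ _ k^o) => c d; rewrite mulrA.
Qed.

Lemma conv1l : left_id dual_unit conv.
Proof.
move=> f; apply/lfunP => x; rewrite convE; have hf := linear_dual f.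
rewrite -[RHS](@sw_epsl _ _ k^o x f) //; apply: (@sw_ext _ _ k^o) => a b.
by rewrite dual_unitE.
Qed.

Lemma conv1r : right_id dual_unit conv.
Proof.
move=> f; apply/lfunP => x; rewrite convE; have hf := linear_dual f.
rewrite -[RHS](@sw_epsr _ _ k^o x f) //; apply: (@sw_ext _ _ k^o) => a b.
by rewrite dual_unitE mulrC.
Qed.

Lemma convDl : left_distributive conv +%R.
Proof.
move=> f g h; apply/lfunP => x; rewrite add_lfunE !convE /sw /tlift -big_split.
apply: eq_bigr => i _ /=; rewrite -big_split; apply: eq_bigr => j _ /=.
by rewrite add_lfunE mulrDl scalerDr.
Qed.

Lemma convDr : right_distributive conv +%R.
Proof.
move=> f g h; apply/lfunP => x; rewrite add_lfunE !convE /sw /tlift -big_split.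
apply: eq_bigr => i _ /=; rewrite -big_split; apply: eq_bigr => j _ /=.
by rewrite add_lfunE mulrDr scalerDr.
Qed.

Lemma dual_unit_neq0 : dual_unit != 0.
Proof.
apply/eqP => /lfunP/(_ 1); rewrite dual_unitE counit1 lfunE /= => /eqP.
by rewrite oner_eq0.
Qed.

HB.instance Definition _ := GRing.Zmodule_isNzRing.Build (hopf_dual H)
  convA conv1l conv1r convDl convDr dual_unit_neq0.

Lemma dual_mulE f g x : (f * g) x = sw x (fun a b => (f a : k) * (g b : k) : k^o).
Proof. exact: convE. Qed.

Lemma dual_scalerAl (c : k) f g : c *: (f * g) = (c *: f) * g.
Proof.
apply/lfunP => x; rewrite scale_lfunE !dual_mulE (sw_map (G := fun w : k^o => c *: w)); last by lin.
by apply: (@sw_ext _ _ k^o) => a b; rewrite scale_lfunE scalerAl.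
Qed.

Lemma dual_scalerAr (c : k) f g : c *: (f * g) = f * (c *: g).
Proof.
apply/lfunP => x; rewrite scale_lfunE !dual_mulE (sw_map (G := fun w : k^o => c *: w)); last by lin.
by apply: (@sw_ext _ _ k^o) => a b; rewrite scale_lfunE scalerAr.
Qed.

HB.instance Definition _ := GRing.Lmodule_isLalgebra.Build k (hopf_dual H) dual_scalerAl.
HB.instance Definition _ := GRing.Lalgebra_isAlgebra.Build k (hopf_dual H) dual_scalerAr.
HB.instance Definition _ := Algebra_isFalgebra.Build k (hopf_dual H).

Lemma dual_functional (f : H -> k^o) : linear f -> exists g : hopf_dual H, forall x, g x = f x.
Proof. by move=> hf; exists (linfun f) => x; exact: (lfunE (lfun_of hf)). Qed.

Lemma dual_eq (x y : H) : (forall f : hopf_dual H, f x = f y) -> x = y.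
Proof.
move=> e; apply: functional_eq => f hf; have [g gE] := dual_functional hf.
by rewrite -!gE.
Qed.

Lemma hit_mul f g x : hit f (hit g x) = hit (f * g) x.
Proof.
rewrite (hit_comp _ (linear_dual f) (linear_dual g)); apply: sw_ext => a b.
by rewrite dual_mulE.
Qed.

Lemma dual_hit f g x : f (hit g x) = (f * g) x.
Proof.
rewrite dual_mulE /hit (sw_map _ _ (linear_dual f)); apply: (@sw_ext _ _ k^o) => a b.
by rewrite linearZ /= mulrC.
Qed.

End DualAlgebra.

(** * Cosemisimplicity and comatrix coefficients *)

Section Cosemisimple.
Variables (k : closedFieldType) (char0 : [pchar k] =i pred0) (H : hopfAlgType k).
Hypothesis ssH : semisimple H.
Local Notation S := (@antipode k H).
Local Notation eps := (@counit k H).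
Local Notation N := (\dim {:H}).
Local Notation chi := (regular_char H).

Lemma antipodeK (x : H) : S (S x) = x.
Proof. exact: antipode_involutive. Qed.

Lemma dimH_neq0 : N%:R != 0 :> k.
Proof.
rewrite (natr_eq0 char0) dimv_eq0.
by apply: contraTneq (memvf (1 : H)) => ->; rewrite memv0 oner_eq0.
Qed.

Lemma regular_char_left (x : H) : x * chi = eps x *: chi.
Proof.
apply: mul_regular_char => W F hF.
transitivity (sw x (fun a b => F (S (a * S b)))).
  by apply: sw_ext => a b; rewrite antipodeM antipodeK.
by rewrite (@sw_Sr _ _ _ x (fun z => F (S z))) ?antipode1 //; lin.
Qed.

Lemma regular_char_integral : exists La : H,
  [/\ eps La = 1, forall x, x * La = eps x *: La, forall x, La * x = eps x *: La & chi = N%:R *: La].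
Proof.
have [La [e1 lL rL]] := exists_integral ssH; exists La; split=> //.
by rewrite -(counit_regular_char H) -rL regular_char_left e1 scale1r.
Qed.

Lemma regular_char_right (x : H) : chi * x = eps x *: chi.
Proof.
have [La [_ _ rL ->]] := regular_char_integral.
by rewrite -scalerAl rL scalerA mulrC -scalerA.
Qed.

(** As $\chi$ is $N\Lambda$ and cocommutative, the hypothesis says $f(\Lambda_1)\Lambda_2 = 0$. By
    [haar_dual_basis] and $S^2 = 1$, $f(S(w)) = \lambda(f(\Lambda_1)\Lambda_2 w)$, which
    vanishes. *)
Lemma dual_form_nondeg (f : hopf_dual H) : (forall g, (g * f) chi = 0) -> f = 0.
Proof.
move=> e; have [La [e1 lL rL chiE]] := regular_char_integral.
have hf := linear_dual f; have hh := @linear_haar k H.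
have z : sw La (fun a b => (f a : k) *: b) = 0.
  apply: (scalerI dimH_neq0); rewrite scaler0.
  rewrite -(linZ (linear_sw_l _ (@linear_id _ _))) -chiE regular_char_cocommutative; last by bilin.
  apply: dual_eq => g; rewrite -/(hit f chi) dual_hit e linear0 //.
apply/lfunP => y; rewrite zero_lfunE -[y]antipodeK.
move: (S y) => w; rewrite (haar_dual_basis e1 rL w) (sw_map (G := fun w => f (S w))); last by lin.
transitivity (haar (sw La (fun a b => (f a : k) *: b) * w)); last by rewrite z mul0r (lin0 hh).
rewrite (sw_map (G := fun v => haar (v * w) : k^o)); last by lin.
apply: (@sw_ext _ _ k^o) => a b; rewrite linearZ /= linearZ /= antipodeK -scalerAl (linZ hh).
exact: mulrC.
Qed.

(** If $xI = 0$ for a nonzero $x \in I$, then $(gx)(gx) = 0$ for every $g$, so $gx$ acts on $H$ with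
    square zero and trace zero. The trace form then gives $x = 0$. Otherwise Brauer's lemma
    applies. *)
Lemma dual_minimal_left_ideal_unit (I : {vspace hopf_dual H}) : minimal_left_ideal I ->
  exists2 f, f \in I & forall x, x \in I -> x * f = x.
Proof.
move=> mI; have [/left_idealP idI I0 _] := mI.
have x0 : vpick I != 0 by rewrite vpick0; apply/eqP.
have xI := memv_pick I; set x := vpick I in x0 xI.
have [[y [yI yx]]|no] := classic (exists y, y \in I /\ x * y != 0).
  exact: (minimal_left_ideal_unit mI xI yI yx).
case/eqP: x0; apply: dual_form_nondeg => g.
rewrite (regular_charE (linear_dual (g * x))); apply: tr_nilp.
  exact: linear_hit (linear_dual _).
move=> y; rewrite hit_mul -mulrA; have -> : x * (g * x) = 0.
  by apply/eqP; apply: contraT => h; case: no; exists (g * x); rewrite idI.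
rewrite mulr0 /hit /sw /tlift big1 // => i _; rewrite big1 // => j _.
by rewrite zero_lfunE scale0r scaler0.
Qed.

Lemma dual_wedderburn : exists m (r : rel 'I_m) E M, @matrix_units k (hopf_dual H) m r E M.
Proof. exact: wedderburn dual_minimal_left_ideal_unit. Qed.

Variables (m : nat) (r : rel 'I_m) (E : 'I_m -> 'I_m -> hopf_dual H).
Variable M : hopf_dual H -> 'I_m -> 'I_m -> k.
Hypothesis mu : matrix_units r E M.

Lemma dual_trace (f g : hopf_dual H) : (f * g) chi = (g * f) chi.
Proof.
have hf := linear_dual f; have hg := linear_dual g.
rewrite !dual_mulE regular_char_cocommutative; last by bilin.
by apply: (@sw_ext _ _ k^o) => a b; rewrite mulrC.
Qed.

Lemma chi_E_off i j : i != j -> E i j chi = 0.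
Proof.
move=> ij; have [rij|n] := boolP (r i j); last by rewrite (mu_E0 mu n) zero_lfunE.
rewrite -(mu_mul mu (mu_refl mu i) rij) dual_trace (mu_mul0 mu) ?zero_lfunE //.
by rewrite eq_sym.
Qed.

Lemma chi_E_neq0 i : E i i chi != 0.
Proof.
apply: contra_neq (mu_E_neq0 mu (mu_refl mu i)) => e0.
apply: dual_form_nondeg => g; rewrite (mu_coord mu g) mulr_suml sum_lfunE big1 // => p _.
rewrite mulr_suml sum_lfunE big1 // => q _; rewrite -scalerAl scale_lfunE.
have [->|qi] := eqVneq q i; last by rewrite (mu_mul0 mu) // zero_lfunE scaler0.
have [rpi|n] := boolP (r p i); last by rewrite (mu_E0 mu n) mul0r zero_lfunE scaler0.
rewrite (mu_mul mu rpi (mu_refl mu i)).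
by have [->|pi] := eqVneq p i; rewrite ?e0 ?(chi_E_off pi) scaler0.
Qed.

(* The basis of H dual to the matrix units, see [dual_comat]. *)
Definition comat i j : H := locked ((E i i chi)^-1 *: hit (E j i) chi).

Lemma dual_comat (f : hopf_dual H) i j : f (comat i j) = M f i j.
Proof.
rewrite {1}(mu_coord mu f) sum_lfunE (bigD1 i) //= [X in _ + X]big1 ?addr0; last first.
  move=> p pi; rewrite sum_lfunE big1 // => q _; rewrite scale_lfunE /comat -lock linearZ /= dual_hit.
  rewrite (mu_mulE mu); case: ifP => _; last by rewrite zero_lfunE !scaler0.
  by rewrite chi_E_off // !scaler0.
rewrite sum_lfunE (bigD1 j) //= [X in _ + X]big1 ?addr0; last first.
  move=> q qj; rewrite scale_lfunE /comat -lock linearZ /= dual_hit.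
  by rewrite (mu_mul0 mu) // zero_lfunE !scaler0.
rewrite scale_lfunE /comat -lock linearZ /= dual_hit.
have [rij|n] := boolP (r i j); last by rewrite (mu_M0 mu _ n) scale0r.
have rji : r j i by rewrite (mu_sym mu).
by rewrite (mu_mul mu rij rji) [_ *: E i i chi]mulVf ?chi_E_neq0 // [LHS]mulr1.
Qed.

Lemma dual_E_comat p q i j : E p q (comat i j) = (r p q && ((i == p) && (j == q)))%:R.
Proof. by rewrite dual_comat (mu_E mu). Qed.

Lemma comat0 i j : ~~ r i j -> comat i j = 0.
Proof. by move=> n; apply: dual_eq => f; rewrite dual_comat (mu_M0 mu _ n) linear0. Qed.

Lemma sum_comat (h : H) : h = \sum_i \sum_j (E i j h : k) *: comat i j.
Proof.
apply: dual_eq => f; rewrite {1}(mu_coord mu f) linear_sum sum_lfunE; apply: eq_bigr => i _.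
rewrite linear_sum sum_lfunE; apply: eq_bigr => j _.
by rewrite scale_lfunE linearZ /= dual_comat; exact: mulrC.
Qed.

Lemma comul_comat i j : comul (comat i j) = \sum_l tens (comat i l) (comat l j).
Proof.
apply: tensor_eq => f g hf hg.
have [f' fE] := dual_functional hf; have [g' gE] := dual_functional hg.
rewrite (linS _ _ _ (@linear_tlift _ _ _ _ _)).
transitivity ((f' * g') (comat i j)).
  by rewrite dual_mulE; apply: (@sw_ext _ _ k^o) => a b; rewrite fE gE.
rewrite dual_comat (mu_MM mu); apply: eq_bigr => l _.
by rewrite tlift_tensE; [rewrite -fE -gE !dual_comat | bilin].
Qed.

Lemma sw_comat (W : vectType k) (B : H -> H -> W) i j : bil B ->
  sw (comat i j) B = \sum_l B (comat i l) (comat l j).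
Proof.
move=> hB; rewrite /sw comul_comat (linS _ _ _ (@linear_tlift _ _ _ _ _)).
by apply: eq_bigr => l _; rewrite tlift_tensE.
Qed.

Lemma counit_comat i j : eps (comat i j) = (i == j)%:R.
Proof. by rewrite -dual_unitE -[dual_unit H]/(1 : hopf_dual H) dual_comat (mu_M1 mu). Qed.

Lemma regular_char_comat : chi = \sum_j #|r j|%:R *: comat j j.
Proof.
have cE i : E i i chi = #|r i|%:R.
  rewrite (regular_charE (linear_dual _)).
  rewrite (@eq_tr _ _ _ (fun h => \sum_p \sum_q (E p q h : k) *: hit (E i i) (comat p q))); last first.
    move=> h; rewrite {1}(sum_comat h).
    have hh := linear_hit (linear_dual (E i i)); rewrite (linS _ _ _ hh); apply: eq_bigr => p _.
    by rewrite (linS _ _ _ hh); apply: eq_bigr => q _; rewrite (linZ hh).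
  rewrite tr_bigsum -sum1_card natr_sum [RHS]big_mkcond; apply: eq_bigr => p _ /=.
  rewrite tr_bigsum (bigD1 i) //= [X in _ + X]big1 ?addr0.
    rewrite (@tr_rank1 _ _ (E p i) _ (linear_dual _)) dual_hit unfold_in (mu_sym mu i).
    case: ifP => rpi; first by rewrite (mu_mul mu rpi (mu_refl mu i)) dual_E_comat rpi !eqxx.
    by rewrite (mu_E0 mu (negbT rpi)) mul0r zero_lfunE.
  move=> q qi; rewrite (@tr_rank1 _ _ (E p q) _ (linear_dual _)) dual_hit.
  by rewrite (mu_mul0 mu) // zero_lfunE.
apply: dual_eq => f; rewrite {1}(sum_comat chi) !linear_sum; apply: eq_bigr => i _.
rewrite linear_sum (bigD1 i) //= big1 ?addr0 ?cE // => j ji.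
by rewrite chi_E_off 1?eq_sym // scale0r linear0.
Qed.


(** Matrix coefficients of a comodule, with the coproduct tested on bilinear maps. Neither
    independence nor values of the counit are required, so families padded with zeros qualify. *)
Definition comatrix (J : finType) (y : J -> J -> H) :=
  forall s t (W : vectType k) (B : H -> H -> W), bil B ->
    sw (y s t) B = \sum_u B (y s u) (y u t).

Section Comatrix.
Variables (J : finType) (y : J -> J -> H).
Hypothesis hy : comatrix y.

Lemma dual_comatrix (f g : hopf_dual H) s t : (f * g) (y s t) = \sum_u f (y s u) * g (y u t).
Proof.
have hf := linear_dual f; have hg := linear_dual g.
by rewrite dual_mulE hy //; bilin.
Qed.

(** The idempotent [E a a] of the dual evaluates on the comatrix to an idempotent matrix, whose rank
    is the multiplicity of the irreducible of [a]. If it is zero, factoring [E a b] through [E a a]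
    kills every coefficient. *)
Lemma comatrix_trace a : exists2 n : nat, E a a (\sum_s y s s) = n%:R
  & (n = 0%N -> forall s t b, E a b (y s t) = 0).
Proof.
have [|n e z] := @fin_idem k J (fun s t => E a a (y s t)).
  by move=> s t; rewrite -dual_comatrix (mu_mul mu) ?(mu_refl mu).
exists n; first by rewrite linear_sum.
move=> n0 s t b; have [rab|nab] := boolP (r a b); last by rewrite (mu_E0 mu nab) zero_lfunE.
rewrite -(mu_mul mu (mu_refl mu a) rab) dual_comatrix big1 // => u _.
by rewrite z // mul0r.
Qed.

Lemma comatrix_trace_mulC (f g : hopf_dual H) : (f * g) (\sum_s y s s) = (g * f) (\sum_s y s s).
Proof.
rewrite (linS _ _ _ (linear_dual (f * g))) (linS _ _ _ (linear_dual (g * f))).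
under [LHS]eq_bigr do rewrite dual_comatrix.
under [RHS]eq_bigr do rewrite dual_comatrix.
rewrite [LHS]exchange_big; apply: eq_bigr => s _.
by apply: eq_bigr => t _; rewrite mulrC.
Qed.

Lemma comatrix_trace_class a b : r a b -> E a a (\sum_s y s s) = E b b (\sum_s y s s).
Proof.
move=> rab; have rba : r b a by rewrite (mu_sym mu).
by rewrite -(mu_mul mu rab rba) comatrix_trace_mulC (mu_mul mu rba rab).
Qed.

Lemma comatrix_trace_sum : \sum_s y s s = \sum_a (E a a (\sum_s y s s) : k) *: comat a a.
Proof.
rewrite [LHS]sum_comat; apply: eq_bigr => a _; rewrite (bigD1 a) //= [X in _ + X]big1 ?addr0 // => b ba.
have [rab|n] := boolP (r a b); last by rewrite (mu_E0 mu n) zero_lfunE scale0r.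
rewrite -(mu_mul mu (mu_refl mu a) rab) comatrix_trace_mulC (mu_mul0 mu) // zero_lfunE scale0r //.
Qed.

(** Slicing the twofold coproduct of [y s t] by [E a b] on the left and [E c d] on the right leaves
    [E a d (y s t)] times [comat b c], because $E_{ab}fE_{cd} = f_{bc}E_{ad}$ in the dual. One
    nonzero coefficient thus puts the whole simple subcoalgebra inside [Z]. *)
Lemma comatrix_comat_mem (Z : {vspace H}) s t a b c d :
  (forall u w, y u w \in Z) -> r a b -> r c d -> E a d (y s t) != 0 -> comat b c \in Z.
Proof.
move=> yZ rab rcd ad0.
have e : (E a d (y s t) : k) *: comat b c =
    \sum_u \sum_w ((E a b (y s u) : k) * E c d (y w t)) *: y u w.
  apply: dual_eq => f; rewrite linearZ /= dual_comat linear_sum.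
  have h : (E a b * (f * E c d)) (y s t) = (M f b c : k) * E a d (y s t).
    by rewrite mulrA (mu_sandwich mu) // scale_lfunE.
  rewrite [LHS]mulrC -[LHS]h dual_comatrix.
  apply: eq_bigr => u _; rewrite dual_comatrix mulr_sumr linear_sum; apply: eq_bigr => w _.
  by rewrite linearZ /= [f _ * _]mulrC mulrA.
rewrite -[comat b c]scale1r -(mulVf ad0) -scalerA memvZ // e.
by apply: memv_suml => u _; apply: memv_suml => w _; rewrite memvZ.
Qed.

End Comatrix.

Definition irr_char i : H := \sum_(j | r i j) comat j j.

Lemma class_card_gt0 i : (0 < #|r i|)%N.
Proof. by apply/card_gt0P; exists i; rewrite unfold_in (mu_refl mu). Qed.

Lemma class_card i j : r i j -> #|r i| = #|r j|.
Proof. by move=> rij; apply: eq_card => l; rewrite !unfold_in (mu_trans mu l rij). Qed.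

Lemma class_card_neq0 i : #|r i|%:R != 0 :> k.
Proof. by rewrite (natr_eq0 char0) -lt0n class_card_gt0. Qed.

Lemma counit_irr_char i : eps (irr_char i) = #|r i|%:R.
Proof.
rewrite linear_sum -sum1_card natr_sum; apply: eq_bigr => j _.
by rewrite counit_comat eqxx.
Qed.

Lemma E_irr_char i a : E a a (irr_char i) = (r i a)%:R.
Proof.
rewrite linear_sum big_mkcond (bigD1 a) //= big1 ?addr0 => [|j /negPf ja]; last first.
  by case: ifP => // _; rewrite dual_E_comat ja /= andbF.
by case: ifP => _; rewrite // dual_E_comat (mu_refl mu) eqxx.
Qed.

Lemma irr_char_eq i j : (irr_char i == irr_char j) = r i j.
Proof.
apply/eqP/idP => [e|rij].
  have := E_irr_char i j; rewrite e E_irr_char (mu_refl mu).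
  by case: (r i j) => // /eqP; rewrite oner_eq0.
by apply: eq_bigl => l; rewrite (mu_trans mu l rij).
Qed.

(* Averaging over each class avoids the choice of class representatives. *)
Lemma sum_class (c : 'I_m -> k) : (forall i j, r i j -> c i = c j) ->
  \sum_a c a *: comat a a = \sum_a (c a / #|r a|%:R) *: irr_char a.
Proof.
move=> cc; rewrite /irr_char; under [RHS]eq_bigr do rewrite scaler_sumr big_mkcond.
rewrite exchange_big; apply: eq_bigr => j _ /=; rewrite -big_mkcond /=.
rewrite (eq_bigr (fun=> (c j / #|r j|%:R) *: comat j j)); last first.
  by move=> i rij; rewrite (cc i j) // (class_card rij).
rewrite sumr_const -scaler_nat scalerA mulrCA.
rewrite (eq_card (_ : _ =i r j)); first by rewrite divff ?mulr1 // class_card_neq0.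
by move=> i; rewrite !unfold_in (mu_sym mu).
Qed.

(** The tensor product of two irreducible comodules, extended by zero to all pairs of indices so
    that the index type does not depend on the classes. *)
Definition prod_comat i j (s t : 'I_m * 'I_m) : H :=
  if r i s.1 && r j s.2 then comat s.1 t.1 * comat s.2 t.2 else 0.

Lemma prod_comat_comatrix i j : comatrix (prod_comat i j).
Proof.
move=> [a b] [c d] W B hB; rewrite /prod_comat /=; case: ifP => rr; last first.
  rewrite big1; first exact: (lin0 (linear_sw_l B (@linear_id _ _))).
  by move=> u _; rewrite (lin0 (proj1 hB _)).
rewrite swM // sw_comat; last by bilin.
rewrite -(pair_bigA _ (fun p q => B (comat a p * comat b q) (prod_comat i j (p, q) (c, d)))) /=.
apply: eq_bigr => p _; rewrite sw_comat; last by bilin.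
apply: eq_bigr => q _; rewrite /prod_comat /=.
have [rap|n] := boolP (r a p); last by rewrite (comat0 n) !mul0r (lin0 (proj1 hB _)) (lin0 (proj1 hB _)).
have [rbq|n] := boolP (r b q); last by rewrite (comat0 n) !mulr0 (lin0 (proj1 hB _)) (lin0 (proj1 hB _)).
by case/andP: rr => ria rjb; rewrite !(mu_sym mu _ p, mu_sym mu _ q) -(mu_trans mu i rap)
  -(mu_trans mu j rbq) !(mu_sym mu _ i, mu_sym mu _ j) ria rjb.
Qed.

Lemma prod_comat_trace i j : \sum_s prod_comat i j s s = irr_char i * irr_char j.
Proof.
rewrite -(pair_bigA _ (fun p q => prod_comat i j (p, q) (p, q))) /= /irr_char mulr_suml big_mkcond.
rewrite [RHS]big_mkcond; apply: eq_bigr => p _; rewrite /prod_comat /=.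
case: ifP => rip; last by rewrite big1.
by rewrite mulr_sumr [RHS]big_mkcond; apply: eq_bigr => q _.
Qed.


Lemma unit_comatrix : comatrix (fun _ _ : unit => 1 : H).
Proof. by move=> _ _ W B hB; rewrite sw1 // big_const card_unit /= addr0. Qed.

(** The sum runs over indices, not classes, so each irreducible character occurs as often as its
    degree. *)
Lemma sum_irr_char : \sum_a irr_char a = chi.
Proof.
rewrite regular_char_comat (sum_class (c := fun a => #|r a|%:R)).
  by apply: eq_bigr => a _; rewrite divff ?scale1r // class_card_neq0.
by move=> i j /class_card ->.
Qed.

(* The fusion matrix A of right multiplication by the character d of the class of i has the right
   eigenvector (deg) because counit is multiplicative, and the left eigenvector (1) because
   chi d = eps(d) chi; so 1 = alpha + beta (d - eps(d)) with alpha d = eps(d) alpha, and alpha is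
   constant along the edges of A. *)
Section Stabilizer.
Variable i : 'I_m.
Local Notation d := (irr_char i).
Local Notation n0 := #|r i|.

Let fusion a b : exists n : nat, E b b (irr_char a * d) = n%:R /\
  (n = 0%N -> forall p q s t c, r a p -> r i s -> E b c (comat p q * comat s t) = 0).
Proof.
have [n e z] := comatrix_trace (prod_comat_comatrix a i) b.
exists n; split; first by rewrite -e prod_comat_trace.
move=> n0 p q s t c rap ris; have := z n0 (p, s) (q, t) c.
by rewrite /prod_comat /= rap ris.
Qed.

Lemma stab_projection : exists alpha beta : H,
  [/\ 1 = alpha + beta * (d - n0%:R%:A), alpha * d = n0%:R *: alpha
    & forall s t, r i s -> alpha * comat s t = eps (comat s t) *: alpha].
Proof.
have /fin_all_exists[mm mmP] a : exists mm : 'I_m -> nat, forall b, E b b (irr_char a * d) = (mm b)%:R /\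
  (mm b = 0%N -> forall p q s t c, r a p -> r i s -> E b c (comat p q * comat s t) = 0).
  by have /fin_all_exists[mm mmP] := fusion a; exists mm.
have mm_class a b b' : r b b' -> mm a b = mm a b'.
  move=> rbb; apply: (natr_inj char0); rewrite -(mmP a b).1 -(mmP a b').1 -prod_comat_trace.
  by have := comatrix_trace_class (prod_comat_comatrix a i) rbb.
have mulE a : irr_char a * d = \sum_b (mm a b)%:R *: comat b b.
  rewrite -prod_comat_trace (comatrix_trace_sum (prod_comat_comatrix a i)) prod_comat_trace.
  by apply: eq_bigr => b _; rewrite (mmP a b).1.
have row a : (\sum_b mm a b = n0 * #|r a|)%N.
  apply: (natr_inj char0); rewrite natrM -!counit_irr_char mulrC -counitM mulE linear_sum natr_sum.
  by apply: eq_bigr => b _; rewrite linearZ /= counit_comat eqxx mulr1.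
have col b : (\sum_a mm a b = n0 * #|r b|)%N.
  apply: (natr_inj char0); rewrite natrM natr_sum -counit_irr_char.
  transitivity (E b b (chi * d)).
    rewrite -sum_irr_char mulr_suml linear_sum; apply: eq_bigr => a _.
    exact: (esym (mmP a b).1).
  rewrite regular_char_right linearZ /=; congr (_ * _).
  rewrite regular_char_comat linear_sum (bigD1 b) //= big1 ?addr0 => [|a /negPf ab].
    by rewrite linearZ /= dual_E_comat (mu_refl mu) !eqxx [LHS]mulr1.
  by rewrite linearZ /= dual_E_comat ab /= andbF scaler0.
(* A character is summed once per index of its class, whence the division by [#|r b|], as in
   [sum_class]. *)
pose A : 'M[rat]_m := \matrix_(a, b) ((mm a b)%:R / #|r b|%:R).
pose y b : rat := #|r b|%:R.
have y0 b : 0 < y b by rewrite ltr0n class_card_gt0.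
have y_neq0 b : y b != 0 by rewrite gt_eqF.
have A0 a b : 0 <= A a b by rewrite mxE divr_ge0 ?ler0n.
have Ay a : \sum_b A a b * y b = n0%:R * y a.
  rewrite /y -natrM -row natr_sum; apply: eq_bigr => b _.
  by rewrite mxE -/(y b) divfK ?y_neq0.
have sA b : \sum_a A a b = n0%:R.
  rewrite (eq_bigr (fun a => (mm a b)%:R / y b)); last by move=> a _; rewrite mxE.
  by rewrite -mulr_suml -natr_sum col natrM -/(y b) mulfK ?y_neq0.
have [phi phin] : exists phi : {rmorphism rat -> k}, forall n : nat, phi n%:R = n%:R.
  by exists (ratr0 char0) => n; rewrite rmorph_nat.
pose al (u : 'rV[rat]_m) : H := \sum_a phi (u 0 a) *: irr_char a.
have alD u v : al (u + v) = al u + al v.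
  by rewrite /al -big_split; apply: eq_bigr => a _ /=; rewrite mxE rmorphD scalerDl.
have alZ (c : nat) u : al (c%:R *: u) = c%:R *: al u.
  by rewrite /al scaler_sumr; apply: eq_bigr => a _ /=; rewrite mxE rmorphM phin scalerA.
have alM u : al u * d = al (u *m A).
  transitivity (\sum_b (\sum_a phi (u 0 a) * (mm a b)%:R) *: comat b b).
    rewrite /al mulr_suml; under eq_bigr do rewrite -scalerAl mulE scaler_sumr.
    rewrite exchange_big; apply: eq_bigr => b _ /=; rewrite scaler_suml.
    by apply: eq_bigr => a _; rewrite scalerA.
  rewrite (sum_class (c := fun b => \sum_a phi (u 0 a) * (mm a b)%:R)); last first.
    by move=> b b' rbb; apply: eq_bigr => a _; rewrite (mm_class a b b').
  apply: eq_bigr => b _; congr (_ *: _); rewrite mxE rmorph_sum mulr_suml.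
  by apply: eq_bigr => a _; rewrite mxE !rmorphM fmorphV !phin mulrA.
have [e1 e1E] : exists e, 1 = al e.
  (* The unit is a comatrix of size one; it is expanded in characters without locating its class. *)
  have /fin_all_exists2[c cE _] := comatrix_trace unit_comatrix.
  exists (\row_a ((c a)%:R / #|r a|%:R)).
  have one : (1 : H) = \sum_(s : unit) 1 by rewrite big_const card_unit /= addr0.
  rewrite {1}one (comatrix_trace_sum unit_comatrix).
  rewrite (eq_bigr (fun a => (c a)%:R *: comat a a)); last by move=> a _; rewrite cE.
  rewrite (sum_class (c := fun a => (c a)%:R)) => [|a b rab]; last first.
    by rewrite -!cE; have := comatrix_trace_class unit_comatrix rab.
  by apply: eq_bigr => a _; rewrite mxE rmorphM fmorphV !phin.
have [a [b [ab aT]]] := perron_split A0 y0 Ay sA e1.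
have harm := perron_harmonic A0 y0 Ay sA aT.
have TE u : al (u *m (A - n0%:R%:M)) = al u * (d - n0%:R%:A).
  rewrite mulmxBr mul_mx_scalar mulrBr alM -scalerAr mulr1 -alZ.
  by apply: (addIr (al (n0%:R *: u))); rewrite -alD subrK subrK.
have ad : al a * d = n0%:R *: al a.
  apply/eqP; rewrite -subr_eq0; apply/eqP.
  have := TE a; rewrite aT mulrBr -scalerAr mulr1 => <-.
  by rewrite /al big1 // => p _; rewrite mxE rmorph0 scale0r.
exists (al a), (al b); split; [by rewrite -TE -alD -ab | exact: ad |].
(* The eigenvector equation expresses each coefficient of [a] through a column of [A], and columns
   of equivalent indices coincide. *)
have a_class p q : r p q -> a 0 p = a 0 q.
  move=> rpq; have n00 : n0%:R != 0 :> rat by rewrite pnatr_eq0 -lt0n class_card_gt0.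
  apply: (mulfI n00); move/eqP: aT; rewrite mulmxBr mul_mx_scalar subr_eq0 => /eqP aA.
  have /rowP aA' := aA; have := aA' p; have := aA' q; rewrite !mxE => <- <-.
  by apply: eq_bigr => l _; rewrite !mxE (mm_class l p q rpq) (class_card rpq).
(* [Q] scales the block of [p] by the coefficient [a 0 p], so it sends $\chi$ to alpha. Harmonicity
   says that this scalar does not change along constituents of products with [comat s t]; hence [Q]
   commutes with right multiplication by it, and $\alpha x = Q(\chi x) = \epsilon(x)\alpha$. *)
pose Q (h : H) : H := \sum_p \sum_q (phi (a 0 p) * E p q h) *: comat p q.
have lQ : linear Q.
  apply: linear_bigsum => p; apply: linear_bigsum => q; apply: linear_scalel.
  have hE := linear_dual (E p q); apply: linear_kmulr; exact: hE.
have Qc p q : Q (comat p q) = phi (a 0 p) *: comat p q.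
  have [rpq|n] := boolP (r p q); last by rewrite (comat0 n) scaler0 (lin0 lQ).
  rewrite /Q (bigD1 p) //= [X in _ + X]big1 ?addr0; last first.
    move=> s sp; rewrite big1 // => t _.
    by rewrite dual_E_comat [p == s]eq_sym (negPf sp) /= andbF mulr0 scale0r.
  rewrite (bigD1 q) //= big1 ?addr0 => [|t tq].
    by rewrite dual_E_comat rpq !eqxx mulr1.
  by rewrite dual_E_comat [q == t]eq_sym (negPf tq) andbF andbF mulr0 scale0r.
have Qchi : Q chi = al a.
  rewrite regular_char_comat (linS _ _ _ lQ) /al.
  rewrite (eq_bigr (fun j => (phi (a 0 j) * #|r j|%:R) *: comat j j)); last first.
    by move=> j _; rewrite (linZ lQ) Qc scalerA mulrC.
  rewrite (sum_class (c := fun j => phi (a 0 j) * #|r j|%:R)) => [|p q rpq].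
    by apply: eq_bigr => p _; rewrite mulfK ?class_card_neq0.
  by rewrite (a_class p q) // (class_card rpq).
move=> s t ris.
have QM h : Q (h * comat s t) = Q h * comat s t.
  rewrite (sum_comat h) mulr_suml !(linS _ _ _ lQ) mulr_suml; apply: eq_bigr => p _.
  rewrite mulr_suml !(linS _ _ _ lQ) mulr_suml; apply: eq_bigr => q _.
  rewrite -scalerAl !(linZ lQ) -scalerAl; congr (_ *: _); rewrite Qc -scalerAl.
  rewrite [in RHS](sum_comat (comat p q * comat s t)) scaler_sumr; apply: eq_bigr => u _.
  rewrite scaler_sumr; apply: eq_bigr => w _; rewrite scalerA.
  have [->|nz] := eqVneq (E u w (comat p q * comat s t)) 0; first by rewrite !mulr0.
  rewrite (harm p u) //; rewrite mxE mulf_neq0 ?invr_eq0 // ?pnatr_eq0.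
    apply: contra_neq nz => mm0; exact: (mmP p u).2 mm0 p q s t w (mu_refl mu p) ris.
  by rewrite -lt0n class_card_gt0.
by rewrite -Qchi -QM regular_char_right (linZ lQ).
Qed.

(* alpha = S(alpha), so alpha is also left invariant under the class of i, and v = alpha v. *)
Lemma stab_class (v : H) : d * v = eps d *: v ->
  forall s t, r i s -> comat s t * v = eps (comat s t) *: v.
Proof.
rewrite counit_irr_char => dv s t ris.
have [al [be [e ad ax]]] := stab_projection.
have aS p q : r i p -> al * S (comat p q) = eps (comat p q) *: al.
  move=> rip; have := @sw_Sr _ _ _ (comat p q) (fun z => al * z) (linear_mulr _ (@linear_id _ _)).
  rewrite mulr1 => <-; rewrite sw_comat; last by bilin.
  rewrite (bigD1 p) //= big1 ?addr0 => [|l lp].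
    by rewrite mulrA ax // counit_comat eqxx scale1r.
  by rewrite mulrA ax // counit_comat eq_sym (negPf lp) scale0r mul0r.
have aSd : al * S d = n0%:R *: al.
  rewrite -counit_irr_char !linear_sum mulr_sumr scaler_suml; apply: eq_bigr => j rij.
  by rewrite aS.
have dSa : d * S al = n0%:R *: S al by rewrite -{1}[d]antipodeK -antipodeM aSd linearZ.
have e1 : S al = al * S al.
  by rewrite -{1}[S al]mul1r {1}e mulrDl -mulrA mulrBl dSa -scalerAl mul1r subrr mulr0 addr0.
have e2 : al = al * S al.
  have e' : 1 = S al + (S d - n0%:R%:A) * S be.
    rewrite -(antipode1 H) {1}e linearD antipodeM linearB linearZ /= antipode1 //.
  by rewrite -{1}[al]mulr1 {1}e' mulrDr mulrA mulrBr aSd -scalerAr mulr1 subrr mul0r addr0.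
have Sal : S al = al by rewrite e1 -e2.
have va : v = al * v.
  by rewrite -{1}[v]mul1r e mulrDl -mulrA mulrBl dv -scalerAl mul1r subrr mulr0 addr0.
have xa : comat s t * al = eps (comat s t) *: al.
  by rewrite -{1}Sal -{1}[comat s t]antipodeK -antipodeM aS // linearZ /= Sal.
by rewrite va mulrA xa -scalerAl.
Qed.

End Stabilizer.


(** * Classification of simple subcoalgebras by blocks *)

Definition comat_span (P : pred 'I_m) : {vspace H} := (\sum_(a | P a) \sum_b <[comat a b]>)%VS.

Lemma comat_spanP (P : pred 'I_m) h :
  h \in comat_span P <-> forall a b, ~~ P a -> E a b h = 0.
Proof.
split=> [hP a b na|hE].
  have : h \in lker (E a b : 'Hom(H, k^o)).
    apply: subvP hP; apply/subv_sumP => p Pp; apply/subv_sumP => q _.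
    rewrite -memvE memv_ker dual_E_comat; have [e|_] := eqVneq p a; last by rewrite andbF.
    by rewrite -e Pp in na.
  by rewrite memv_ker => /eqP.
rewrite (sum_comat h); apply: memv_suml => a _; apply: memv_suml => b _.
have [Pa|na] := boolP (P a); last by rewrite hE // scale0r mem0v.
apply: memvZ; rewrite memvE (sumv_sup a) // (sumv_sup b) //.
Qed.

Lemma mem_comat_span (P : pred 'I_m) a b : P a -> comat a b \in comat_span P.
Proof. by move=> Pa; rewrite memvE (sumv_sup a) // (sumv_sup b). Qed.

Lemma comat_span_sub (P : pred 'I_m) (Z : {vspace H}) :
  (forall a b, P a -> r a b -> comat a b \in Z) -> (comat_span P <= Z)%VS.
Proof.
move=> PZ; apply/subv_sumP => a Pa; apply/subv_sumP => b _; rewrite -memvE.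
by have [rab|n] := boolP (r a b); [exact: PZ | rewrite (comat0 n) mem0v].
Qed.

Lemma tens_mem (C D : {vspace H}) (a b : H) : a \in C -> b \in D -> tens a b \in tensv C D.
Proof.
move=> aC bD; rewrite (coord_vbasis aC) (linS _ _ _ (@tens_linear_l _ _ _ _)) memv_suml // => p _.
rewrite (linZ (@tens_linear_l _ _ _ _)) memvZ //.
rewrite (coord_vbasis bD) (linS _ _ _ (@tens_linear_r _ _ _ _)) memv_suml // => q _.
rewrite (linZ (@tens_linear_r _ _ _ _)) memvZ // memv_span //.
by apply: allpairs_f; rewrite mem_nth // size_tuple.
Qed.

Lemma comat_span_subcoalgebra (P : pred 'I_m) : (forall a b, r a b -> P a -> P b) ->
  subcoalgebra (comat_span P).
Proof.
move=> Pr h /comat_spanP hE; rewrite (sum_comat h) linear_sum memv_suml // => a _.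
rewrite linear_sum memv_suml // => b _; rewrite linearZ /=.
have [Pa|na] := boolP (P a); last by rewrite hE // scale0r mem0v.
rewrite memvZ // comul_comat memv_suml // => l _.
have [ral|n] := boolP (r a l); last by rewrite (comat0 n) (lin0 (@tens_linear_l _ _ _ _)) mem0v.
by rewrite tens_mem ?mem_comat_span // (Pr a).
Qed.

Lemma subcoalgebra_tlift (C : {vspace H}) (B : H -> H -> H) x : subcoalgebra C -> bil B ->
  (forall a b, a \in C -> b \in C -> B a b \in C) -> x \in C -> sw x B \in C.
Proof.
move=> sC hB BC /sC xC; pose L := linfun (lfun_of (@linear_tlift _ _ _ _ B)).
have LE t : L t = tlift B t by rewrite lfunE.
rewrite /sw -LE memv_preim; apply: subvP xC; apply/span_subvP => _ /allpairsP[[a b] [aC bC ->]].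
by rewrite -memv_preim LE tlift_tensE //; apply: BC; exact: vbasis_mem.
Qed.

(** The slicing of [comatrix_comat_mem] for an element of a subcoalgebra, which is stable under both
    actions of the dual. *)
Lemma subcoalgebra_comat_mem (C : {vspace H}) h a b c d : subcoalgebra C -> h \in C ->
  r a b -> r c d -> E a d h != 0 -> comat b c \in C.
Proof.
move=> sC hC rab rcd ad0.
have h1 := linear_dual (E a b); have h2 := linear_dual (E c d).
pose z := sw (hit (E c d) h) (fun u v => (E a b u : k) *: v).
have zC : z \in C.
  apply: subcoalgebra_tlift => //; [by bilin | by move=> u v _ vC; rewrite memvZ |].
  by apply: subcoalgebra_tlift => //; [by bilin | move=> u v uC _; rewrite memvZ].
have zE : z = (E a d h : k) *: comat b c.
  apply: dual_eq => f; rewrite linearZ /= dual_comat /z (sw_map _ _ (linear_dual f)).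
  transitivity ((E a b * f) (hit (E c d) h)).
    by rewrite dual_mulE; apply: (@sw_ext _ _ k^o) => u v; rewrite linearZ.
  by rewrite dual_hit (mu_sandwich mu) // scale_lfunE; exact: mulrC.
by rewrite -[comat b c]scale1r -(mulVf ad0) -scalerA memvZ // -zE.
Qed.

Lemma subcoalgebra_contains (C : {vspace H}) : subcoalgebra C -> C <> 0%VS ->
  exists i, (comat_span (r i) <= C)%VS.
Proof.
move=> sC C0; have v0 : vpick C != 0 by rewrite vpick0; apply/eqP.
have [a [d ad0]] : exists a d, E a d (vpick C) != 0.
  apply: NNPP => no; case/eqP: v0; rewrite (sum_comat (vpick C)) big1 // => a _.
  rewrite big1 // => b _; have [->|h] := eqVneq (E a b (vpick C)) 0; first by rewrite scale0r.
  by case: no; exists a, b.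
have rad : r a d by apply: contraNT ad0 => n; rewrite (mu_E0 mu n) zero_lfunE.
exists a; apply: comat_span_sub => b c rab rbc.
apply: (subcoalgebra_comat_mem sC (memv_pick C) rab _ ad0).
by rewrite -(mu_trans mu d rbc) -(mu_trans mu d rab).
Qed.

Lemma class_subcoalgebra i : subcoalgebra (comat_span (r i)).
Proof.
by apply: comat_span_subcoalgebra => a b rab; rewrite !(mu_sym mu i) (mu_trans mu i rab).
Qed.

Lemma comat_neq0 a b : r a b -> comat a b != 0.
Proof.
move=> rab; apply/eqP => e; have := dual_E_comat a b a b.
by rewrite e linear0 rab !eqxx => /esym/eqP; rewrite oner_eq0.
Qed.

Lemma comat_span_class_le i (P : pred 'I_m) : (comat_span (r i) <= comat_span P)%VS -> P i.
Proof.
move=> /subvP/(_ _ (mem_comat_span i (mu_refl mu i)))/comat_spanP h.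
apply: contraT => n; have /eqP := h i i n; rewrite dual_E_comat (mu_refl mu) !eqxx.
by rewrite oner_eq0.
Qed.

Lemma comat_span_class i j : r i j -> comat_span (r i) = comat_span (r j).
Proof. by move=> rij; apply: eq_bigl => a; rewrite (mu_trans mu a rij). Qed.

Lemma class_neq0 i : comat_span (r i) <> 0%VS.
Proof.
move=> e; have := mem_comat_span i (mu_refl mu i); rewrite e memv0.
by rewrite (negPf (comat_neq0 (mu_refl mu i))).
Qed.

Lemma class_simple i : simple_subcoalgebra (comat_span (r i)).
Proof.
split; [exact: class_subcoalgebra | exact: class_neq0 |].
move=> D sD sDi; have [D0|/eqP D0] := eqVneq D 0%VS; [by left | right].
have [j jD] := subcoalgebra_contains sD D0.
have rij : r i j := comat_span_class_le (subv_trans jD sDi).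
by apply/eqP; rewrite eqEsubv sDi (comat_span_class rij).
Qed.

Lemma simple_class C : simple_subcoalgebra C -> exists i, C = comat_span (r i).
Proof.
case=> sC C0 minC; have [i iC] := subcoalgebra_contains sC C0; exists i.
by case: (minC _ (@class_subcoalgebra i) iC) => // e; case: (class_neq0 e).
Qed.

Definition class_mx i : 'M[H]_#|r i| := \matrix_(p, q) comat (enum_val p) (enum_val q).

Lemma class_mx_basis i :
  basis_of (comat_span (r i)) [seq class_mx i p q | p <- enum 'I_#|r i|, q <- enum 'I_#|r i|].
Proof.
pose L := [seq (p, q) | p <- enum 'I_#|r i|, q <- enum 'I_#|r i|].
have XE : [seq class_mx i p q | p <- enum 'I_#|r i|, q <- enum 'I_#|r i|] =
  [seq class_mx i u.1 u.2 | u <- L] by rewrite /L map_allpairs.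
rewrite /basis_of; apply/andP; split.
  rewrite eqEsubv; apply/andP; split.
    apply/span_subvP => _ /allpairsP[[p q] [_ _ ->]] /=; rewrite mxE mem_comat_span //.
    exact: (enum_valP p).
  apply: comat_span_sub => a b ria rab.
  have rib : r i b by rewrite (mu_trans mu b ria).
  rewrite memv_span //; apply/allpairsP.
  exists (enum_rank_in (ria : a \in r i) a, enum_rank_in (rib : b \in r i) b).
  by rewrite !mem_enum /= mxE !enum_rankK_in.
rewrite XE; apply: (free_dual (G := fun u => E (enum_val u.1) (enum_val u.2))).
  by apply: allpairs_uniq; rewrite ?enum_uniq // => -[? ?] [? ?].
move=> [p q] [p' q'] _ _ /=; rewrite mxE dual_E_comat.
have -> : r (enum_val p) (enum_val q).
  by rewrite -(mu_trans mu _ (enum_valP p)); exact: (enum_valP q).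
by rewrite !(inj_eq enum_val_inj) /= xpair_eqE ![_ == p']eq_sym ![_ == q']eq_sym.
Qed.

Lemma dim_class i : \dim (comat_span (r i)) = (#|r i| ^ 2)%N.
Proof.
have /andP[/eqP <- /eqP ->] := class_mx_basis i.
by rewrite size_allpairs !size_enum_ord mulnn.
Qed.

Lemma class_has_character i : has_character (comat_span (r i)) (irr_char i).
Proof.
split; first exact: class_simple.
exists #|r i|, (class_mx i); split; first split; first exact: class_mx_basis.
  move=> p q; rewrite mxE comul_comat (bigID (mem (r i))) /= [X in _ + X]big1 ?addr0; last first.
    move=> l nl; rewrite (comat0 (_ : ~~ r (enum_val p) l)) ?(lin0 (@tens_linear_l _ _ _ _)) //.
    by rewrite -(mu_trans mu _ (enum_valP p)).
  by rewrite big_enum_val; apply: eq_bigr => l _; rewrite !mxE.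
by rewrite /irr_char big_enum_val; apply: eq_bigr => l _; rewrite mxE.
Qed.

(** Such a trace is a multiple $n$ of the irreducible character, and the counit compares degrees to
    give $n = 1$. This makes the character of a simple subcoalgebra independent of the comatrix
    basis. *)
Lemma comatrix_irr_char (J : finType) (y : J -> J -> H) j : comatrix y ->
  (forall s, y s s \in comat_span (r j)) -> eps (\sum_s y s s) = #|r j|%:R ->
  \sum_s y s s = irr_char j.
Proof.
move=> hy yj; rewrite (comatrix_trace_sum hy); set c := fun a => E a a (\sum_s y s s).
have [n nE _] := comatrix_trace hy j.
have yj' : \sum_s y s s \in comat_span (r j) by apply: memv_suml => s _; exact: yj.
have cE a : c a = if r j a then n%:R else 0.
  case: ifP => [rja|/negbT n']; first by rewrite -nE /c; have := comatrix_trace_class hy rja.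
  exact: (proj1 (comat_spanP _ _) yj' a a n').
have -> : \sum_a (c a : k) *: comat a a = n%:R *: irr_char j.
  rewrite scaler_sumr [RHS]big_mkcond; apply: eq_bigr => a _.
  by rewrite cE; case: ifP; rewrite ?scale0r.
rewrite linearZ /= counit_irr_char -natrM => /(natr_inj char0) e.
suff -> : n = 1%N by rewrite scale1r.
by apply/eqP; rewrite -(eqn_pmul2r (class_card_gt0 j)) e mul1n.
Qed.


Lemma comatrix_basis_comatrix C n (y : 'M[H]_n) : comatrix_basis C y -> comatrix (fun s t => y s t).
Proof.
case=> _ cy s t W B hB; rewrite /sw cy (linS _ _ _ (@linear_tlift _ _ _ _ _)).
by apply: eq_bigr => l _; rewrite tlift_tensE.
Qed.

Lemma comatrix_basis_counit C n (y : 'M[H]_n) s t : comatrix_basis C y -> eps (y s t) = (s == t)%:R.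
Proof.
move=> hy; have hc := comatrix_basis_comatrix hy; have [/andP[_ fy] _] := hy.
pose L := [seq (p, q) | p <- enum 'I_n, q <- enum 'I_n].
(* The counit axiom $y_{st} = \sum_p \epsilon(y_{sp})y_{pt}$ as a linear relation among all entries,
   supported on column [t]; freeness makes its coefficients vanish. *)
pose c (u : 'I_n * 'I_n) := (u.2 == t)%:R * (eps (y s u.1) - (s == u.1)%:R).
have fL : free [seq y u.1 u.2 | u <- L] by rewrite /L map_allpairs.
have e : \sum_(u <- L) c u *: y u.1 u.2 = 0.
  rewrite /L big_allpairs big_enum /=.
  rewrite (eq_bigr (fun p => eps (y s p) *: y p t - (s == p)%:R *: y p t)); last first.
    move=> p _; rewrite big_enum (bigD1 t) //= big1 ?addr0 => [|q qt].
      by rewrite /c /= eqxx mul1r scalerBl.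
    by rewrite /c /= (negPf qt) mul0r scale0r.
  rewrite sumrB [X in _ - X](bigD1 s) //= [X in _ - (_ + X)]big1 ?addr0 => [|p ps]; last first.
    by rewrite eq_sym (negPf ps) scale0r.
  rewrite eqxx scale1r; apply/eqP; rewrite subr_eq0; apply/eqP.
  rewrite -[RHS](@sw_epsl _ _ _ (y s t) (fun z => z)) // hc //.
  by split; lin.
have := free_map_coef fL e (p := (t, t)); rewrite /c /= eqxx mul1r.
rewrite allpairs_f ?mem_enum // => /(_ isT)/eqP.
by rewrite subr_eq0 => /eqP.
Qed.

Lemma has_character_class C d : has_character C d ->
  exists i, C = comat_span (r i) /\ d = irr_char i.
Proof.
case=> sC [n [y [hy ->]]]; have [i e] := simple_class sC; exists i; split=> //.
have hc := comatrix_basis_comatrix hy; have [/andP[/eqP spy /eqP fy] _] := hy.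
have ni : n = #|r i|.
  apply/eqP; rewrite -(@eqn_exp2r _ _ 2) // -dim_class -e -spy fy size_allpairs.
  by rewrite !size_enum_ord mulnn.
apply: (comatrix_irr_char hc) => [s|].
  rewrite -e -spy memv_span //; apply: (allpairs_f (fun p q => y p q)); exact: mem_enum.
rewrite linear_sum -ni (eq_bigr (fun=> 1)) ?sumr_const ?card_ord // => s _.
by rewrite (comatrix_basis_counit _ _ hy) eqxx.
Qed.

Lemma Irr_class d : Irr d <-> exists i, d = irr_char i.
Proof.
split=> [[C /has_character_class[i [_ ->]]]|[i ->]]; first by exists i.
by exists (comat_span (r i)); exact: class_has_character.
Qed.

Lemma sw_tens (h : H) : sw h (fun u v => tens u v) = comul h.
Proof.
apply: tensor_eq => f g hf hg; rewrite (sw_map _ _ (@linear_tlift _ _ _ _ _)).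
by apply: (@sw_ext _ _ k^o) => u v; rewrite tlift_tensE //; bilin.
Qed.

Local Notation Sv := (linfun S).

Lemma antipode_class_subcoalgebra i : subcoalgebra (Sv @: comat_span (r i)).
Proof.
move=> _ /memv_imgP[h /comat_spanP hE ->]; rewrite lfunE /= (sum_comat h) !linear_sum memv_suml // => a _.
rewrite !linear_sum memv_suml // => b _; rewrite !linearZ /=.
have [ria|na] := boolP (r i a); last by rewrite hE // scale0r mem0v.
rewrite memvZ // -sw_tens sw_antipode; last by bilin.
rewrite sw_comat; last by bilin.
rewrite memv_suml // => l _.
have [ral|n] := boolP (r a l); last by rewrite (comat0 n) linear0 (lin0 (@tens_linear_r _ _ _ _)) mem0v.
have imS z : z \in comat_span (r i) -> S z \in (Sv @: comat_span (r i))%VS.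
  by move=> zi; rewrite -[S z](lfunE S) memv_img.
by rewrite tens_mem // imS // mem_comat_span // (mu_trans mu l ria).
Qed.

(** The antipode is an involution that reverses the coproduct, so it carries simple subcoalgebras to
    simple ones. *)
Lemma antipode_class i : exists j, (Sv @: comat_span (r i))%VS = comat_span (r j).
Proof.
have SvK (U : {vspace H}) : (Sv @: (Sv @: U))%VS = U.
  rewrite -limg_comp -[RHS]lim1g; congr (_ @: U)%VS; apply/lfunP => x.
  by rewrite !lfunE /= !lfunE /= antipodeK.
have nz U : U <> 0%VS -> (Sv @: U)%VS <> 0%VS.
  by move=> U0 e; apply: U0; rewrite -[U]SvK e limg0.
apply: simple_class; split.
- exact: antipode_class_subcoalgebra.
- exact/nz/class_neq0.
move=> D sD Di; have [D0|/eqP D0] := eqVneq D 0%VS; [by left | right].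
have [a aD] := subcoalgebra_contains sD D0.
have Sai : (Sv @: comat_span (r a) <= comat_span (r i))%VS.
  by rewrite -[X in (_ <= X)%VS]SvK limgS // (subv_trans aD).
have [b bSa] := subcoalgebra_contains (@antipode_class_subcoalgebra a) (nz _ (@class_neq0 a)).
have rib : r i b := comat_span_class_le (subv_trans bSa Sai).
apply/eqP; rewrite eqEsubv Di /= (subv_trans _ aD) // -[X in (_ <= X)%VS]SvK limgS //.
by rewrite (comat_span_class rib).
Qed.

Lemma antipode_irr_char i : exists2 j, S (irr_char i) = irr_char j &
  (Sv @: comat_span (r i))%VS = comat_span (r j).
Proof.
have [j ij] := antipode_class i; exists j => //.
(* Transposed because the antipode reverses the coproduct, and padded with zeros outside the
   class. *)
pose y a b := if r i a && r i b then S (comat b a) else 0.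
have ty : \sum_a y a a = S (irr_char i).
  by rewrite linear_sum [RHS]big_mkcond; apply: eq_bigr => a _; rewrite /y andbb; case: ifP; rewrite ?linear0.
have hy : comatrix y.
  move=> s t W B hB; rewrite /y; case: ifP => [/andP[ris rit]|n].
    rewrite sw_antipode // sw_comat; last by bilin.
    apply: eq_bigr => l _; rewrite ris rit andbT /=.
    have [ril|nil] := boolP (r i l); first by [].
    by rewrite (comat0 (_ : ~~ r t l)) ?linear0 ?(lin0 (proj2 hB _)) ?(lin0 (proj1 hB _)) // -(mu_trans mu l rit).
  rewrite (lin0 (linear_sw_l B (@linear_id _ _))) big1 // => l _.
  move/negbT: n; rewrite negb_and => /orP[/negPf->|/negPf->]; first by rewrite (lin0 (proj1 hB _)).
  by rewrite andbF (lin0 (proj2 hB _)).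
rewrite -ty; apply: comatrix_irr_char => // [s|].
  rewrite -ij /y andbb; case: ifP => ris; last exact: mem0v.
  by rewrite -[S _](lfunE S) memv_img // mem_comat_span.
rewrite ty counit_antipode counit_irr_char; congr _%:R.
apply/eqP; rewrite -(@eqn_exp2r _ _ 2) // -!dim_class -ij limg_dim_eq //.
apply/eqP; rewrite -subv0; apply/subvP => x; rewrite memv_cap memv_ker lfunE /= => /andP[_ /eqP Sx].
by rewrite -[x]antipodeK Sx linear0 mem0v.
Qed.


(** * Characters fixing a vector and the Hopf subalgebra they generate *)

Section StabilizedCharacters.
Variable v : H.

Definition fixer : {vspace H} := lker (linfun (fun x => x * v - eps x *: v)).

Lemma fixerP x : (x \in fixer) = (x * v == eps x *: v).
Proof.
have h : linear (fun x => x * v - eps x *: v) by lin.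
by rewrite memv_ker (lfunE (lfun_of h)) /= subr_eq0.
Qed.

Definition stab i := irr_char i * v == eps (irr_char i) *: v.

(** Here [stab_class] turns one equation on a character into an inclusion of its whole subcoalgebra
    in a subspace, the form in which products and constituents can be handled. *)
Lemma stab_sub i : stab i = (comat_span (r i) <= fixer)%VS.
Proof.
apply/idP/idP => [/eqP si|/subvP si].
  apply: comat_span_sub => a b ria _; rewrite fixerP; apply/eqP.
  exact: (stab_class si).
rewrite /stab -fixerP; apply: si; apply/comat_spanP => a b na.
rewrite linear_sum /= big1 // => j rij; rewrite dual_E_comat; case: eqP => [e|_]; rewrite ?andbF //.
by rewrite -e rij in na.
Qed.

Lemma stab_r i j : r i j -> stab i = stab j.
Proof. by move=> rij; rewrite !stab_sub (comat_span_class rij). Qed.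

Lemma stab_comat i a b : stab i -> r i a -> comat a b * v = eps (comat a b) *: v.
Proof.
by rewrite stab_sub => /subvP h ria; apply/eqP; rewrite -fixerP h // mem_comat_span.
Qed.

(** Constituents inherit the property: the simple subcoalgebra of a constituent is spanned by slices
    of the comatrix, which stay in [fixer]. *)
Lemma stab_comatrix (J : finType) (y : J -> J -> H) s t a b : comatrix y ->
  (forall u w, y u w \in fixer) -> E a b (y s t) != 0 -> stab a.
Proof.
move=> hy yZ ab0; have rab : r a b by apply: contraNT ab0 => n; rewrite (mu_E0 mu n) zero_lfunE.
rewrite stab_sub; apply: comat_span_sub => p q rap rpq.
apply: (comatrix_comat_mem hy yZ rap _ ab0).
by rewrite -(mu_trans mu b rpq) -(mu_trans mu b rap).
Qed.

Lemma prod_comat_fixer i j u w : stab i -> stab j -> prod_comat i j u w \in fixer.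
Proof.
move=> si sj; rewrite fixerP /prod_comat; case: ifP => [/andP[riu rju]|_]; last first.
  by rewrite mul0r linear0 scale0r.
rewrite -mulrA (stab_comat _ sj) // -scalerAr (stab_comat _ si) // counitM scalerA.
by rewrite mulrC.
Qed.

Variable X : H -> Prop.
Hypothesis XP : forall d, X d <-> Irr d /\ d * v = eps d *: v.

Lemma X_stab d : X d <-> exists2 i, d = irr_char i & stab i.
Proof.
rewrite XP Irr_class; split=> [[[i ->] /eqP si]|[i -> /eqP si]]; first by exists i.
by split=> //; exists i.
Qed.

Lemma stab_closed_mul : closed_under_mul X.
Proof.
have [rep [rrep rep_eq]] := equiv_rep (mu_rel mu).
have repr i j : (rep i == rep j) = r i j.
  apply/eqP/idP => [e|]; last exact: rep_eq.
  by rewrite (mu_trans mu j (rrep i)) e (mu_sym mu).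
move=> _ _ /X_stab[i -> si] /X_stab[j -> sj]; have hc := prod_comat_comatrix i j; split.
  have /fin_all_exists2[mm mmE _] := comatrix_trace hc.
  have mm_class a b : r a b -> mm a = mm b.
    move=> rab; apply: (natr_inj char0); rewrite -!mmE.
    by have := comatrix_trace_class hc rab.
  (* A function on all of $H$ is wanted: the multiplicity of any index whose character is [e], and 0
     if there is none. The choice of index is harmless by [mm_class]. *)
  pose me e := odflt 0%N (omap mm [pick l | irr_char l == e]).
  have meE l : me (irr_char l) = mm l.
    rewrite /me; case: pickP => [l'|/(_ l)]; rewrite /= ?eqxx //.
    by rewrite irr_char_eq => /mm_class.
  (* Only indices fixed by [rep] are listed, one per class, so that no character is repeated. *)
  exists me, [seq irr_char l | l <- enum 'I_m & rep l == l]; split.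
  - rewrite map_inj_in_uniq; first exact/filter_uniq/enum_uniq.
    move=> a b.
    rewrite !mem_filter => /andP[/eqP ra _] /andP[/eqP rb _] /eqP.
    by rewrite irr_char_eq -repr ra rb => /eqP.
  - move=> e; rewrite Irr_class; split=> [/mapP[l _ ->]|[l ->]]; first by exists l.
    apply/mapP; exists (rep l); first by rewrite mem_filter mem_enum repr (mu_sym mu) rrep.
    by apply/eqP; rewrite irr_char_eq.
  rewrite big_map big_filter big_enum_cond /= -prod_comat_trace (comatrix_trace_sum hc).
  rewrite (partition_big rep (fun l => rep l == l)) /=; last first.
    by move=> a _; rewrite repr (mu_sym mu) rrep.
  apply: eq_bigr => l /eqP rl; rewrite meE /irr_char -sumrMnl; apply: eq_big => a.
    by rewrite -[in LHS]rl repr (mu_sym mu).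
  move=> /eqP ral; rewrite mmE scaler_nat (mm_class a l) // -repr ral.
  by rewrite rl.
move=> mult [s [us sP e]] _ /Irr_class[b ->] mb.
have [sPb] : irr_char b \in s by apply/sP/Irr_class; exists b.
(* The decomposition [mult] is arbitrary here. [E b b] is 1 on the character of [b] and 0 on the
   other irreducible characters, so it reads off the multiplicity. *)
have Eb : E b b (irr_char i * irr_char j) != 0.
  rewrite e linear_sum (bigD1_seq (irr_char b)) //= big1_seq ?addr0.
    by rewrite raddfMn /= E_irr_char (mu_refl mu) (natr_eq0 char0); apply/eqP.
  move=> e' /andP[e'b /sP/Irr_class[l el]]; rewrite el raddfMn /= E_irr_char.
  by move: e'b; rewrite el irr_char_eq => /negPf->; rewrite mul0rn.
have [st st0] : exists st, E b b (prod_comat i j st st) != 0.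
  apply: NNPP => no; case/eqP: Eb; rewrite -prod_comat_trace linear_sum /= big1 // => st _.
  by apply/eqP; apply: contraT => h; case: no; exists st.
apply/X_stab; exists b => //.
apply: (stab_comatrix hc _ st0) => u w; exact: prod_comat_fixer.
Qed.

(** Apply $\sum_l S(x_{al})x_{lb} = \epsilon(x_{ab})$ to $v$: each $x_{lb}$ acts on $v$ by the
    counit, so only the term $l = b$ survives. *)
Lemma stab_antipode i a b : stab i -> r i a -> S (comat a b) * v = eps (comat a b) *: v.
Proof.
move=> si ria; have := @sw_Sl _ _ _ (comat a b) (fun z => z * v) (linear_mull _ (@linear_id _ _)).
rewrite mul1r => <-; rewrite sw_comat; last by bilin.
have [rab|n] := boolP (r a b); last first.
  rewrite (comat0 n) linear0 mul0r big1 // => l _.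
  have [ral|nal] := boolP (r a l); last by rewrite (comat0 nal) linear0 !mul0r.
  by rewrite (comat0 (_ : ~~ r l b)) ?mulr0 ?mul0r // -(mu_trans mu b ral).
rewrite (bigD1 b) //= big1 ?addr0 => [|l lb].
  rewrite -mulrA (stab_comat _ si) ?counit_comat ?eqxx ?scale1r //.
  by rewrite (mu_trans mu b ria).
have [ral|nal] := boolP (r a l); last by rewrite (comat0 nal) linear0 !mul0r.
rewrite -mulrA (stab_comat _ si) ?counit_comat ?(negPf lb) ?scale0r ?mulr0 //.
by rewrite (mu_trans mu l ria).
Qed.

Lemma stab_antipode_class i j : stab i -> S (irr_char i) = irr_char j -> stab j.
Proof.
move=> si e; rewrite /stab -e; apply/eqP; rewrite !linear_sum mulr_suml scaler_suml.
by apply: eq_bigr => a ria; rewrite (stab_antipode _ si) // counit_antipode.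
Qed.

Lemma stab_closed_star : closed_under_star X.
Proof.
move=> _ /X_stab[i -> si]; apply/X_stab.
have [j e _] := antipode_irr_char i; exists j => //.
exact: stab_antipode_class si e.
Qed.

Lemma stab_generates : generates X (comat_span stab).
Proof.
have [rep [rrep rep_eq]] := equiv_rep (mu_rel mu).
have repr i j : (rep i == rep j) = r i j.
  apply/eqP/idP => [e|]; last exact: rep_eq.
  by rewrite (mu_trans mu j (rrep i)) e (mu_sym mu).
pose A := [pred i | (rep i == i) && stab i].
pose ev (t : 'I_#|A|) : 'I_m := enum_val t.
have evP t : rep (ev t) = ev t /\ stab (ev t) by have /andP[/eqP] := enum_valP t.
have evr t t' : r (ev t) (ev t') = (t == t').
  by rewrite -repr (evP t).1 (evP t').1 (inj_eq enum_val_inj).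
have evsurj i : stab i -> exists t, r i (ev t).
  move=> si; have iA : rep i \in A.
    by rewrite inE -(stab_r (rrep i)) si andbT repr (mu_sym mu) rrep.
  by exists (enum_rank_in iA (rep i)); rewrite /ev enum_rankK_in.
exists #|A|, (fun t => irr_char (ev t)), (fun t => comat_span (r (ev t))); split.
- by move=> t t' /eqP; rewrite irr_char_eq evr => /eqP.
- move=> x; rewrite X_stab; split=> [[i -> /evsurj[t rit]]|[t ->]].
    by exists t; apply/eqP; rewrite irr_char_eq.
  by exists (ev t); [| exact: (evP t).2].
- by move=> t; exact: class_has_character.
- apply/directv_sumP => t _; apply/eqP; rewrite -subv0; apply/subvP => h.
  rewrite memv_cap => /andP[/comat_spanP ht hs]; rewrite memv0; apply/eqP.
  have {}hs a b : r (ev t) a -> E a b h = 0.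
    move=> ra; have : h \in lker (E a b : 'Hom(H, k^o)).
      apply: subvP hs; apply/subv_sumP => t' /andP[_ t't]; apply/subvP => z /comat_spanP zE.
      rewrite memv_ker zE //; apply: contra t't => rt'.
      by rewrite -evr (mu_trans mu _ rt') (mu_sym mu).
    by rewrite memv_ker => /eqP.
  rewrite (sum_comat h) big1 // => a _; rewrite big1 // => b _.
  have [ra|na] := boolP (r (ev t) a); first by rewrite hs // scale0r.
  by rewrite ht // scale0r.
apply/eqP; rewrite eqEsubv; apply/andP; split.
  apply: comat_span_sub => a b /evsurj[t rat] _.
  by apply: (subvP (sumv_sup t _ (subvv _))) => //; rewrite mem_comat_span // (mu_sym mu).
apply/subv_sumP => t _; apply: comat_span_sub => a b ra _; apply: mem_comat_span.
by rewrite -(stab_r ra) (evP t).2.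
Qed.

Lemma stab_hopf_subalgebra : hopf_subalgebra (comat_span stab).
Proof.
split.
(* The unit is a comatrix of size one that fixes [v], so its constituents are stabilizing. *)
- apply/comat_spanP => a b na; apply/eqP; apply: contraT => h; case/negP: na.
  apply: (@stab_comatrix _ _ tt tt a b unit_comatrix _ h) => _ _.
  by rewrite fixerP mul1r counit1 scale1r.
- apply/prodvP => x z /comat_spanP hx /comat_spanP hz.
  rewrite (sum_comat x) mulr_suml memv_suml // => a _; rewrite mulr_suml memv_suml // => b _.
  have [sa|na] := boolP (stab a); last by rewrite hx // scale0r mul0r mem0v.
  rewrite -scalerAl memvZ // (sum_comat z) mulr_sumr memv_suml // => p _.
  rewrite mulr_sumr memv_suml // => q _.
  have [sp|np] := boolP (stab p); last by rewrite hz // scale0r mulr0 mem0v.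
  rewrite -scalerAr memvZ //; apply/comat_spanP => c d nc.
  apply/eqP; apply: contraT => h; case/negP: nc.
  apply: (@stab_comatrix _ _ (a, p) (b, q) c d (prod_comat_comatrix a p)) => [u w|].
    exact: prod_comat_fixer.
  by rewrite /prod_comat /= !(mu_refl mu).
- by apply: comat_span_subcoalgebra => a b /stab_r->.
- move=> x /comat_spanP hx; rewrite (sum_comat x) linear_sum memv_suml // => a _.
  rewrite linear_sum memv_suml // => b _; rewrite linearZ /=.
  have [sa|na] := boolP (stab a); last by rewrite hx // scale0r mem0v.
  have [j e ej] := antipode_irr_char a; have sj := stab_antipode_class sa e.
  rewrite memvZ //; have : S (comat a b) \in comat_span (r j).
    by rewrite -ej -[S _](lfunE S) memv_img // mem_comat_span ?(mu_refl mu).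
  by apply: subvP; apply: comat_span_sub => p q rjp _; rewrite mem_comat_span // -(stab_r rjp).
Qed.

End StabilizedCharacters.

End Cosemisimple.

Theorem proposition25 (k : closedFieldType) (char0 : [pchar k] =i pred0)
    (H : hopfAlgType k) (ssH : semisimple H)
    (K : {vspace H}) (hopfK : hopf_subalgebra K)
    (LaK : H) (intK : normalized_integral K LaK)
    (C : {vspace H}) (simC : simple_subcoalgebra C)
    (c : H) (charC : has_character C c) :
  [/\ closed_under_mul (stab_chars c LaK),
      closed_under_star (stab_chars c LaK)
    & exists2 CK : {vspace H},
        generates (stab_chars c LaK) CK & hopf_subalgebra CK].
Proof.
have [m [r [E [M mu]]]] := dual_wedderburn char0 ssH.
have XP d : stab_chars c LaK d <-> Irr d /\ d * (c * LaK) = counit d *: (c * LaK).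
  by rewrite /stab_chars mulrA.
split; [exact: (stab_closed_mul char0 ssH mu XP) | exact: (stab_closed_star char0 ssH mu XP) |].
exists (comat_span E (stab r E (c * LaK))).
  exact: (stab_generates char0 ssH mu XP).
exact: (stab_hopf_subalgebra char0 ssH mu).
Qed.
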